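(* Let $\mathcal{F}\in\mathcal{D}^{\mathrm h}(n)$ and suppose $D\in\mathrm{div}^{\mathrm h}(\mathcal{F})$. Then there exist coordinates $(x,y)$ of $(\mathbb{C}^2,0)$ in which $\mathcal{F}$ is represented by a form $$W(x,y)(x\,dy-y\,dx)+Q(x,y)\,dx$$ such that $W$ is a Weierstrass polynomial in $y$ of degree and order $n$, $Q$ is a homogeneous polynomial of degree $n+2$ such that $xQ=0$ represents $D$, and $Q(1,y)$ is monic. With these conditions the form is unique up to a choice of affine coordinate in $E$ and local biholomorphisms tangent to a homothety.
   Context: A germ of holomorphic foliation $\mathcal{F}$ on $(\mathbb{C}^2,0)$ is given by a germ of 1-form (or vector field) with at most an isolated zero; its multiplicity is the order of vanishing at $0$. $E\cong\mathbb{P}^1$ is the exceptional divisor of the blow-up of $0$ and $\widetilde{\mathcal{F}}$ the saturated pull-back of $\mathcal{F}$. $\mathcal{D}(n)$ is the set of germs $\mathcal{F}$ of multiplicity $n+1$ such that $\widetilde{\mathcal{F}}$ has no singular point on $E$. $\mathcal{D}(0)$ is the set of radial foliations (defined by vector fields with linear part $x\partial_x+y\partial_y$). For $\mathcal{F}=\{\omega=0\}\in\mathcal{D}(n)$ and $\mathcal{G}\in\mathcal{D}(0)$ defined by a vector field $X$, $\mathrm{Tang}(\mathcal{F},\mathcal{G})$ is the divisor of zeros of $\omega(X)$, and $\mathrm{Tang}(\mathcal{F},\mathcal{G})_{|E}$ is the restriction to $E$ of the tangency divisor of the lifted foliations; it is an effective divisor of degree $n+3$. $\mathcal{F}$ is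 homogeneous with respect to $\mathcal{G}$ if $\mathrm{Tang}(\mathcal{F},\mathcal{G})$ is invariant by $\mathcal{F}$; $\mathcal{D}^{\mathrm h}(n)$ is the set of $\mathcal{F}\in\mathcal{D}(n)$ homogeneous with respect to some $\mathcal{G}\in\mathcal{D}(0)$, and $\mathrm{div}^{\mathrm h}(\mathcal{F})$ is the set of divisors $\mathrm{Tang}(\mathcal{F},\mathcal{G})_{|E}$ with $\mathcal{G}\in\mathcal{D}(0)$ such that $\mathcal{F}$ is homogeneous with respect to $\mathcal{G}$. A Weierstrass polynomial in $y$ is a monic polynomial in $\mathbb{C}\{x\}[y]$; its order is its order of vanishing at $(0,0)$. A homogeneous polynomial of degree $k$ in $(x,y)$ represents an effective divisor of degree $k$ on $E=\mathbb{P}(\mathbb{C}^2)$, its zero divisor. A biholomorphism is tangent to a homothety if its linear part is $\lambda\,\mathrm{Id}$, $\lambda\in\mathbb{C}^*$. *)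

(* Defs.v *)
From HB Require Import structures.
From mathcomp Require Import all_boot all_order all_algebra.
From mathcomp Require Import complex.
From mathcomp Require Import boolp classical_sets functions reals topology normedtype.

Set Implicit Arguments.
Unset Strict Implicit.
Unset Printing Implicit Defensive.

Import Order.TTheory GRing.Theory Num.Theory.
Import numFieldNormedType.Exports.
Local Open Scope ring_scope.

(* The ring K[[T]]; its product is the Cauchy product, not the pointwise
   product of functions. *)
Definition pseries (K : Type) := nat -> K.

HB.instance Definition _ (K : comNzRingType) :=
  GRing.Zmodule.copy (pseries K) (nat -> K).

Section PowerSeriesRing.
Variable K : comNzRingType.
Implicit Types f g h : pseries K.

Definition ps_one : pseries K := fun n => (n == 0)%:R.

Definition ps_mul f g : pseries K :=
  fun n => \sum_(k < n.+1) f k * g (n - k)%N.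

Let trunc N f : {poly K} := \poly_(i < N) f i.

Let truncE N f n : (n < N)%N -> (trunc N f)`_n = f n.
Proof. by move=> nN; rewrite coef_poly nN. Qed.

Let coef_trunc_mul N (p q : {poly K}) f g n : (n < N)%N ->
    (forall i, (i < N)%N -> p`_i = f i) -> (forall i, (i < N)%N -> q`_i = g i) ->
  (p * q)`_n = ps_mul f g n.
Proof.
move=> nN pE qE; rewrite coefM; apply: eq_bigr => -[k kn] _ /=.
by rewrite pE ?qE //; apply: leq_ltn_trans nN; rewrite ?leq_subr.
Qed.

Let truncM N f g n : (n < N)%N ->
  (trunc N f * trunc N g)`_n = ps_mul f g n.
Proof. by move=> nN; apply: (coef_trunc_mul nN) => i; apply: truncE. Qed.

Fact ps_mulA : associative ps_mul.
Proof.
move=> f g h; apply/funext => n.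
have nN : (n < n.+1)%N by [].
rewrite -(@coef_trunc_mul n.+1 (trunc n.+1 f) (trunc n.+1 g * trunc n.+1 h)) //.
- rewrite mulrA (@coef_trunc_mul n.+1 _ _ (ps_mul f g) h) // => i iN.
  + exact: truncM.
  + exact: truncE.
- by move=> i; apply: truncE.
- by move=> i; apply: truncM.
Qed.

Fact ps_mulC : commutative ps_mul.
Proof. by move=> f g; apply/funext => n; rewrite -!(@truncM n.+1) // mulrC. Qed.

Fact ps_mul1 : left_id ps_one ps_mul.
Proof.
move=> f; apply/funext => n; rewrite /ps_mul big_ord_recl /= /ps_one mul1r subn0.
by rewrite big1 ?addr0 // => i _; rewrite mul0r.
Qed.

Fact ps_mulDl : left_distributive ps_mul (+%R : pseries K -> _ -> _).
Proof.
move=> f g h; apply/funext => n; rewrite /ps_mul -[RHS]big_split /=.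
by apply: eq_bigr => i _; rewrite -mulrDl.
Qed.

Fact ps_one_neq0 : ps_one != 0 :> pseries K.
Proof.
apply/eqP => /(congr1 (fun f : pseries K => f 0%N)) /= /eqP.
by rewrite /ps_one eqxx oner_eq0.
Qed.

HB.instance Definition _ := GRing.Zmodule_isComNzRing.Build (pseries K)
  ps_mulA ps_mulC ps_mul1 ps_mulDl ps_one_neq0.

End PowerSeriesRing.

(* C[[x, y]]: [f i j] is the coefficient of x^i y^j. *)
Notation series2 R := (pseries (pseries R[i])).

Section Series.
Variable R : realType.
Local Notation C := R[i].
Implicit Types (f g p q : series2 R).

Definition Xs : series2 R := fun i j => ((i == 1) && (j == 0))%:R.
Definition Ys : series2 R := fun i j => ((i == 0) && (j == 1))%:R.

(* Absolute convergence on some polydisc: f defines an element of C{x, y}.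
   For r M : C, [0 < r] forces r to be real, and [_ <= M] forces M to be. *)
Definition convergent f := exists r M : C, 0 < r /\
  forall N, \sum_(i < N) \sum_(j < N) `|f i j| * r ^+ (i + j) <= M.

Definition sums_to f (x y z : C) :=
  (((fun N => \sum_(i < N) \sum_(j < N) f i j * x ^+ i * y ^+ j) : nat -> C^o)
     @ \oo --> (z : C^o))%classic.

Definition psdx f : series2 R := fun i j => f i.+1 j *+ i.+1.
Definition psdy f : series2 R := fun i j => f i j.+1 *+ j.+1.

(* f(p, q).  When p and q have no constant term, f_kl p^k q^l contributes to
   the coefficient of x^i y^j only if k + l <= i + j, so the sum is exact. *)
Definition pscomp f p q : series2 R := fun i j =>
  \sum_(k < (i + j).+1) \sum_(l < (i + j).+1) f k l * (p ^+ k * q ^+ l) i j.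

Definition psswap f : series2 R := fun i j => f j i.

Definition order_ge f m := forall i j, (i + j < m)%N -> f i j = 0.

Definition has_order f m := order_ge f m /\ ~ order_ge f m.+1.

Definition homogeneous m f := forall i j, (i + j)%N != m -> f i j = 0.

Definition linear_part f : series2 R :=
  fun i j => if (i + j)%N == 1 then f i j else 0.

(* f_m(1, T), where f_m is the homogeneous component of degree m of f. *)
Definition dehom m f : {poly C} := \poly_(j < m.+1) f (m - j)%N j.

(* Monic polynomial of degree m in C{x}[y]. *)
Definition weierstrass_poly m f :=
  convergent f /\ forall i j, (m <= j)%N -> f i j = ((i == 0) && (j == m))%:R.

End Series.

Arguments Xs {R}.
Arguments Ys {R}.

Section Germs.
Variable R : realType.
Local Notation C := R[i].

(* (a, b) is a dx + b dy. *)
Definition oneform := (series2 R * series2 R)%type.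
(* (a, b) is a d/dx + b d/dy. *)
Definition vfield := (series2 R * series2 R)%type.
(* (p, q) is the map (x, y) |-> (p(x, y), q(x, y)). *)
Definition germmap := (series2 R * series2 R)%type.

Implicit Types (w : oneform) (X : vfield) (F G H : germmap).

Definition contract w X : series2 R := w.1 * X.1 + w.2 * X.2.

Definition pullback F w : oneform :=
  let a := pscomp w.1 F.1 F.2 in let b := pscomp w.2 F.1 F.2 in
  (a * psdx F.1 + b * psdx F.2, a * psdy F.1 + b * psdy F.2).

Definition holomorphic (v : series2 R * series2 R) :=
  convergent v.1 /\ convergent v.2.

Definition inverse_maps F G :=
  pscomp G.1 F.1 F.2 = Xs /\ pscomp G.2 F.1 F.2 = Ys.

Definition biholomorphism F :=
  [/\ holomorphic F, F.1 0%N 0%N = 0, F.2 0%N 0%N = 0 &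
      exists G, [/\ holomorphic G, G.1 0%N 0%N = 0, G.2 0%N 0%N = 0,
                    inverse_maps F G & inverse_maps G F]].

Definition tangent_to_homothety F := exists2 c : C, c != 0 &
  linear_part F.1 = (fun i j => c * Xs i j) /\
  linear_part F.2 = (fun i j => c * Ys i j).

(* w and w' differ by a nowhere vanishing holomorphic factor. *)
Definition same_foliation w w' := exists U : series2 R,
  [/\ convergent U, U 0%N 0%N != 0, w.1 = U * w'.1 & w.2 = U * w'.2].

Definition isolated_zero w := exists2 r : C, 0 < r &
  forall x y : C, `|x| < r -> `|y| < r ->
    sums_to w.1 x y 0 -> sums_to w.2 x y 0 -> x = 0 /\ y = 0.

Definition foliation w := holomorphic w /\ isolated_zero w.

Definition multiplicity w m :=
  [/\ order_ge w.1 m, order_ge w.2 m & ~ (order_ge w.1 m.+1 /\ order_ge w.2 m.+1)].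

(** Blow-up of the origin.  The points of the exceptional divisor E are
    [Some t], the direction (1 : t), and [None], the direction (0 : 1).

    The chart (x, t) |-> (x, t x) contains all the points [Some t].  A function
    which is holomorphic near the affine part of E is expanded in powers of x;
    here its coefficients are polynomials in t, so that it is encoded as a
    sequence of polynomials.  The other chart (s, y) |-> (s y, y) is the first
    one after exchange of the variables; [None] is its point s = 0. *)

Definition expt := option C.

Definition chartfun := nat -> {poly C}.

Definition blowup (f : series2 R) : chartfun := fun d => dehom d f.

Definition shiftx (A : chartfun) : chartfun :=
  fun d => if d is d'.+1 then A d' else 0.

(* The pull-back of a dx + b dy is (a + t b) dx + x b dt. *)
Definition blowup_form w : chartfun * chartfun :=
  ((fun d => blowup w.1 d + 'X * blowup w.2 d), shiftx (blowup w.2)).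

(* x times the lift of a d/dx + b d/dy, i.e. x a d/dx + (b - t a) d/dt. *)
Definition blowup_field X : chartfun * chartfun :=
  (shiftx (blowup X.1), (fun d => blowup X.2 d - 'X * blowup X.1 d)).

(* (a0, b0) is the restriction to x = 0 of (A, B) divided by the largest power
   of x dividing both A and B. *)
Definition saturated_on_E (AB : chartfun * chartfun) (a0 b0 : {poly C}) :=
  exists m, [/\ forall d, (d < m)%N -> AB.1 d = 0 /\ AB.2 d = 0,
                a0 = AB.1 m, b0 = AB.2 m & (a0 != 0) || (b0 != 0)].

Definition swap_pair (v : series2 R * series2 R) : series2 R * series2 R :=
  (psswap v.2, psswap v.1).

Definition regular_on_chart w := exists a0 b0,
  saturated_on_E (blowup_form w) a0 b0 /\ forall t, ~ (root a0 t /\ root b0 t).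

Definition regular_on_E w :=
  regular_on_chart w /\ regular_on_chart (swap_pair w).

(* The foliations D(n). *)
Definition Dclass n w :=
  [/\ foliation w, multiplicity w n.+1 & regular_on_E w].

(* Generators of the foliations in D(0). *)
Definition radial X :=
  [/\ holomorphic X, X.1 0%N 0%N = 0, X.2 0%N 0%N = 0,
      linear_part X.1 = Xs & linear_part X.2 = Ys].

(* Divisors on E, as multiplicity functions. *)
Definition divisor := expt -> nat.

(* The zero divisor of a homogeneous polynomial of degree k. *)
Definition zero_divisor k (P : series2 R) : divisor := fun e =>
  if e is Some t then mup t (dehom k P) else mup 0 (dehom k (psswap P)).

(* P is an equation, on the affine part of E, of the restriction to E of the
   tangency divisor of the lifted foliations. *)
Definition tang_chart w X (P : {poly C}) := exists a0 b0 u0 v0,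
  [/\ saturated_on_E (blowup_form w) a0 b0,
      saturated_on_E (blowup_field X) u0 v0 & P = a0 * u0 + b0 * v0].

(* P, P' != 0: the restriction to E is a divisor only if E is not contained in
   the tangency locus of the lifted foliations. *)
Definition tang_on_E w X (D : divisor) := exists P P' : {poly C},
  [/\ tang_chart w X P, tang_chart (swap_pair w) (swap_pair X) P',
      P != 0, P' != 0 &
      (forall t, D (Some t) = mup t P) /\ D None = mup 0 P'].

(* The divisor of zeros of f is invariant by {w = 0}: f divides w /\ df. *)
Definition invariant_divisor w (f : series2 R) := exists2 h : series2 R,
  convergent h & w.1 * psdy f - w.2 * psdx f = f * h.

Definition homogeneous_wrt w X :=
  contract w X <> 0 /\ invariant_divisor w (contract w X).

(* The foliations D^h(n). *)
Definition Dhclass n w :=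
  Dclass n w /\ exists X, radial X /\ homogeneous_wrt w X.

Definition divh w (D : divisor) :=
  exists X, [/\ radial X, homogeneous_wrt w X & tang_on_E w X D].

(* The affine coordinate y/x induced on E by the coordinate system F = (x, y),
   as a map from E to C + {infinity}. *)
Definition affine_coordinate F (e : expt) : option C :=
  let L p : C := let: (a, b) := if e is Some t then (1, t) else (0, 1) in
                 p 1%N 0%N * a + p 0%N 1%N * b in
  if L F.1 == 0 then None else Some (L F.2 / L F.1).

(* W (x dy - y dx) + Q dx *)
Definition nform (W Q : series2 R) : oneform := (Q - W * Ys, W * Xs).

(* In the coordinates F = (x, y), the foliation {w = 0} is represented by
   nform W Q, with the required conditions on W, Q and D.  The divisor xQ = 0 is
   read on E by means of the linear part of F. *)
Definition normal_form n w (D : divisor) F (W Q : series2 R) :=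
  [/\ biholomorphism F,
      same_foliation (pullback F (nform W Q)) w,
      weierstrass_poly n W /\ has_order W n,
      homogeneous n.+2 Q /\ dehom n.+2 Q \is monic &
      forall e, D e = zero_divisor n.+3
        (pscomp (Xs * Q) (linear_part F.1) (linear_part F.2)) e].

End Germs.

(* Main.v *)
(* Existence.  By Poincare's theorem the radial vector field X can be taken to
   be x d/dx + y d/dy, with (0 : 1) a point of D.  Then f = w(X) divides the
   products of its Euler derivative with the coefficients of w.  Since w has no
   singular point on E, a degree by degree argument in the blow-up shows that f
   is a unit times a homogeneous polynomial x Q, and w is the same unit times
   W (x dy - y dx) + Q dx, where W(0, y) has order n.  The substitutions
   (x, y) |-> (u x, u y) preserve this shape and Q; asking that the new W be a
   Weierstrass polynomial is, in the chart (x, t) = (x, y / x), a recursion on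
   the coefficients of u solved by Euclidean division by the leading term w_0(t)
   of W, and majorants give the convergence of u.

   Uniqueness.  The affine coordinate and D determine Q, with leading term q(t).
   A conjugacy between two normal forms, tangent to a homothety, lifts to
   (X, T) = (c x + O(x^2), t + O(x)) with q(T) K(X) + w'(X, T) K(T) = 0, where
   K = q d/dt - w d/dx.  At each order in x, w' - w is divisible by w_0, which is
   prime to q, and has smaller degree: it vanishes.  The conjugacy is then, at
   that order, a flow of K up to which (X, T) can be corrected, and the next
   order can be treated. *)
From HB Require Import structures.
From mathcomp Require Import all_boot all_order all_algebra.
From mathcomp Require Import zify ring lra.
From mathcomp Require Import complex.
From mathcomp Require Import boolp classical_sets functions reals topology normedtype.
Require Import Defs.

Set Implicit Arguments.
Unset Strict Implicit.
Unset Printing Implicit Defensive.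

Import Order.TTheory GRing.Theory Num.Theory.
Import numFieldNormedType.Exports.
Local Open Scope ring_scope.

(** * Power series, substitution and blow-up *)

(** Almost everything takes place in C[t][[x]], into which [bl] embeds C[[x, y]] by f(x, y) -> f(x,
    t x). The embedding is not onto: a series comes from the plane exactly when its coefficient of
    x^d has degree at most d in t. In the existence proof each construction in the chart therefore
    carries a degree bound beside its equation, and this bound allows it to be blown down. The same
    bound protects the analysis. The recursion for u contains u_t, and a derivative would normally
    shrink the domain at each step; here it costs at most the degree, which the division needed to
    solve u + x u_x = 1 + x beta absorbs. Division by w_0 costs a bounded factor once the radius rho
    in t is large, and rho is free since it only rescales the radius in y. All estimates bear on
    truncated sums, so that no infinite sum has to exist beforehand. In the uniqueness proof the
    obstacle is that corrected conjugacies have no simple formula, and nothing records whether they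
    still come from the plane. They are handled as abstract continuous endomorphisms of C[t][[x]],
    and the argument is formal. *)

Section Antidiagonal.
Variable V : nmodType.
Implicit Types h : nat -> nat -> V.

Lemma sum_antidiag h N :
  \sum_(d < N) \sum_(j < d.+1) h (d - j)%N j
  = \sum_(k < N) \sum_(l < N - k) h k l.
Proof.
elim: N => [|N IH]; first by rewrite !big_ord0.
rewrite big_ord_recr /= IH [in RHS]big_ord_recr /=.
under [in RHS]eq_bigr => k _.
  rewrite subSn; last by rewrite ltnW.
  rewrite big_ord_recr /=; over.
rewrite big_split /= -addrA; congr (_ + _).
rewrite subSn // subnn big_ord1.
rewrite (reindex_inj rev_ord_inj) /= big_ord_recr /= subnn; congr (_ + _).
  by apply: eq_bigr => k _; rewrite !subSS subKn // ltnW.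
by rewrite subn0.
Qed.

Lemma sum_sub_ord (h : nat -> V) N a :
  \sum_(l < N - a) h l = \sum_(l < N) if (a + l < N)%N then h l else 0.
Proof.
rewrite (big_ord_widen N h (leq_subr a N)) big_mkcond /=.
by apply: eq_bigr => i _; congr (if _ then _ else _); apply/idP/idP; lia.
Qed.

(** Turning nested ranges into a cube with an indicator removes the dependent bounds, after which
    the order of summation can be changed freely. *)
Lemma sum_triple (s : nat -> nat -> nat -> V) d :
  \sum_(k < d.+1) \sum_(l < k.+1) \sum_(m < (d - k).+1) s (k - l)%N l m
  = \sum_(x < d.+1) \sum_(l < d.+1) \sum_(z < d.+1)
      if (x + l + z < d.+1)%N then s x l z else 0.
Proof.
pose h x l := \sum_(z < d.+1 - (x + l)) s x l z.
transitivity (\sum_(k < d.+1) \sum_(l < k.+1) h (k - l)%N l).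
  apply: eq_bigr => -[k /= kd] _; apply: eq_bigr => -[l /= lk] _.
  by rewrite /h subnK // subSn.
rewrite sum_antidiag; apply: eq_bigr => x _; rewrite sum_sub_ord.
apply: eq_bigr => l _; rewrite /h sum_sub_ord; case: ifP => // xl.
by rewrite big1 // => z _; case: ifP => // xlz; lia.
Qed.

Lemma triple_antidiag (t : nat -> nat -> nat -> V) d :
  \sum_(j < d.+1) \sum_(l < j.+1) \sum_(a < (d - j).+1) t a l (j - l)%N
  = \sum_(k < d.+1) \sum_(l < k.+1) \sum_(m < (d - k).+1) t (k - l)%N l m.
Proof.
rewrite sum_triple (sum_triple (fun x l z => t z l x)) exchange_big /=.
under eq_bigr do rewrite exchange_big /=.
rewrite exchange_big /=; apply: eq_bigr => x _; apply: eq_bigr => l _.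
apply: eq_bigr => z _; congr (if _ then _ else _); apply/idP/idP; lia.
Qed.

End Antidiagonal.

Section PseriesTheory.
Variable K : comNzRingType.
Implicit Types (f g h : pseries K) (c : K).

Lemma psD f g n : (f + g) n = f n + g n. Proof. by []. Qed.
Lemma psN f n : (- f) n = - f n. Proof. by []. Qed.
Lemma ps0 n : (0 : pseries K) n = 0. Proof. by []. Qed.
Lemma psB f g n : (f - g) n = f n - g n. Proof. by []. Qed.
Lemma ps1 n : (1 : pseries K) n = (n == 0)%:R. Proof. by []. Qed.
Lemma psM f g n : (f * g) n = \sum_(k < n.+1) f k * g (n - k)%N. Proof. by []. Qed.

Lemma ps_sum I (r : seq I) P (F : I -> pseries K) n :
  (\sum_(i <- r | P i) F i) n = \sum_(i <- r | P i) F i n.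
Proof. by elim/big_rec2: _ => // i x y _ <-. Qed.

Lemma psMn f m n : (f *+ m) n = f n *+ m.
Proof. by elim: m => // m IH; rewrite !mulrS psD IH. Qed.

Lemma psM0 f g : (f * g) 0%N = f 0%N * g 0%N.
Proof. by rewrite psM big_ord1. Qed.

Definition psC c : pseries K := fun n => if n is 0 then c else 0.

Lemma psCM c f n : (psC c * f) n = c * f n.
Proof.
rewrite psM big_ord_recl /= subn0 big1 ?addr0 // => i _.
by rewrite /psC /= mul0r.
Qed.

Fact psC_is_zmod_morphism : zmod_morphism psC.
Proof. by move=> a b; apply/funext => -[|n]; rewrite psB //= subr0. Qed.

Fact psC_is_monoid_morphism : monoid_morphism psC.
Proof.
split; first by apply/funext => -[].
by move=> a b; apply/funext => n; rewrite psCM; case: n => //= n; rewrite mulr0.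
Qed.

HB.instance Definition _ :=
  GRing.isZmodMorphism.Build K (pseries K) psC psC_is_zmod_morphism.
HB.instance Definition _ :=
  GRing.isMonoidMorphism.Build K (pseries K) psC psC_is_monoid_morphism.

Definition psX : pseries K := fun n => (n == 1)%:R.

Lemma psXM f n : (psX * f) n = if n is m.+1 then f m else 0.
Proof.
rewrite psM; case: n => [|n]; first by rewrite big_ord1 mul0r.
rewrite 2!big_ord_recl /= mul0r add0r mul1r subSS subn0 big1 ?addr0 //.
by move=> i _; rewrite /psX /= mul0r.
Qed.

Lemma psXnM f k n : (psX ^+ k * f) n = if (k <= n)%N then f (n - k)%N else 0.
Proof.
elim: k n => [|k IH] n; first by rewrite expr0 mul1r subn0.
by rewrite exprS -mulrA psXM; case: n => // n; rewrite IH.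
Qed.

Lemma psXn_inj k f g : psX ^+ k * f = psX ^+ k * g -> f = g.
Proof.
move=> /(congr1 (fun h : pseries K => h (k + _)%N)) e; apply/funext => n.
by have := e n; rewrite !psXnM leq_addr addKn.
Qed.

Definition psvanish N f := forall d, (d < N)%N -> f d = 0.

Lemma psvanish0 f : psvanish 0 f. Proof. by []. Qed.

Lemma psvanishW M N f : (N <= M)%N -> psvanish M f -> psvanish N f.
Proof. by move=> NM fM d dN; apply: fM; apply: leq_trans NM. Qed.

Lemma psvanishD N f g : psvanish N f -> psvanish N g -> psvanish N (f + g).
Proof. by move=> fN gN d dN; rewrite psD fN // gN // addr0. Qed.

Lemma psvanishN N f : psvanish N f -> psvanish N (- f).
Proof. by move=> fN d dN; rewrite psN fN // oppr0. Qed.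

Lemma psvanishB N f g : psvanish N f -> psvanish N g -> psvanish N (f - g).
Proof. by move=> fN gN; apply: psvanishD => //; apply: psvanishN. Qed.

Lemma psvanish_sum I (r : seq I) (P : pred I) (F : I -> pseries K) N :
  (forall i, P i -> psvanish N (F i)) -> psvanish N (\sum_(i <- r | P i) F i).
Proof.
by move=> FN d dN; rewrite ps_sum big1 // => i Pi; apply: FN.
Qed.

Lemma psvanishM M N f g :
  psvanish M f -> psvanish N g -> psvanish (M + N) (f * g).
Proof.
move=> fM gN d dMN; rewrite psM big1 // => -[k /= kd] _.
have [kM|Mk] := ltnP k M; first by rewrite fM // mul0r.
by rewrite gN ?mulr0 //; lia.
Qed.

Lemma psvanishMl N f g : psvanish N g -> psvanish N (f * g).
Proof. exact: (psvanishM (psvanish0 f)). Qed.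

Lemma psvanishMr N f g : psvanish N f -> psvanish N (f * g).
Proof. by rewrite mulrC; apply: psvanishMl. Qed.

Lemma psvanishX N f k : psvanish N f -> psvanish (N * k) (f ^+ k).
Proof.
move=> fN; elim: k => [|k IH]; first by rewrite muln0.
by rewrite exprS mulnS; apply: psvanishM.
Qed.

Lemma psvanish_inj f : (forall N, psvanish N f) -> f = 0.
Proof. by move=> fN; apply/funext => n; apply: (fN n.+1). Qed.

Lemma psvanishXn N f : psvanish N f -> exists g, f = psX ^+ N * g.
Proof.
move=> fN; exists (fun n => f (N + n)%N); apply/funext => n.
by rewrite psXnM; case: ltnP => [/fN //|Nn]; rewrite subnKC.
Qed.

Lemma psM_lead M N f g : psvanish M f -> psvanish N g ->
  (f * g) (M + N)%N = f M * g N.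
Proof.
move=> fM gN; rewrite psM.
have MMN : (M < (M + N).+1)%N by lia.
rewrite (bigD1 (Ordinal MMN)) //= addKn big1 ?addr0 // => -[k /= kd].
rewrite -val_eqE /= => kM; have [kltM|Mk] := ltnP k M; first by rewrite fM // mul0r.
by rewrite gN ?mulr0 //; lia.
Qed.

(** Geometric series. The inverse [c] of the constant term is a datum because K is only a ring: the
    lemma is applied to C, then to C[[y]], and also to C[t]. *)
Lemma ps_inv c f : c * f 0%N = 1 -> exists g, f * g = 1.
Proof.
move=> cf0; pose u := 1 - psC c * f.
have u1 : psvanish 1 u by case=> // _; rewrite /u psB psCM cf0 subrr.
(* u^k has order at least k, so the coefficient of index n of the partial sums is stationary from n
   + 1 terms on. *)
pose s : pseries K := fun n => (\sum_(k < n.+1) u ^+ k) n.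
have sE N n : (n < N)%N -> s n = (\sum_(k < N) u ^+ k) n.
  move=> nN; rewrite /s !ps_sum.
  rewrite (big_ord_widen N (fun k => (u ^+ k) n)) // big_mkcond /=.
  apply: eq_bigr => k _; case: ifP => // kn.
  by rewrite (psvanishX (k := k) u1) //; lia.
suff : (1 - u) * s = 1.
  by rewrite /u opprB addrC subrK => us; exists (psC c * s); rewrite mulrA [f * _]mulrC.
apply/funext => n; have -> : ((1 - u) * s) n = ((1 - u) * (\sum_(k < n.+1) u ^+ k)) n.
  rewrite !psM; apply: eq_bigr => -[k /= kn] _; rewrite (@sE n.+1) //; lia.
rewrite -opprB mulNr -subrX1 opprB psB (psvanishX (k := n.+1) u1) ?subr0 //; lia.
Qed.

Definition psd f : pseries K := fun n => f n.+1 *+ n.+1.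

Lemma psdM f g : psd (f * g) = psd f * g + f * psd g.
Proof.
apply/funext => n; rewrite psD {1}/psd psM.
have -> : (\sum_(k < n.+2) f k * g (n.+1 - k)%N) *+ n.+1 =
  \sum_(k < n.+2) (f k *+ k) * g (n.+1 - k)%N
  + \sum_(k < n.+2) f k * (g (n.+1 - k)%N *+ (n.+1 - k)%N).
  rewrite -big_split -sumrMnl; apply: eq_bigr => -[k /= kn] _.
  by rewrite mulrnAl mulrnAr -mulrnDr subnKC.
congr (_ + _).
  by rewrite big_ord_recl mulr0n mul0r add0r psM; apply: eq_bigr.
rewrite big_ord_recr /= subnn mulr0n mulr0 addr0 psM.
by apply: eq_bigr => -[k /= kn] _; rewrite /psd subSn.
Qed.

Fact psd_is_zmod_morphism : zmod_morphism psd.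
Proof. by move=> f g; apply/funext => n; rewrite psB /psd mulrnBl. Qed.

HB.instance Definition _ := GRing.isZmodMorphism.Build
  (pseries K) (pseries K) psd psd_is_zmod_morphism.

(** The substitution of a single variable for both. It serves to collect homogeneous components, and
    later to evaluate a series in an auxiliary variable z at z = x. *)
Definition delta (F : pseries (pseries K)) : pseries K :=
  fun d => \sum_(j < d.+1) F (d - j)%N j.

End PseriesTheory.

Section Delta.
Variable K : comNzRingType.

Fact delta_is_zmod_morphism : zmod_morphism (@delta K).
Proof.
move=> F G; apply/funext => d; rewrite psB /delta -sumrB.
by apply: eq_bigr => j _; rewrite !psB.
Qed.

Fact delta_is_monoid_morphism : monoid_morphism (@delta K).
Proof.
split.
  apply/funext => d; rewrite /delta; case: d => [|d]; first by rewrite big_ord1.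
  rewrite big1 // => -[[|j] /= jd] _; rewrite !ps1 ?subn0 //=.
  by case: (d.+1 - j.+1)%N.
move=> F G; apply/funext => d; rewrite psM /delta.
pose t a l m := F a l * G (d - (l + m) - a)%N m.
transitivity (\sum_(j < d.+1) \sum_(l < j.+1) \sum_(a < (d - j).+1) t a l (j - l)%N).
  apply: eq_bigr => -[j /= jd] _; rewrite psM ps_sum.
  transitivity (\sum_(a < (d - j).+1) \sum_(l < j.+1) F a l * G (d - j - a)%N (j - l)%N) => //.
  rewrite exchange_big /=; apply: eq_bigr => -[l /= lj] _.
  by apply: eq_bigr => a _; rewrite /t subnKC.
rewrite triple_antidiag; apply: eq_bigr => -[k /= kd] _.
rewrite mulr_suml; apply: eq_bigr => -[l /= lk] _.
rewrite mulr_sumr; apply: eq_bigr => -[m /= md] _.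
by rewrite /t; congr (_ * G _ _); lia.
Qed.

HB.instance Definition _ := GRing.isZmodMorphism.Build
  (pseries (pseries K)) (pseries K) (@delta K) delta_is_zmod_morphism.
HB.instance Definition _ := GRing.isMonoidMorphism.Build
  (pseries (pseries K)) (pseries K) (@delta K) delta_is_monoid_morphism.

End Delta.

Section RadialSubstitution.
Variables (A K : comNzRingType) (iota : {rmorphism A -> K}) (p q : K).

(** Splitting f(p z, q z) into this coefficientwise substitution and [delta] yields multiplicativity
    once for three uses: the blow-up (p = 1, q = t), the value of homogeneous components at a point
    (p, q constants), and composition (p, q series). *)
Definition monomial_subst (f : pseries (pseries A)) : pseries (pseries K) :=
  fun i j => iota (f i j) * p ^+ i * q ^+ j.

Fact monomial_subst_is_zmod_morphism : zmod_morphism monomial_subst.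
Proof.
move=> f g; apply/funext => i; apply/funext => j.
by rewrite psB psB /monomial_subst !psB rmorphB !mulrBl.
Qed.

Fact monomial_subst_is_monoid_morphism : monoid_morphism monomial_subst.
Proof.
split.
  apply/funext => i; apply/funext => j; rewrite /monomial_subst !ps1.
  case: i => [|i]; rewrite ?ps1 ?ps0 ?rmorph0 ?mul0r // expr0 mulr1.
  by case: j => [|j]; rewrite ?rmorph1 ?rmorph0 ?mul0r // mulr1.
move=> f g; apply/funext => i; apply/funext => j.
rewrite /monomial_subst psM ps_sum rmorph_sum !mulr_suml psM ps_sum.
apply: eq_bigr => -[a /= ai] _; rewrite !psM rmorph_sum !mulr_suml.
apply: eq_bigr => -[b /= bj] _.
have -> : p ^+ i = p ^+ a * p ^+ (i - a) by rewrite -exprD subnKC.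
have -> : q ^+ j = q ^+ b * q ^+ (j - b) by rewrite -exprD subnKC.
by rewrite rmorphM; ring.
Qed.

HB.instance Definition _ := GRing.isZmodMorphism.Build
  (pseries (pseries A)) (pseries (pseries K)) monomial_subst
  monomial_subst_is_zmod_morphism.
HB.instance Definition _ := GRing.isMonoidMorphism.Build
  (pseries (pseries A)) (pseries (pseries K)) monomial_subst
  monomial_subst_is_monoid_morphism.

(* The expansion of [f (p z, q z)] in powers of [z]. *)
Definition rsub : pseries (pseries A) -> pseries K :=
  @delta K \o monomial_subst.

HB.instance Definition _ := GRing.RMorphism.on rsub.

Lemma rsubE f d :
  rsub f d = \sum_(j < d.+1) iota (f (d - j)%N j) * p ^+ (d - j) * q ^+ j.
Proof. by []. Qed.

End RadialSubstitution.

Lemma rmorph_rsub (A K K' : comNzRingType) (iota : {rmorphism A -> K})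
    (s : {rmorphism K -> K'}) (p q : K) f d :
  s (rsub iota p q f d) = rsub (s \o iota) (s p) (s q) f d.
Proof.
rewrite !rsubE (rmorph_sum s); apply: eq_bigr => j _.
by rewrite !(rmorphM s) !(rmorphXn s).
Qed.

#[global] Opaque rsub ps_mul.

Section FilteredSum.
Variable K : comNzRingType.
Implicit Types H : pseries (pseries K).

(** The pairs (k, l) that the truncated Cauchy product omits satisfy k + l >= N, and their terms
    vanish to that order. This is how products pass through infinite sums known only by
    truncations. *)
Lemma filtered_sumM H H' N :
    (forall d, psvanish d (H d)) -> (forall d, psvanish d (H' d)) ->
  psvanish N (\sum_(d < N) (H * H') d - (\sum_(d < N) H d) * (\sum_(d < N) H' d)).
Proof.
move=> Hv H'v.
have -> : \sum_(d < N) (H * H') d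
    = \sum_(k < N) \sum_(l < N) if (k + l < N)%N then H k * H' l else 0.
  transitivity (\sum_(d < N) \sum_(j < d.+1) H (d - j)%N * H' j).
    by apply: eq_bigr => d _; rewrite mulrC psM; apply: eq_bigr => j _; rewrite mulrC.
  by rewrite (sum_antidiag (fun k l => H k * H' l)); apply: eq_bigr => k _; rewrite (sum_sub_ord (fun l => H k * H' l)).
rewrite mulr_suml -sumrB; apply: psvanish_sum => k _.
rewrite mulr_sumr -sumrB; apply: psvanish_sum => l _.
case: ltnP => kl; first by rewrite subrr.
by rewrite sub0r; apply/psvanishN/(psvanishW kl)/psvanishM.
Qed.

End FilteredSum.

Section Series2.
Variable R : realType.
Local Notation C := R[i].
Implicit Types (f g p q : series2 R).

(** The function [blowup], under a type that carries the Cauchy product. *)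
Definition bl f : pseries {poly C} := blowup f.

Lemma coef_bl f d j : (bl f d)`_j = if (j <= d)%N then f (d - j)%N j else 0.
Proof. by rewrite coef_poly ltnS. Qed.

Lemma bl_rsub f : bl f = rsub polyC 1 'X f.
Proof.
apply/funext => d; rewrite rsubE /bl /blowup /dehom poly_def.
by apply: eq_bigr => j _; rewrite expr1n mulr1 mul_polyC.
Qed.

Fact bl_is_zmod_morphism : zmod_morphism bl.
Proof. by move=> f g; rewrite !bl_rsub rmorphB. Qed.

Fact bl_is_monoid_morphism : monoid_morphism bl.
Proof. by split=> [|f g]; rewrite !bl_rsub ?rmorph1 ?rmorphM. Qed.

HB.instance Definition _ := GRing.isZmodMorphism.Build
  (series2 R) (pseries {poly C}) bl bl_is_zmod_morphism.
HB.instance Definition _ := GRing.isMonoidMorphism.Build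
  (series2 R) (pseries {poly C}) bl bl_is_monoid_morphism.

Lemma bl_inj : injective bl.
Proof.
move=> f g e; apply/funext => i; apply/funext => j.
have := congr1 (fun F : pseries {poly C} => (F (i + j)%N)`_j) e.
by rewrite /= !coef_bl leq_addl addnK.
Qed.

Lemma size_bl f d : (size (bl f d) <= d.+1)%N.
Proof. exact: size_poly. Qed.

Definition unbl (F : pseries {poly C}) : series2 R := fun i j => (F (i + j)%N)`_j.

(** The degree bound characterizes the image of [bl]: a monomial x^d t^j is x^(d - j) y^j, which
    requires j <= d. *)
Lemma unblK (F : pseries {poly C}) :
  (forall d, (size (F d) <= d.+1)%N) -> bl (unbl F) = F.
Proof.
move=> sF; apply/funext => d; apply/polyP => j; rewrite coef_bl /unbl.
by case: leqP => jd; rewrite ?subnK // nth_default //; apply: leq_trans (sF d) _.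
Qed.

Lemma order_ge_bl f N : order_ge f N <-> psvanish N (bl f).
Proof.
split=> [fN d dN|fN i j ijN].
  by apply/polyP => j; rewrite coef_bl coef0; case: ifP => // jd; rewrite fN // subnK.
by have := congr1 (fun P : {poly C} => P`_j) (fN _ ijN); rewrite coef_bl leq_addl addnK coef0.
Qed.

Definition eqo N f g := forall i j, (i + j < N)%N -> f i j = g i j.

Lemma eqo_bl N f g : eqo N f g <-> psvanish N (bl f - bl g).
Proof.
rewrite -rmorphB -order_ge_bl; split=> e i j ij.
  by rewrite psB psB e // subrr.
by have := e i j ij; rewrite psB psB => /eqP; rewrite subr_eq0 => /eqP.
Qed.

Lemma eqo_sym N f g : eqo N f g -> eqo N g f.
Proof. by move=> e i j ij; rewrite e. Qed.

Lemma eqo_trans N f g h : eqo N f g -> eqo N g h -> eqo N f h.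
Proof. by move=> e e' i j ij; rewrite e // e'. Qed.

Lemma eqoW M N f g : (N <= M)%N -> eqo M f g -> eqo N f g.
Proof. by move=> NM e i j ij; apply: e; apply: leq_trans NM. Qed.

Lemma eqoP f g : (forall N, eqo N f g) -> f = g.
Proof.
by move=> e; apply/funext => i; apply/funext => j; apply: (e (i + j).+1).
Qed.

Lemma order_geM M N f g : order_ge f M -> order_ge g N -> order_ge (f * g) (M + N).
Proof. by rewrite !order_ge_bl rmorphM => ? ?; apply: psvanishM. Qed.

Lemma order_geD N f g : order_ge f N -> order_ge g N -> order_ge (f + g) N.
Proof. by rewrite !order_ge_bl rmorphD => ? ?; apply: psvanishD. Qed.

Lemma order_geX f k : order_ge f 1 -> order_ge (f ^+ k) k.
Proof. by rewrite !order_ge_bl rmorphXn => ?; rewrite -[k in psvanish k]mul1n; apply: psvanishX. Qed.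

Lemma order_ge1 f : order_ge f 1 <-> f 0%N 0%N = 0.
Proof. by split=> [f1|f0 [|i] [|j]] //; apply: f1. Qed.

Lemma eqoM N f g f' g' : eqo N f f' -> eqo N g g' -> eqo N (f * g) (f' * g').
Proof.
rewrite !eqo_bl !rmorphM => e e'.
rewrite (_ : _ - _ = (bl f - bl f') * bl g + bl f' * (bl g - bl g')); last by ring.
by apply: psvanishD; [apply: psvanishMr | apply: psvanishMl].
Qed.

Lemma eqoD N f g f' g' : eqo N f f' -> eqo N g g' -> eqo N (f + g) (f' + g').
Proof. by move=> e e' i j ij; rewrite !psD e // e'. Qed.

Definition cser : C -> series2 R := @psC _ \o @psC _.
HB.instance Definition _ := GRing.RMorphism.on cser.

Lemma cserM c f i j : (cser c * f) i j = c * f i j.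
Proof. by rewrite psCM psCM. Qed.

Lemma bl_cser c : bl (cser c) = psC c%:P.
Proof.
apply/funext => d; apply/polyP => j; rewrite coef_bl.
have cE i k : cser c i k = if (i == 0) && (k == 0) then c else 0.
  by case: i => [|i]; case: k.
rewrite cE; case: d => [|d]; first by case: j => [|j]; rewrite /= coefC.
by rewrite /psC /= coef0; case: ifP => // jd; case: j jd => [|j] jd; rewrite ?andbF.
Qed.

Lemma Xs_psX : Xs = psX _ :> series2 R.
Proof. by apply/funext => -[|[|i]]; apply/funext => -[|j]; rewrite /Xs /psX ?ps0 ?ps1. Qed.

Lemma XsM f i j : (Xs * f) i j = if i is m.+1 then f m j else 0.
Proof. by rewrite Xs_psX psXM; case: i. Qed.

Lemma Ys_psX : Ys = psC (psX _) :> series2 R.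
Proof. by apply/funext => -[|i]; apply/funext => -[|[|j]]; rewrite /Ys /psC /psX ?ps0 ?ps1. Qed.

Lemma YsM f i j : (Ys * f) i j = if j is m.+1 then f i m else 0.
Proof. by rewrite Ys_psX psCM psXM; case: j. Qed.

Lemma bl_Xs : bl Xs = psX _.
Proof.
apply/funext => d; apply/polyP => j; rewrite coef_bl /Xs /psX.
case: d => [|[|d]] /=; first by case: j => [|j]; rewrite ?coef0.
  by case: j => [|[|j]]; rewrite ?coef1.
by rewrite coef0; case: ifP => // jd; case: j jd => [|j] jd; rewrite ?andbF.
Qed.

Lemma bl_Ys : bl Ys = psC 'X * psX _.
Proof.
apply/funext => d; apply/polyP => j; rewrite psCM coef_bl /Ys /psX.
case: d => [|[|d]] /=; rewrite ?mulr0 ?mulr1 ?coef0 ?coefX.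
- by case: j.
- by case: j => [|[|j]].
by case: ifP => // jd; rewrite (_ : (_ == 0%N) && _ = false) //; apply/negP => /andP[/eqP ? /eqP ?]; lia.
Qed.

Lemma psdx_psd f : psdx f = psd f.
Proof. by apply/funext => i; apply/funext => j; rewrite /psd psMn. Qed.

Lemma psdy_psd f i : psdy f i = psd (f i).
Proof. by []. Qed.

Lemma psdxM f g : psdx (f * g) = psdx f * g + f * psdx g.
Proof. by rewrite !psdx_psd psdM. Qed.

Fact psdx_is_zmod_morphism : zmod_morphism (@psdx R).
Proof. by move=> f g; rewrite !psdx_psd raddfB. Qed.

HB.instance Definition _ := GRing.isZmodMorphism.Build
  (series2 R) (series2 R) (@psdx R) psdx_is_zmod_morphism.

Fact psdy_is_zmod_morphism : zmod_morphism (@psdy R).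
Proof. by move=> f g; apply/funext => i; rewrite psB !psdy_psd psB raddfB. Qed.

HB.instance Definition _ := GRing.isZmodMorphism.Build
  (series2 R) (series2 R) (@psdy R) psdy_is_zmod_morphism.

Lemma psdyM f g : psdy (f * g) = psdy f * g + f * psdy g.
Proof.
apply/funext => i; rewrite psD psdy_psd !psM raddf_sum -big_split /=.
by apply: eq_bigr => k _; rewrite psdM.
Qed.

Definition euler f : series2 R := fun i j => f i j *+ (i + j).

Lemma eulerE f : euler f = Xs * psdx f + Ys * psdy f.
Proof.
apply/funext => i; apply/funext => j; rewrite psD psD XsM YsM /euler mulrnDr.
by case: i => [|i]; case: j => [|j]; rewrite ?mulr0n.
Qed.

End Series2.

Section Derivation.
Variables (A : comNzRingType) (D : {additive A -> A}).
Hypothesis DM : forall f g, D (f * g) = D f * g + f * D g.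

Lemma derivation1 : D 1 = 0.
Proof.
by have /eqP := DM 1 1; rewrite !mul1r mulr1 -subr_eq subrr eq_sym => /eqP.
Qed.

Lemma derivationX f k : D (f ^+ k) = (f ^+ k.-1 * D f) *+ k.
Proof.
elim: k => [|k IH]; first by rewrite expr0 derivation1.
rewrite exprS DM IH mulrnAr mulrA mulrSr addrC.
by case: k {IH} => [|k] /=; rewrite ?mulr0n ?add0r ?exprS //= mulrC.
Qed.

End Derivation.

Lemma sum_mul2 (A : comNzRingType) N (F G : nat -> A) a b :
  \sum_(d < N) (F d * a + G d * b)
  = (\sum_(d < N) F d) * a + (\sum_(d < N) G d) * b.
Proof. by rewrite big_split /= !mulr_suml. Qed.

Section Composition.
Variable R : realType.
Local Notation C := R[i].
Implicit Types (f g p q : series2 R).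
Local Notation cser := (@cser R).
Local Notation bl := (@bl R).

Lemma order_ge_sum I (r : seq I) (P : pred I) (F : I -> series2 R) N :
  (forall i, P i -> order_ge (F i) N) -> order_ge (\sum_(i <- r | P i) F i) N.
Proof.
move=> FN i j ij; rewrite !ps_sum big1 // => k Pk; exact: FN.
Qed.

Lemma order_ge_rsub f p q d :
  order_ge p 1 -> order_ge q 1 -> order_ge (rsub cser p q f d) d.
Proof.
move=> p1 q1; rewrite rsubE; apply: order_ge_sum => -[j /= jd] _.
rewrite -mulrA order_ge_bl rmorphM; apply/psvanishMl/order_ge_bl.
by rewrite -[d in order_ge _ d](@subnK j d) //; apply: order_geM; apply: order_geX.
Qed.

(** Modulo order N, composition is a finite sum of values of the ring morphism [rsub].
    Multiplicativity, associativity and the chain rule follow by letting N vary. *)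
Lemma pscomp_trunc N f p q : order_ge p 1 -> order_ge q 1 ->
  eqo N (pscomp f p q) (\sum_(d < N) rsub cser p q f d).
Proof.
move=> p1 q1 i j ij; rewrite /pscomp !ps_sum.
set M := (i + j).+1.
transitivity (\sum_(d < M) rsub cser p q f d i j).
  transitivity (\sum_(k < M) \sum_(l < M - k) f k l * (p ^+ k * q ^+ l) i j).
    apply: eq_bigr => k _; rewrite (sum_sub_ord (fun l => f k l * (p ^+ k * q ^+ l) i j)).
    apply: eq_bigr => l _; case: ltnP => // kl.
    by rewrite (@order_geM _ k l) ?mulr0 //; apply: order_geX.
  rewrite -(sum_antidiag (fun k l => f k l * (p ^+ k * q ^+ l) i j)).
  apply: eq_bigr => d _; rewrite rsubE !ps_sum.
  by apply: eq_bigr => l _; rewrite -mulrA cserM.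
rewrite (big_ord_widen N (fun d => rsub cser p q f d i j)) // big_mkcond /=.
apply: eq_bigr => d _; case: ifP => // dM.
by rewrite (@order_ge_rsub _ _ _ d) //; lia.
Qed.

Lemma pscompB f g p q : pscomp (f - g) p q = pscomp f p q - pscomp g p q.
Proof.
apply/funext => i; apply/funext => j; rewrite !psB /pscomp -sumrB.
apply: eq_bigr => k _; rewrite -sumrB; apply: eq_bigr => l _.
by rewrite !psB mulrBl.
Qed.

Lemma pscomp_cser c p q : pscomp (cser c) p q = cser c.
Proof.
apply/funext => i; apply/funext => j; rewrite /pscomp big_ord_recl big_ord_recl /=.
rewrite !expr0 mul1r !big1 ?addr0; first by rewrite -[in RHS](mulr1 (cser c)) cserM.
- by move=> k _; rewrite big1 // => l _; rewrite mul0r.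
- by move=> l _; rewrite mul0r.
Qed.

Lemma pscompM f g p q : order_ge p 1 -> order_ge q 1 ->
  pscomp (f * g) p q = pscomp f p q * pscomp g p q.
Proof.
move=> p1 q1; apply: eqoP => N.
apply: eqo_trans (pscomp_trunc _ p1 q1) _; apply: eqo_sym.
apply: eqo_trans (eqoM (pscomp_trunc _ p1 q1) (pscomp_trunc _ p1 q1)) _.
apply: eqo_sym; apply/eqo_bl.
pose H f : pseries (pseries {poly C}) := fun d => bl (rsub cser p q f d).
have Hv h d : psvanish d (H h d) by apply/order_ge_bl/order_ge_rsub.
have HE h : bl (\sum_(d < N) rsub cser p q h d) = \sum_(d < N) H h d.
  exact: rmorph_sum.
have -> : bl ((\sum_(d < N) rsub cser p q f d) * (\sum_(d < N) rsub cser p q g d))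
    = (\sum_(d < N) H f d) * (\sum_(d < N) H g d).
  exact: etrans (rmorphM bl _ _) (congr2 _ (HE f) (HE g)).
have -> := HE (f * g).
have := @filtered_sumM _ (H f) (H g) N (Hv f) (Hv g).
congr (psvanish N (_ - _)); apply: eq_bigr => d _.
rewrite psM /H (rmorphM (rsub cser p q) f g) psM.
rewrite (rmorph_sum bl); apply: eq_bigr => k _.
by rewrite (rmorphM bl).
Qed.

Definition pscomp_morph p q (p1 : order_ge p 1) (q1 : order_ge q 1) :
    {rmorphism series2 R -> series2 R} :=
  HB.pack_for {rmorphism series2 R -> series2 R} (fun f => pscomp f p q)
    (GRing.isZmodMorphism.Build _ _ (fun f => pscomp f p q)
      (fun f g => pscompB f g p q))
    (GRing.isMonoidMorphism.Build _ _ (fun f => pscomp f p q)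
      (conj (etrans (congr1 (fun f => pscomp f p q) (esym (rmorph1 cser)))
              (etrans (pscomp_cser 1 p q) (rmorph1 cser)))
            (fun f g => @pscompM f g p q p1 q1))).

Lemma order_ge_pscomp f p q N : order_ge p 1 -> order_ge q 1 ->
  order_ge f N -> order_ge (pscomp f p q) N.
Proof.
move=> p1 q1 fN i j ij; rewrite (pscomp_trunc f p1 q1 ij) big1 // => -[d /= dN] _.
rewrite rsubE big1 // => -[k /= kd] _.
by rewrite fN ?(rmorph0 cser) ?mul0r // subnK.
Qed.

Lemma eqo_pscomp f g p q N : order_ge p 1 -> order_ge q 1 ->
  eqo N f g -> eqo N (pscomp f p q) (pscomp g p q).
Proof.
move=> p1 q1 e i j ij.
have fg : order_ge (f - g) N by move=> k l kl; rewrite !psB e // subrr.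
by have /eqP := order_ge_pscomp p1 q1 fg ij; rewrite pscompB !psB subr_eq0 => /eqP.
Qed.

Lemma pscompA f p q p' q' : order_ge p 1 -> order_ge q 1 ->
    order_ge p' 1 -> order_ge q' 1 ->
  pscomp (pscomp f p q) p' q' = pscomp f (pscomp p p' q') (pscomp q p' q').
Proof.
move=> p1 q1 p'1 q'1; apply: eqoP => N.
have pp : order_ge (pscomp p p' q') 1 by apply: order_ge_pscomp.
have qq : order_ge (pscomp q p' q') 1 by apply: order_ge_pscomp.
apply: eqo_trans (eqo_pscomp p'1 q'1 (pscomp_trunc f p1 q1)) _; apply: eqo_sym.
apply: eqo_trans (pscomp_trunc f pp qq) _ => i j ij.
pose s := pscomp_morph p'1 q'1; rewrite -[pscomp (\sum_(d < N) _) _ _]/(s _) (rmorph_sum s).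
rewrite !ps_sum; apply: eq_bigr => d _; rewrite (rmorph_rsub _ s) !rsubE !ps_sum.
by apply: eq_bigr => k _; rewrite /= pscomp_cser.
Qed.

(** Stated for any derivation that kills constants and lowers the order of contact by at most one,
    so as to cover both partial derivatives. *)
Lemma pscomp_chain (D : {additive series2 R -> series2 R}) f p q :
    (forall f g, D (f * g) = D f * g + f * D g) -> (forall c, D (cser c) = 0) ->
    (forall N f g, eqo N.+1 f g -> eqo N (D f) (D g)) ->
    order_ge p 1 -> order_ge q 1 ->
  D (pscomp f p q) = pscomp (psdx f) p q * D p + pscomp (psdy f) p q * D q.
Proof.
move=> DM Dc De p1 q1.
have key d : D (rsub cser p q f d.+1)
    = rsub cser p q (psdx f) d * D p + rsub cser p q (psdy f) d * D q.
  rewrite !rsubE (raddf_sum D).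
  have E (l : 'I_d.+2) : D (cser (f (d.+1 - l)%N l) * p ^+ (d.+1 - l) * q ^+ l)
    = cser (f (d.+1 - l)%N l) * (p ^+ (d.+1 - l).-1 * D p) *+ (d.+1 - l) * q ^+ l
      + cser (f (d.+1 - l)%N l) * p ^+ (d.+1 - l) * (q ^+ l.-1 * D q) *+ l.
    by rewrite DM DM Dc mul0r add0r !(derivationX DM) !mulrnAr mulrnAl.
  rewrite (eq_bigr _ (fun l _ => E l)) big_split /= !mulr_suml; congr (_ + _).
    rewrite big_ord_recr /= subnn mulr0n mul0r addr0; apply: eq_bigr => -[l /= ld] _.
    by rewrite /psdx subSn // (rmorphMn cser) /= !mulrnAl; congr (_ *+ _); ring.
  rewrite big_ord_recl /= mulr0n add0r; apply: eq_bigr => -[l /= ld] _.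
  by rewrite /psdy (rmorphMn cser) /= !mulrnAl /bump /= add1n subSS; congr (_ *+ _); ring.
have key0 : D (rsub cser p q f 0%N) = 0 by rewrite rsubE big_ord1 !mulr1 Dc.
apply: eqoP => N.
(* The left-hand side is truncated at N + 1, since D loses one order. *)
apply: eqo_trans (De _ _ _ (pscomp_trunc f p1 q1)) _; apply: eqo_sym.
have tr h := @pscomp_trunc N h p q p1 q1.
have r N' (g : series2 R) : eqo N' g g by [].
apply: eqo_trans (eqoD (eqoM (tr (psdx f)) (r _ (D p))) (eqoM (tr (psdy f)) (r _ (D q)))) _.
suff -> : D (\sum_(d < N.+1) rsub cser p q f d)
  = (\sum_(d < N) rsub cser p q (psdx f) d) * D p
    + (\sum_(d < N) rsub cser p q (psdy f) d) * D q by [].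
rewrite (raddf_sum D) big_ord_recl key0 add0r.
transitivity (\sum_(d < N) (rsub cser p q (psdx f) d * D p + rsub cser p q (psdy f) d * D q)).
  by apply: eq_bigr => d _; exact: key.
exact: sum_mul2.
Qed.

End Composition.

#[global] Opaque pscomp.

Lemma subst_ext (A : comNzRingType) (N : nat) (a b : A) (F : nat -> A) d :
  \sum_(j < d.+1) F j * a ^+ (d - j) * (b * a) ^+ j
  = (\sum_(j < d.+1) F j * b ^+ j) * a ^+ d.
Proof.
rewrite mulr_suml; apply: eq_bigr => -[j /= jd] _.
by rewrite exprMn -[in RHS](@subnK j d) // exprD; ring.
Qed.

Lemma big_eq (A : nmodType) N (F G : nat -> A) :
  (forall d, F d = G d) -> \sum_(d < N) F d = \sum_(d < N) G d.
Proof. by move=> e; apply: eq_bigr. Qed.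

Section ChainRule.
Variable R : realType.
Local Notation C := R[i].
Implicit Types (f g p q : series2 R).
Local Notation cser := (@cser R).
Local Notation bl := (@bl R).

Lemma cserE c i j : cser c i j = if (i == 0) && (j == 0) then c else 0.
Proof. by case: i => [|i]; case: j. Qed.

Lemma psdx_pscomp f p q : order_ge p 1 -> order_ge q 1 ->
  psdx (pscomp f p q)
  = pscomp (psdx f) p q * psdx p + pscomp (psdy f) p q * psdx q.
Proof.
apply: (pscomp_chain (D := @psdx R)); first exact: psdxM.
- move=> c; apply/funext => i; apply/funext => j.
  by change (psdx (cser c) i j = 0); rewrite /psdx cserE /= mul0rn.
- move=> N g h e i j ij; change (psdx g i j = psdx h i j).
  by rewrite /psdx e // addSn.
Qed.

Lemma psdy_pscomp f p q : order_ge p 1 -> order_ge q 1 ->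
  psdy (pscomp f p q)
  = pscomp (psdx f) p q * psdy p + pscomp (psdy f) p q * psdy q.
Proof.
apply: (pscomp_chain (D := @psdy R)); first exact: psdyM.
- move=> c; apply/funext => i; apply/funext => j.
  by change (psdy (cser c) i j = 0); rewrite /psdy cserE /= andbF mul0rn.
- move=> N g h e i j ij; change (psdy g i j = psdy h i j).
  by rewrite /psdy e // addnS.
Qed.

Lemma euler_pscomp f p q : order_ge p 1 -> order_ge q 1 ->
  euler (pscomp f p q)
  = pscomp (psdx f) p q * euler p + pscomp (psdy f) p q * euler q.
Proof.
move=> p1 q1; rewrite !eulerE psdx_pscomp // psdy_pscomp //; ring.
Qed.

Definition kc : C -> pseries {poly C} := bl \o cser.
HB.instance Definition _ := GRing.RMorphism.on kc.

Lemma kcE c : kc c = psC c%:P.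
Proof. exact: bl_cser. Qed.

Lemma bl_rsub_cser p q f d : bl (rsub cser p q f d)
  = \sum_(j < d.+1) kc (f (d - j)%N j) * bl p ^+ (d - j) * bl q ^+ j.
Proof. exact: (rmorph_rsub _ bl). Qed.

Lemma horner_kc (P : {poly C}) T N : (size P <= N)%N ->
  (map_poly kc P).[T] = \sum_(j < N) kc P`_j * T ^+ j.
Proof.
move=> sP; rewrite (@horner_coef_wide _ N) ?size_map_poly_leq //.
  by apply: eq_bigr => j _; rewrite coef_map.
exact: leq_trans (size_poly _ _) sP.
Qed.

(** By homogeneity f_d(p, T p) = f_d(1, T) p^d: in the chart, composition with (p, q) substitutes
    [bl p] for x and [T] for t. *)
Lemma bl_pscomp N f p q T : order_ge p 1 -> order_ge q 1 -> bl q = T * bl p ->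
  psvanish N (bl (pscomp f p q)
              - \sum_(d < N) (map_poly kc (bl f d)).[T] * bl p ^+ d).
Proof.
move=> p1 q1 qT; have /eqo_bl := @pscomp_trunc _ N f p q p1 q1.
rewrite [bl (\sum_(d < N) _)](_ : _ = \sum_(d < N) (map_poly kc (bl f d)).[T] * bl p ^+ d) //.
rewrite (rmorph_sum bl).
apply: (@big_eq _ _ (fun d => bl (rsub cser p q f d))
          (fun d => (map_poly kc (bl f d)).[T] * bl p ^+ d)) => d.
rewrite bl_rsub_cser qT.
rewrite (subst_ext 0 _ _ (fun j => kc (f (d - j)%N j))); congr (_ * _).
rewrite (horner_kc T (size_bl f d)); apply: eq_bigr => -[j /= jd] _.
by rewrite coef_bl -ltnS jd.
Qed.

Lemma pscomp_id f : pscomp f Xs Ys = f.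
Proof.
have x1 : order_ge (Xs : series2 R) 1 by apply/order_ge1.
have y1 : order_ge (Ys : series2 R) 1 by apply/order_ge1.
have hT P : (map_poly kc P).[psC 'X] = psC P.
  rewrite (horner_kc _ (leqnn _)) -[in RHS](coefK P) poly_def (rmorph_sum (@psC _)).
  by apply: eq_bigr => j _; rewrite -mul_polyC rmorphM rmorphXn kcE.
apply: bl_inj; apply/eqP; rewrite -subr_eq0; apply/eqP/psvanish_inj => N.
have := @bl_pscomp N f _ _ (psC 'X) x1 y1.
rewrite bl_Ys bl_Xs => /(_ erefl) e d dN.
have := e d dN; rewrite !psB => /eqP; rewrite subr_eq0 => /eqP ->; apply/eqP.
rewrite subr_eq0 ps_sum; apply/eqP.
under eq_bigr => k _ do rewrite hT mulrC psXnM.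
rewrite (bigD1 (Ordinal dN)) //= leqnn subnn big1 ?addr0 // => -[k /= kN].
rewrite -val_eqE /= => kd; case: ifP => // kled.
by rewrite (_ : (d - k)%N = (d - k).-1.+1) //; lia.
Qed.

Lemma pscomp_Xs p q : order_ge p 1 -> order_ge q 1 -> pscomp Xs p q = p.
Proof.
move=> p1 q1; apply: eqoP => N.
apply: eqo_trans (eqoW (leq_addr 2 N) (pscomp_trunc _ p1 q1)) _ => i j _.
rewrite addn2 2!big_ord_recl /= big1 => [|d _]; last first.
  rewrite rsubE big1 // => -[[|k] /= kd] _; rewrite /Xs ?andbF ?(rmorph0 cser) ?mul0r //.
rewrite addr0 !rsubE big_ord1 big_ord_recl big_ord1 /= /Xs /=.
by rewrite !(rmorph0 cser) !(rmorph1 cser) !mul0r addr0 add0r mul1r mulr1.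
Qed.

Lemma pscomp_Ys p q : order_ge p 1 -> order_ge q 1 -> pscomp Ys p q = q.
Proof.
move=> p1 q1; apply: eqoP => N.
apply: eqo_trans (eqoW (leq_addr 2 N) (pscomp_trunc _ p1 q1)) _ => i j _.
rewrite addn2 2!big_ord_recl /= big1 => [|d _]; last first.
  rewrite rsubE big1 // => -[[|[|k]] /= kd] _; rewrite /Ys ?andbF ?(rmorph0 cser) ?mul0r //.
rewrite addr0 !rsubE big_ord1 big_ord_recl big_ord1 /= /Ys /=.
by rewrite !(rmorph0 cser) !(rmorph1 cser) !mul0r !add0r mul1r expr0 mul1r.
Qed.

(** The value at (a, b) of the homogeneous component of degree d. Unlike the chart, it treats the
    direction (0 : 1) on the same footing as the others. *)
Definition hev d f (a b : C) : C :=
  \sum_(j < d.+1) f (d - j)%N j * a ^+ (d - j) * b ^+ j.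

Lemma hev_rsub d f a b : hev d f a b = rsub idfun a b f d.
Proof. by rewrite rsubE. Qed.

Lemma hevM k l f g a b : order_ge f k -> order_ge g l ->
  hev (k + l) (f * g) a b = hev k f a b * hev l g a b.
Proof.
have v h n : order_ge h n -> psvanish n (rsub idfun a b h).
  move=> hn d dn; rewrite rsubE big1 // => -[j /= jd] _.
  by rewrite hn ?mul0r // subnK.
move=> fk gl; rewrite !hev_rsub (rmorphM (rsub idfun a b)).
by apply: psM_lead; apply: v.
Qed.

Lemma hevD d f g a b : hev d (f + g) a b = hev d f a b + hev d g a b.
Proof. by rewrite !hev_rsub rmorphD. Qed.

Lemma hev_sum d n (F : 'I_n -> series2 R) a b :
  hev d (\sum_(i < n) F i) a b = \sum_(i < n) hev d (F i) a b.
Proof.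
rewrite hev_rsub (rmorph_sum (rsub idfun a b)) ps_sum.
by apply: eq_bigr => i _; rewrite hev_rsub.
Qed.

Lemma hev_eqo d f g a b : eqo d.+1 f g -> hev d f a b = hev d g a b.
Proof. by move=> e; apply: eq_bigr => -[j /= jd] _; rewrite e // subnK. Qed.

Lemma hev0 f a b : hev 0 f a b = f 0%N 0%N.
Proof. by rewrite /hev big_ord1 !mulr1. Qed.

Lemma hev1 f a b : hev 1 f a b = f 1%N 0%N * a + f 0%N 1%N * b.
Proof. by rewrite /hev big_ord_recl big_ord1 /= !mulr1. Qed.

Lemma hevX k f a b : order_ge f 1 -> hev k (f ^+ k) a b = hev 1 f a b ^+ k.
Proof.
move=> f1; elim: k => [|k IH]; first by rewrite !expr0 hev0.
by rewrite !exprS -add1n hevM ?IH //; apply: order_geX.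
Qed.

Lemma hevZ k f a b c : hev k f (c * a) (c * b) = c ^+ k * hev k f a b.
Proof.
rewrite /hev mulr_sumr; apply: eq_bigr => -[j /= jk] _.
have -> : c ^+ k = c ^+ (k - j) * c ^+ j by rewrite -exprD subnK.
by rewrite !exprMn; ring.
Qed.

Lemma hev_cser c k f a b : hev k (cser c * f) a b = c * hev k f a b.
Proof.
by rewrite /hev mulr_sumr; apply: eq_bigr => j _; rewrite cserM !mulrA.
Qed.

(** On the lowest homogeneous component only the linear part of the substitution acts. *)
Lemma hev_pscomp d f p q a b : order_ge p 1 -> order_ge q 1 -> order_ge f d ->
  hev d (pscomp f p q) a b = hev d f (hev 1 p a b) (hev 1 q a b).
Proof.
move=> p1 q1 fd; have := @pscomp_trunc _ d.+1 f p q p1 q1.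
move=> /hev_eqo ->; rewrite hev_rsub (rmorph_sum (rsub idfun a b)) ps_sum.
rewrite big_ord_recr /= big1 ?add0r => [|k _]; last first.
  rewrite (_ : rsub cser p q f k = 0) ?rmorph0 // rsubE big1 // => -[j /= jk] _.
  by rewrite fd ?(rmorph0 cser) ?mul0r //; have := ltn_ord k; lia.
rewrite -hev_rsub rsubE hev_sum; apply: eq_bigr => -[j /= jd] _.
rewrite -mulrA hev_cser -mulrA -!hevX // -hevM ?subnK //; exact: order_geX.
Qed.

End ChainRule.

(** * Convergence and majorants *)

Section Norms.
Variable R : realType.
Local Notation C := R[i].
Implicit Types (z : C) (P Q : {poly C}) (F G : pseries {poly C}).

(** The modulus as an element of R, whose order is total, unlike that of C. *)
Definition cabs z : R := complex.Re `|z|.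

Lemma cabsE z : `|z| = (cabs z)%:C%C.
Proof. by rewrite /cabs RRe_real // normr_real. Qed.

Lemma cabs_ge0 z : 0 <= cabs z.
Proof. by rewrite -lecR -cabsE normr_ge0. Qed.
Hint Resolve cabs_ge0 : core.

Lemma cabs0 : cabs 0 = 0.
Proof. by rewrite /cabs normr0. Qed.

Lemma cabs1 : cabs 1 = 1.
Proof. by rewrite /cabs normr1. Qed.

Lemma cabsM z z' : cabs (z * z') = cabs z * cabs z'.
Proof. by apply: complexI; rewrite rmorphM /= -!cabsE normrM. Qed.

Lemma cabsD z z' : cabs (z + z') <= cabs z + cabs z'.
Proof. by rewrite -lecR rmorphD /= -!cabsE ler_normD. Qed.

Lemma cabsN z : cabs (- z) = cabs z.
Proof. by rewrite /cabs normrN. Qed.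

Lemma cabsMn z n : cabs (z *+ n) = cabs z *+ n.
Proof. by apply: complexI; rewrite rmorphMn /= -!cabsE normrMn. Qed.

Lemma cabsV z : cabs z^-1 = (cabs z)^-1.
Proof. by apply: complexI; rewrite fmorphV /= -!cabsE normfV. Qed.

Lemma cabs_eq0 z : (cabs z == 0) = (z == 0).
Proof. by rewrite -(inj_eq (@complexI R)) -cabsE normr_eq0. Qed.

Lemma cabs_sum I (r : seq I) (P : pred I) (F : I -> C) :
  cabs (\sum_(i <- r | P i) F i) <= \sum_(i <- r | P i) cabs (F i).
Proof.
elim/big_rec2: _ => [|i x y _ yx]; first by rewrite cabs0.
by apply: le_trans (cabsD _ _) _; rewrite lerD2l.
Qed.

Lemma cauchy_product_le (a b : nat -> R) N :
    (forall n, 0 <= a n) -> (forall n, 0 <= b n) ->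
  \sum_(d < N) \sum_(k < d.+1) a k * b (d - k)%N
  <= (\sum_(k < N) a k) * (\sum_(l < N) b l).
Proof.
move=> a0 b0.
have -> : \sum_(d < N) \sum_(k < d.+1) a k * b (d - k)%N
    = \sum_(d < N) \sum_(k < d.+1) b (d - k)%N * a k.
  by apply: eq_bigr => d _; apply: eq_bigr => k _; rewrite mulrC.
rewrite (sum_antidiag (fun l k => b l * a k)) mulrC mulr_suml.
apply: ler_sum => k _; rewrite (sum_sub_ord (fun l => b k * a l)) mulr_sumr.
by apply: ler_sum => l _; case: ifP => // _; rewrite mulr_ge0.
Qed.

(** The l1 norm of the coefficients on the disc of radius rho; it is submultiplicative, which a
    majorant argument needs. *)
Definition pnorm (rho : R) P : R := \sum_(j < size P) cabs P`_j * rho ^+ j.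

Section FixedRho.
Variable rho : R.
Hypothesis rho0 : 0 < rho.
Local Notation pnorm := (pnorm rho).

Let rhoX j : 0 <= rho ^+ j. Proof. by rewrite exprn_ge0 // ltW. Qed.

Lemma pnormE N P : (size P <= N)%N -> pnorm P = \sum_(j < N) cabs P`_j * rho ^+ j.
Proof.
move=> sP; rewrite /pnorm (big_ord_widen N (fun j => cabs P`_j * rho ^+ j)) //.
rewrite big_mkcond; apply: eq_bigr => j _; case: ltnP => // Pj.
by rewrite nth_default // cabs0 mul0r.
Qed.

Lemma pnorm_ge0 P : 0 <= pnorm P.
Proof. by apply: sumr_ge0 => j _; rewrite mulr_ge0. Qed.

Lemma pnorm0 : pnorm 0 = 0.
Proof. by rewrite /pnorm size_poly0 big_ord0. Qed.

Lemma pnormC c : pnorm c%:P = cabs c.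
Proof. by rewrite (@pnormE 1) ?size_polyC_leq1 // big_ord1 coefC mulr1. Qed.

Lemma pnormD P Q : pnorm (P + Q) <= pnorm P + pnorm Q.
Proof.
set N := maxn (size P) (size Q).
rewrite (@pnormE N) ?size_polyD // (@pnormE N P) ?leq_maxl //.
rewrite (@pnormE N Q) ?leq_maxr // -big_split /=.
by apply: ler_sum => j _; rewrite coefD -mulrDl ler_wpM2r // cabsD.
Qed.

Lemma pnormN P : pnorm (- P) = pnorm P.
Proof. by rewrite /pnorm size_polyN; apply: eq_bigr => j _; rewrite coefN cabsN. Qed.

Lemma pnorm_sum I (r : seq I) (T : pred I) (F : I -> {poly C}) :
  pnorm (\sum_(i <- r | T i) F i) <= \sum_(i <- r | T i) pnorm (F i).
Proof.
elim/big_rec2: _ => [|i x y _ yx]; first by rewrite pnorm0.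
by apply: le_trans (pnormD _ _) _; rewrite lerD2l.
Qed.

Lemma pnormM P Q : pnorm (P * Q) <= pnorm P * pnorm Q.
Proof.
set N := (size P + size Q)%N.
have sPQ : (size (P * Q)%R <= N)%N.
  by apply: leq_trans (size_polyMleq _ _) _; rewrite leq_pred.
rewrite (@pnormE N) // (@pnormE N P) ?leq_addr // (@pnormE N Q) ?leq_addl //.
pose a P' k := cabs P'`_k * rho ^+ k.
have a0 P' k : 0 <= a P' k by rewrite mulr_ge0.
apply: le_trans (cauchy_product_le N (a0 P) (a0 Q)).
apply: ler_sum => d _; rewrite coefM.
apply: le_trans (ler_wpM2r (rhoX _) (cabs_sum _ _ _)) _.
rewrite mulr_suml; apply: ler_sum => -[k /= kd] _; rewrite cabsM /a.
by rewrite -[in rho ^+ d](@subnKC k d) // exprD mulrACA.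
Qed.

(** The radius is kept, and the price is the degree. For the recursion below that degree is under
    control. *)
Lemma pnorm_deriv P : pnorm P^`() * rho <= pnorm P *+ (size P).-1.
Proof.
have sP : (size P^`() <= (size P).-1)%N.
  by case: (eqVneq P 0) => [->|/lt_size_deriv]; rewrite ?deriv0 ?size_poly0 //; lia.
rewrite (@pnormE _ _ sP) /pnorm mulr_suml -sumrMnl.
case e : (size P) => [|n] /=; first by rewrite !big_ord0.
rewrite big_ord_recl; apply: ler_wpDl; first by rewrite mulrn_wge0 // mulr_ge0.
apply: ler_sum => -[j /= jn] _; rewrite coef_deriv cabsMn mulrnAl mulrnAl.
rewrite -mulrA -exprSr /bump /= add1n; apply: ler_wpMn2l; last by [].
by rewrite mulr_ge0.
Qed.

Section FixedRadius.
Variable r : R.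
Hypothesis r0 : 0 <= r.

(** A partial sum of the majorant norm with radii r in x and rho in t. Convergence will be a bound
    independent of K. *)
Definition Bnorm K F := \sum_(d < K) pnorm (F d) * r ^+ d.

Let rX j : 0 <= r ^+ j. Proof. by rewrite exprn_ge0. Qed.

Lemma Bnorm_ge0 K F : 0 <= Bnorm K F.
Proof. by apply: sumr_ge0 => d _; rewrite mulr_ge0 // pnorm_ge0. Qed.

Lemma BnormD K F G : Bnorm K (F + G) <= Bnorm K F + Bnorm K G.
Proof.
rewrite /Bnorm -big_split /=; apply: ler_sum => d _.
by rewrite -mulrDl ler_wpM2r // pnormD.
Qed.

Lemma BnormN K F : Bnorm K (- F) = Bnorm K F.
Proof. by apply: eq_bigr => d _; rewrite psN pnormN. Qed.

Lemma Bnorm0 K : Bnorm K 0 = 0.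
Proof. by rewrite /Bnorm big1 // => d _; rewrite ps0 pnorm0 mul0r. Qed.

Lemma Bnorm_sum K I (s : seq I) (T : pred I) (F : I -> pseries {poly C}) :
  Bnorm K (\sum_(i <- s | T i) F i) <= \sum_(i <- s | T i) Bnorm K (F i).
Proof.
elim/big_rec2: _ => [|i x y _ yx]; first by rewrite Bnorm0.
by apply: le_trans (BnormD _ _ _) _; rewrite lerD2l.
Qed.

Lemma eq_Bnorm K F G : psvanish K (F - G) -> Bnorm K F = Bnorm K G.
Proof.
move=> e; apply: eq_bigr => d _; congr (pnorm _ * _); apply/eqP.
by rewrite -subr_eq0 -psB e.
Qed.

Lemma BnormM K F G : Bnorm K (F * G) <= Bnorm K F * Bnorm K G.
Proof.
pose a F' k := pnorm (F' k) * r ^+ k.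
have a0 F' k : 0 <= a F' k by rewrite mulr_ge0 // pnorm_ge0.
apply: le_trans (cauchy_product_le K (a0 F) (a0 G)).
apply: ler_sum => d _; rewrite psM.
apply: le_trans (ler_wpM2r (rX _) (pnorm_sum _ _ _)) _.
rewrite mulr_suml; apply: ler_sum => -[k /= kd] _; rewrite /a.
rewrite -[in r ^+ d](@subnKC k d) // exprD mulrACA ler_wpM2r ?mulr_ge0 //.
exact: pnormM.
Qed.

Lemma Bnorm_psC K P : Bnorm K (psC P) <= pnorm P.
Proof.
case: K => [|K]; first by rewrite /Bnorm big_ord0 pnorm_ge0.
rewrite /Bnorm big_ord_recl mulr1 big1 ?addr0 // => d _.
by rewrite /psC /= pnorm0 mul0r.
Qed.

Lemma Bnorm1 K : Bnorm K 1 <= 1.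
Proof. by rewrite -(rmorph1 (@psC _)); apply: le_trans (Bnorm_psC _ _) _; rewrite pnormC cabs1. Qed.

Lemma BnormX K F k : Bnorm K (F ^+ k) <= Bnorm K F ^+ k.
Proof.
elim: k => [|k IH]; first by rewrite !expr0 Bnorm1.
rewrite !exprS; apply: le_trans (BnormM _ _ _) _.
by rewrite ler_wpM2l // Bnorm_ge0.
Qed.

Lemma Bnorm_psX K F : Bnorm K (psX _ * F) <= r * Bnorm K F.
Proof.
rewrite /Bnorm mulr_sumr; case: K => [|K]; first by rewrite !big_ord0.
rewrite big_ord_recl psXM pnorm0 mul0r add0r [leRHS]big_ord_recr /= -[leLHS]addr0.
apply: lerD; last by rewrite !mulr_ge0 // pnorm_ge0.
by apply: ler_sum => d _; rewrite psXM /bump /= add1n exprS mulrCA.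
Qed.

End FixedRadius.

(** The source of all smallness: reducing the radius gains one factor c per order of vanishing. *)
Lemma Bnorm_shrink r c m K F : 0 <= r -> 0 <= c -> c <= 1 -> psvanish m F ->
  Bnorm (c * r) K F <= c ^+ m * Bnorm r K F.
Proof.
move=> r0 c0 c1 Fm; rewrite /Bnorm mulr_sumr; apply: ler_sum => d _.
have [dm|md] := ltnP d m; first by rewrite Fm // pnorm0 !mul0r mulr0.
rewrite exprMn mulrCA ler_wpM2r ?mulr_ge0 ?exprn_ge0 ?pnorm_ge0 //.
exact: ler_wiXn2l.
Qed.

Lemma Bnorm_le r r' K F : 0 <= r -> r <= r' -> Bnorm r K F <= Bnorm r' K F.
Proof.
move=> r0 rr'; apply: ler_sum => d _; rewrite ler_wpM2l ?pnorm_ge0 //.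
by rewrite lerXn2r // nnegrE //; apply: le_trans rr'.
Qed.

End FixedRho.

End Norms.
#[global] Hint Extern 0 (is_true (_ <= cabs _)) => apply: cabs_ge0 : core.

Section Convergence.
Variable R : realType.
Local Notation C := R[i].
Implicit Types (f g p q : series2 R) (F G : pseries {poly C}).
Local Notation bl := (@bl R).

Lemma convergent_real f : convergent f <-> exists r M : R, 0 < r /\
  forall N, \sum_(i < N) \sum_(j < N) cabs (f i j) * r ^+ (i + j) <= M.
Proof.
have E (r : R) N : \sum_(i < N) \sum_(j < N) `|f i j| * (r%:C)%C ^+ (i + j)
    = ((\sum_(i < N) \sum_(j < N) cabs (f i j) * r ^+ (i + j))%:C)%C.
  rewrite rmorph_sum; apply: eq_bigr => i _; rewrite rmorph_sum.
  by apply: eq_bigr => j _; rewrite rmorphM rmorphXn cabsE.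
split=> [[r [M [r0 fM]]]|[r [M [r0 fM]]]]; last first.
  exists (r%:C)%C, (M%:C)%C; split; first by rewrite ltcR.
  by move=> N; rewrite E lecR.
have rE : r = ((complex.Re r)%:C)%C by rewrite RRe_real // gtr0_real.
have ME : M = ((complex.Re M)%:C)%C.
  have := fM 0%N; rewrite big_ord0 => M0; rewrite RRe_real // ger0_real //.
exists (complex.Re r), (complex.Re M); split; first by rewrite -ltcR -rE.
by move=> N; rewrite -lecR -E -rE -ME.
Qed.

Definition cvB (rho : R) F := exists r M : R, 0 < r /\ forall K, Bnorm rho r K F <= M.

Lemma Bnorm_bl rho r K f : Bnorm rho r K (bl f)
  = \sum_(k < K) \sum_(l < K - k) cabs (f k l) * r ^+ k * (r * rho) ^+ l.
Proof.
rewrite -(sum_antidiag (fun k l => cabs (f k l) * r ^+ k * (r * rho) ^+ l)).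
apply: eq_bigr => d _; rewrite (pnormE _ (size_bl f d)) mulr_suml.
apply: eq_bigr => -[j /= jd] _; rewrite coef_bl -ltnS jd exprMn.
have -> : r ^+ d = r ^+ (d - j) * r ^+ j by rewrite -exprD subnK.
by ring.
Qed.

(** Radii r in x and rho in t amount to radii r and r rho in (x, y). Hence rho is arbitrary: 1 in
    general, large when a division by a monic polynomial is involved. *)
Lemma convergentP rho f : 0 < rho -> convergent f <-> cvB rho (bl f).
Proof.
move=> rho0; rewrite convergent_real; split=> -[r [M [r0 fM]]].
  exists (Num.min r (r / rho)), M; split; first by rewrite lt_min r0 divr_gt0.
  move=> K; apply: le_trans (fM K); rewrite Bnorm_bl; set m := Num.min _ _.
  have m0 : 0 <= m by rewrite le_min (ltW r0) divr_ge0 // ltW.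
  apply: ler_sum => k _.
  rewrite (sum_sub_ord (fun l => cabs (f k l) * m ^+ k * (m * rho) ^+ l)).
  apply: ler_sum => l _; case: ifP => _; last by rewrite mulr_ge0 ?exprn_ge0 ?(ltW r0).
  rewrite -mulrA ler_wpM2l // exprD.
  apply: ler_pM; rewrite ?exprn_ge0 ?mulr_ge0 // ?(ltW rho0) //.
    by rewrite lerXn2r ?nnegrE // ?ge_min ?lexx // ltW.
  rewrite lerXn2r ?nnegrE ?mulr_ge0 // ?(ltW rho0) ?(ltW r0) // -ler_pdivlMr //.
  by rewrite ge_min lexx orbT.
exists (Num.min r (r * rho)), M; split; first by rewrite lt_min r0 mulr_gt0.
(* The square of side N lies in the triangle k + l < 2 N. *)
move=> N; apply: le_trans (fM (N + N)%N); rewrite Bnorm_bl.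
set m := Num.min _ _.
have m0 : 0 <= m by rewrite le_min (ltW r0) mulr_ge0 // ltW.
have t0 k l : 0 <= cabs (f k l) * r ^+ k * (r * rho) ^+ l.
  by rewrite !mulr_ge0 // exprn_ge0 // ?mulr_ge0 // ltW.
apply: (@le_trans _ _ (\sum_(k < N) \sum_(l < N + N - k) cabs (f k l) * r ^+ k * (r * rho) ^+ l)).
  apply: ler_sum => k _.
  have NN : (N <= N + N - k)%N by have := ltn_ord k; lia.
  rewrite (big_ord_widen (N + N - k)%N (fun l => cabs (f k l) * m ^+ (k + l))) // big_mkcond.
  apply: ler_sum => l _; case: ifP => // _; rewrite -mulrA ler_wpM2l // exprD.
  apply: ler_pM; rewrite ?exprn_ge0 //.
    by rewrite lerXn2r ?nnegrE ?(ltW r0) // ge_min lexx.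
  by rewrite lerXn2r ?nnegrE ?mulr_ge0 ?(ltW r0) ?(ltW rho0) // ge_min lexx orbT.
rewrite (big_ord_widen (N + N)%N (fun k => \sum_(l < N + N - k) cabs (f k l) * r ^+ k * (r * rho) ^+ l)) ?leq_addl //.
rewrite big_mkcond; apply: ler_sum => k _; case: ifP => // _.
by apply: sumr_ge0.
Qed.

Lemma cvB_D rho F G : 0 < rho -> cvB rho F -> cvB rho G -> cvB rho (F + G).
Proof.
move=> rho0 [r [M [r0 FM]]] [r' [M' [r'0 GM]]].
have m0 : 0 <= Num.min r r' by rewrite le_min !ltW.
exists (Num.min r r'), (M + M'); split; first by rewrite lt_min r0.
move=> K; apply: le_trans (BnormD _ _ _ _ _) _ => //.
by apply: lerD; [apply: le_trans (FM K) | apply: le_trans (GM K)];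
  apply: Bnorm_le; rewrite // ge_min lexx ?orbT.
Qed.

Lemma cvB_M rho F G : 0 < rho -> cvB rho F -> cvB rho G -> cvB rho (F * G).
Proof.
move=> rho0 [r [M [r0 FM]]] [r' [M' [r'0 GM]]].
have m0 : 0 <= Num.min r r' by rewrite le_min !ltW.
exists (Num.min r r'), (M * M'); split; first by rewrite lt_min r0.
move=> K; apply: le_trans (BnormM _ _ _ _ _) _ => //.
by apply: ler_pM; rewrite ?Bnorm_ge0 //; [apply: le_trans (FM K) | apply: le_trans (GM K)];
  apply: Bnorm_le; rewrite // ge_min lexx ?orbT.
Qed.

Lemma cvB_le rho F a : 0 < a ->
  (exists r M : R, 0 < r /\ forall K, a * Bnorm rho r K F <= M) -> cvB rho F.
Proof.
move=> a0 [r [M [r0 FM]]]; exists r, (M / a); split=> // K.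
by rewrite ler_pdivlMr // mulrC.
Qed.

Lemma convergentD f g : convergent f -> convergent g -> convergent (f + g).
Proof. by rewrite !(convergentP _ ltr01) rmorphD; apply: cvB_D. Qed.

Lemma convergentM f g : convergent f -> convergent g -> convergent (f * g).
Proof. by rewrite !(convergentP _ ltr01) rmorphM; apply: cvB_M. Qed.

Lemma convergentN f : convergent f -> convergent (- f).
Proof.
rewrite !(convergentP _ ltr01) rmorphN => -[r [M [r0 FM]]].
by exists r, M; split=> // K; rewrite BnormN.
Qed.

Lemma convergentB f g : convergent f -> convergent g -> convergent (f - g).
Proof. by move=> ? ?; apply: convergentD => //; apply: convergentN. Qed.

Lemma convergent_cser c : @convergent R (cser c).
Proof.
apply/(convergentP _ ltr01); exists 1, (cabs c); split=> // K.
by rewrite bl_cser; apply: le_trans (Bnorm_psC _ _ _ _) _; rewrite ?pnormC.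
Qed.

Lemma convergentX f k : convergent f -> convergent (f ^+ k).
Proof.
move=> fc; elim: k => [|k IH]; last by rewrite exprS; apply: convergentM.
by rewrite expr0 -(rmorph1 (@cser R)); apply: convergent_cser.
Qed.

Lemma convergent_Xs : @convergent R Xs.
Proof.
apply/(convergentP _ ltr01); exists 1, 1; split=> // K.
rewrite bl_Xs -[psX _]mulr1; apply: le_trans (Bnorm_psX _ _ _ _) _ => //.
by rewrite mul1r Bnorm1.
Qed.

Lemma convergent_psswap f : convergent f -> convergent (psswap f).
Proof.
move=> [r [M [r0 fM]]]; exists r, M; split=> // N.
rewrite exchange_big; apply: le_trans (fM N).
by apply: ler_sum => i _; apply: ler_sum => j _; rewrite addnC.
Qed.

Lemma convergent_Ys : @convergent R Ys.
Proof.
have -> : Ys = psswap Xs :> series2 R.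
  by apply/funext => i; apply/funext => j; rewrite /psswap /Xs /Ys andbC.
exact/convergent_psswap/convergent_Xs.
Qed.

Lemma bl_psdy f d : bl (psdy f) d = (bl f d.+1)^`().
Proof.
apply/polyP => j; rewrite coef_deriv !coef_bl ltnS.
by case: ifP => jd; rewrite ?mul0rn // /psdy subSS.
Qed.

Lemma convergent_psdy f : convergent f -> convergent (psdy f).
Proof.
rewrite !(convergentP _ ltr01) => -[r [M [r0 fM]]].
(* Halving the radius brings a factor 2^-(d + 1), which absorbs the degree produced by the
   derivative. *)
apply: (@cvB_le _ _ (r / 2)); first by rewrite divr_gt0.
exists (r / 2), M; split; first by rewrite divr_gt0.
move=> K; apply: le_trans (fM K.+1); rewrite /Bnorm mulr_sumr big_ord_recl.
apply: ler_wpDl; first by rewrite mulr_ge0 // pnorm_ge0.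
apply: ler_sum => d _; rewrite bl_psdy lift0.
have d0 : 0 <= (r / 2) by rewrite divr_ge0 // ltW.
have /le_trans -> // : r / 2 * (pnorm 1 (bl f d.+1)^`() * (r / 2) ^+ d)
    <= (pnorm 1 (bl f d.+1) * 2 ^+ d.+1) * (r / 2) ^+ d.+1.
  rewrite mulrCA -exprS ler_wpM2r ?exprn_ge0 //.
  have := pnorm_deriv ltr01 (bl f d.+1); rewrite mulr1 => /le_trans -> //.
  rewrite -[leLHS]mulr_natr ler_wpM2l ?pnorm_ge0 // -natrX ler_nat.
  by apply: leq_trans (ltnW (ltn_expl _ _)); rewrite // -subn1 leq_subLR add1n size_bl.
by rewrite -mulrA -exprMn mulrCA divff ?mulr1 // pnatr_eq0.
Qed.

Lemma convergent_psdx f : convergent f -> convergent (psdx f).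
Proof. by move=> /convergent_psswap/convergent_psdy/convergent_psswap. Qed.

Lemma convergent_shiftx f : convergent f -> @convergent R (fun i j => f i.+1 j).
Proof.
rewrite !convergent_real => -[r [M [r0 fM]]]; exists r, (M / r); split=> // N.
rewrite ler_pdivlMr // mulr_suml; apply: le_trans (fM N.+1).
rewrite [leRHS]big_ord_recl; apply: ler_wpDl.
  by apply: sumr_ge0 => j _; rewrite mulr_ge0 ?exprn_ge0 // ltW.
apply: ler_sum => i _; rewrite [leRHS]big_ord_recr mulr_suml; apply: ler_wpDr.
  by rewrite mulr_ge0 ?exprn_ge0 ?(ltW r0).
by apply: ler_sum => j _; rewrite /= /bump /= add1n addSn exprSr mulrA.
Qed.

(** With rho = 1 the norm of f at radius s is its majorant series evaluated at (s, s), and s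
    dominates both p and q. *)
Lemma Bnorm_pscomp r s K f p q : 0 <= r -> order_ge p 1 -> order_ge q 1 ->
    Bnorm 1 r K (bl p) <= s -> Bnorm 1 r K (bl q) <= s ->
  Bnorm 1 r K (bl (pscomp f p q)) <= Bnorm 1 s K (bl f).
Proof.
move=> r0 p1 q1 ps qs.
have s0 : 0 <= s by apply: le_trans ps; apply: Bnorm_ge0.
have /eqo_bl := @pscomp_trunc _ K f p q p1 q1; move=> /eq_Bnorm -> //.
rewrite (rmorph_sum bl) /=; apply: le_trans (Bnorm_sum _ _ _ _ _ _) _ => //.
apply: ler_sum => d _; rewrite bl_rsub_cser.
rewrite (pnormE _ (size_bl f d)) mulr_suml.
apply: le_trans (Bnorm_sum _ _ _ _ _ _) _ => //.
apply: ler_sum => -[j /= jd] _; rewrite coef_bl -ltnS jd expr1n mulr1.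
apply: le_trans (BnormM _ _ _ _ _) _ => //.
have -> : s ^+ d = s ^+ (d - j) * s ^+ j by rewrite -exprD subnK.
rewrite mulrA; apply: ler_pM; rewrite ?Bnorm_ge0 //; last first.
  by apply: le_trans (BnormX _ _ _ _ _) _ => //; rewrite lerXn2r ?nnegrE ?Bnorm_ge0.
apply: le_trans (BnormM _ _ _ _ _) _ => //.
apply: ler_pM; rewrite ?Bnorm_ge0 //; last first.
  by apply: le_trans (BnormX _ _ _ _ _) _ => //; rewrite lerXn2r ?nnegrE ?Bnorm_ge0.
by rewrite kcE; apply: le_trans (Bnorm_psC _ _ _ _) _; rewrite ?pnormC.
Qed.

Lemma small_radius f s : convergent f -> order_ge f 1 -> 0 < s ->
  exists2 r : R, 0 < r &
    forall r', 0 <= r' -> r' <= r -> forall K, Bnorm 1 r' K (bl f) <= s.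
Proof.
move=> /(convergentP _ ltr01)[r [M [r0 fM]]] /order_ge_bl f1 s0.
have M0 : 0 <= M by apply: le_trans (fM 0%N); rewrite /Bnorm big_ord0.
pose c := Num.min 1 (s / (M + 1)).
have Mp : 0 < M + 1 by rewrite ltr_wpDl.
have c0 : 0 < c by rewrite lt_min ltr01 divr_gt0.
exists (c * r); first exact: mulr_gt0.
move=> r' r'0 r'c K; apply: le_trans (Bnorm_le _ _ _ r'0 r'c) _ => //.
have cle1 : c <= 1 by rewrite ge_min lexx.
apply: le_trans (Bnorm_shrink ltr01 K (ltW r0) (ltW c0) cle1 f1) _.
rewrite expr1; apply: (@le_trans _ _ (c * (M + 1))).
  by rewrite ler_wpM2l ?(ltW c0) // (le_trans (fM K)) // lerDl.
by rewrite -ler_pdivlMr // ge_min lexx orbT.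
Qed.

Lemma convergent_pscomp f p q : convergent f -> convergent p -> convergent q ->
  order_ge p 1 -> order_ge q 1 -> convergent (pscomp f p q).
Proof.
move=> /(convergentP _ ltr01)[s [M [s0 fM]]] pc qc p1 q1.
have [r r0 pr] := small_radius pc p1 s0; have [r' r'0 qr] := small_radius qc q1 s0.
have m0 : 0 < Num.min r r' by rewrite lt_min r0.
apply/(convergentP _ ltr01); exists (Num.min r r'), M; split=> // K.
apply: le_trans (fM K); apply: Bnorm_pscomp; rewrite ?(ltW m0) //.
  by apply: pr; rewrite ?(ltW m0) // ge_min lexx.
by apply: qr; rewrite ?(ltW m0) // ge_min lexx orbT.
Qed.

Lemma series2_inv f : f 0%N 0%N != 0 -> exists g, f * g = 1.
Proof.
move=> f0; have [] := @ps_inv _ (f 0%N 0%N)^-1 (f 0%N); first by rewrite mulVf.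
by move=> c fc; apply: (@ps_inv _ c); rewrite mulrC.
Qed.

Lemma convergent_inv f g : convergent f -> f * g = 1 -> convergent g.
Proof.
move=> fc fg.
have e0 : f 0%N 0%N * g 0%N 0%N = 1.
  by have := congr1 (fun h : series2 R => h 0%N 0%N) fg; rewrite !psM0.
have f0 : f 0%N 0%N != 0 by apply: contraTneq isT => f0; move: e0; rewrite f0 mul0r => /esym/eqP; rewrite oner_eq0.
pose c := (f 0%N 0%N)^-1; pose u := 1 - cser c * f.
have u1 : order_ge u 1.
  by apply/order_ge1; rewrite /u !psB cserM mulVf //; exact: subrr.
have uc : convergent u.
  apply: convergentB; last by apply: convergentM => //; apply: convergent_cser.
  by rewrite -(rmorph1 (@cser R)); apply: convergent_cser.
(* An a priori estimate: where the norm of u is at most 1/2, this relation bounds the truncated norm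
   of g, a finite number, by 2 |c|. *)
have gE : g = cser c + u * g by rewrite /u mulrBl mul1r -mulrA fg mulr1; ring.
have half0 : 0 < 1 / 2 :> R by rewrite divr_gt0.
have [r r0 ur] := small_radius uc u1 half0.
apply/(convergentP _ ltr01); exists r, (2 * cabs c); split=> // K.
have := ur r (ltW r0) (lexx _) K; have := Bnorm_ge0 ltr01 (ltW r0) K (bl g).
have : Bnorm 1 r K (bl g) <= cabs c + Bnorm 1 r K (bl u) * Bnorm 1 r K (bl g).
  have E : bl g = psC c%:P + bl u * bl g.
    by rewrite -bl_cser -(rmorphM bl) -(rmorphD bl) -gE.
  rewrite {1}E; apply: le_trans (BnormD _ _ _ _ _) _ => //; first exact: ltW.
  apply: lerD; last by apply: BnormM => //; apply: ltW.
  by apply: le_trans (Bnorm_psC _ _ _ _) _; rewrite ?pnormC // ltW.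
nra.
Qed.

End Convergence.

(** * Fixed points by majorants, for inversion and linearization *)

Section Majorant.
Variable R : realType.
Local Notation C := R[i].
Implicit Types (f g p q : series2 R) (v : series2 R * series2 R).
Local Notation bl := (@bl R).
Local Notation cser := (@cser R).

Lemma eqo_order N f g : eqo N f g <-> order_ge (f - g) N.
Proof.
by rewrite eqo_bl order_ge_bl rmorphB.
Qed.

Lemma order_geW M N f : (N <= M)%N -> order_ge f M -> order_ge f N.
Proof. by move=> NM fM i j ij; apply: fM; apply: leq_trans NM. Qed.

Lemma order_ge0 N : order_ge (0 : series2 R) N.
Proof. by []. Qed.

Lemma eqoX N p p' a : order_ge p 1 -> order_ge p' 1 -> eqo N p p' ->
  order_ge (p ^+ a - p' ^+ a) (N + a).-1.
Proof.
move=> p1 p'1 /eqo_order pp'; elim: a => [|a IH].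
  by rewrite !expr0 subrr; apply: order_ge0.
rewrite (_ : _ - _ = (p - p') * p ^+ a + p' * (p ^+ a - p' ^+ a)); last by rewrite !exprS; ring.
rewrite addnS /=; apply: order_geD; first by apply: order_geM => //; apply: order_geX.
by apply: (@order_geW (1 + (N + a).-1)%N); [lia | apply: order_geM].
Qed.

Lemma eqo_sum M N (F G : nat -> series2 R) :
  (forall d, (d < M)%N -> eqo N (F d) (G d)) -> eqo N (\sum_(d < M) F d) (\sum_(d < M) G d).
Proof.
move=> e i j ij; rewrite 4!ps_sum.
by apply: eq_bigr => -[d /= dM] _; apply: e.
Qed.

Lemma rsub_cserE p q f d : rsub cser p q f d
  = \sum_(k < d.+1) cser (f (d - k)%N k) * (p ^+ (d - k) * q ^+ k).
Proof. by rewrite rsubE; apply: eq_bigr => k _; rewrite mulrA. Qed.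

(** As f has order at least 2, every monomial contains a second factor without constant term, which
    gains one order. The iteration below thus stabilizes degree by degree. *)
Lemma pscomp_causal N f p q p' q' :
    order_ge p 1 -> order_ge q 1 -> order_ge p' 1 -> order_ge q' 1 ->
    order_ge f 2 -> eqo N p p' -> eqo N q q' ->
  eqo N.+1 (pscomp f p q) (pscomp f p' q').
Proof.
move=> p1 q1 p'1 q'1 f2 pp' qq'.
apply: eqo_trans (pscomp_trunc f p1 q1) _; apply: eqo_sym.
apply: eqo_trans (pscomp_trunc f p'1 q'1) _; apply: eqo_sym.
apply: (eqo_sum (F := rsub cser p q f) (G := rsub cser p' q' f)) => d dN.
rewrite !rsub_cserE; apply: (eqo_sum (F := fun k => cser (f (d - k)%N k) * (p ^+ (d - k) * q ^+ k))
  (G := fun k => cser (f (d - k)%N k) * (p' ^+ (d - k) * q' ^+ k))) => k /ltnSE kd.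
have E0 x y : eqo N.+1 (cser 0 * x) (cser 0 * y) by rewrite (rmorph0 cser) !mul0r.
have [d2|d2] := ltnP d 2.
  have -> : f (d - k)%N k = 0 by apply: f2; rewrite subnK.
  exact: E0.
apply: eqoM; first by [].
apply/eqo_order; rewrite (_ : _ - _ = (p ^+ (d - k) - p' ^+ (d - k)) * q ^+ k
  + p' ^+ (d - k) * (q ^+ k - q' ^+ k)); last by ring.
apply: order_geD.
  apply: (@order_geW ((N + (d - k)).-1 + k)%N); first lia.
  by apply: order_geM; [apply: eqoX | apply: order_geX].
apply: (@order_geW ((d - k) + (N + k).-1)%N); first lia.
by apply: order_geM; [apply: order_geX | apply: eqoX].
Qed.

Lemma Bnorm_order2 f : convergent f -> order_ge f 2 ->
  exists2 s0 : R, 0 < s0 &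
    forall s, 0 <= s -> s <= s0 -> forall K, Bnorm 1 (s + s) K (bl f) <= s.
Proof.
move=> /(convergentP _ ltr01)[r [M [r0 fM]]] /order_ge_bl f2.
have M0 : 0 <= M by apply: le_trans (fM 0%N); rewrite /Bnorm big_ord0.
have d0 : 0 < 4 * (M + 1) by rewrite mulr_gt0 // ltr_wpDl.
(* The first bound gives 2 s <= r; the second is (2 s / r)^2 (M + 1) <= s solved for s. *)
exists (Num.min (r / 2) (r ^+ 2 / (4 * (M + 1)))).
  by rewrite lt_min !divr_gt0 // exprn_gt0.
move=> s s0; rewrite le_min => /andP[sr sM] K.
have -> : s + s = (s + s) / r * r by rewrite divfK // gt_eqF.
have c0 : 0 <= (s + s) / r by rewrite divr_ge0 ?addr_ge0 // ltW.
have c1 : (s + s) / r <= 1 by rewrite ler_pdivrMr // mul1r; lra.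
apply: le_trans (Bnorm_shrink ltr01 K (ltW r0) c0 c1 f2) _.
apply: (@le_trans _ _ (((s + s) / r) ^+ 2 * (M + 1))).
  by rewrite ler_wpM2l ?exprn_ge0 // (le_trans (fM K)) // lerDl.
rewrite exprMn exprVn mulrAC ler_pdivrMr ?exprn_gt0 //.
rewrite ler_pdivlMr // in sM.
have -> : (s + s) ^+ 2 * (M + 1) = s * (s * (4 * (M + 1))) by ring.
by rewrite ler_wpM2l.
Qed.

Lemma pnorm_scale (c : nat -> C) f d : (forall k, cabs (c k) <= 1) ->
  pnorm 1 (bl (fun i j => c (i + j)%N * f i j) d) <= pnorm 1 (bl f d).
Proof.
move=> c1; rewrite !(pnormE _ (size_bl _ d)); apply: ler_sum => -[j /= jd] _.
rewrite !expr1n !mulr1 !coef_bl -ltnS jd cabsM -[leRHS]mul1r.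
by rewrite ler_wpM2r.
Qed.

Lemma Bnorm_Xs r K : 0 <= r -> Bnorm 1 r K (bl Xs) <= r.
Proof.
move=> r0; rewrite bl_Xs -[psX _]mulr1; apply: le_trans (Bnorm_psX _ _ _ _) _ => //.
by rewrite -[leRHS]mulr1 ler_wpM2l // Bnorm1.
Qed.

Lemma Bnorm_Ys r K : 0 <= r -> Bnorm 1 r K (bl Ys) <= r.
Proof.
move=> r0; rewrite bl_Ys mulrC; apply: le_trans (Bnorm_psX _ _ _ _) _ => //.
rewrite -[leRHS]mulr1 ler_wpM2l //; apply: le_trans (Bnorm_psC _ _ _ _) _ => //.
rewrite (@pnormE _ _ 2) ?size_polyX // big_ord_recl big_ord1 /= !coefX /=.
by rewrite cabs0 cabs1 mul0r add0r mul1r expr1n.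
Qed.

Section Iteration.
Variables (c : nat -> C) (Y1 Y2 : series2 R).
Hypotheses (Y1o : order_ge Y1 2) (Y2o : order_ge Y2 2).

Definition mstep Y v : series2 R :=
  fun i j => c (i + j)%N * pscomp Y (Xs + v.1) (Ys + v.2) i j.

Definition miter m : series2 R * series2 R :=
  iter m (fun v => (mstep Y1 v, mstep Y2 v)) (0, 0).

Definition order2 v := order_ge v.1 2 /\ order_ge v.2 2.

Lemma order_Xs_add g : order_ge g 2 -> order_ge (Xs + g) 1.
Proof. by move=> g2; apply/order_ge1; rewrite !psD g2 // addr0. Qed.

Lemma order_Ys_add g : order_ge g 2 -> order_ge (Ys + g) 1.
Proof. by move=> g2; apply/order_ge1; rewrite !psD g2 // addr0. Qed.

Lemma order_mstep Y v : order_ge Y 2 -> order2 v -> order_ge (mstep Y v) 2.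
Proof.
move=> Y2' [v1 v2] i j ij; rewrite /mstep.
by rewrite (order_ge_pscomp (order_Xs_add v1) (order_Ys_add v2) Y2' ij) mulr0.
Qed.

Lemma order_miter m : order2 (miter m).
Proof. by elim: m => [//|m IH]; split; apply: order_mstep. Qed.

Lemma mstep_causal N Y v v' : order_ge Y 2 -> order2 v -> order2 v' ->
  eqo N v.1 v'.1 -> eqo N v.2 v'.2 -> eqo N.+1 (mstep Y v) (mstep Y v').
Proof.
move=> Y2' [a1 a2] [b1 b2] e1 e2 i j ij.
apply: (congr1 (fun z => c (i + j)%N * z)).
apply: (pscomp_causal (order_Xs_add a1) (order_Ys_add a2)
          (order_Xs_add b1) (order_Ys_add b2) Y2' _ _ ij); exact: eqoD.
Qed.

Lemma miter_step m :
  eqo m (miter m).1 (miter m.+1).1 /\ eqo m (miter m).2 (miter m.+1).2.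
Proof.
elim: m => [//|m [e1 e2]].
by split; apply: mstep_causal e1 e2 => //; apply: order_miter.
Qed.

Lemma miter_steps m k :
  eqo m (miter m).1 (miter (m + k)).1 /\ eqo m (miter m).2 (miter (m + k)).2.
Proof.
elim: k => [|k [e1 e2]]; first by rewrite addn0.
have [f1 f2] := miter_step (m + k)%N; rewrite addnS.
by split; [apply: eqo_trans e1 (eqoW _ f1) | apply: eqo_trans e2 (eqoW _ f2)];
  apply: leq_addr.
Qed.

Definition mlim1 : series2 R := fun i j => (miter (i + j).+1).1 i j.
Definition mlim2 : series2 R := fun i j => (miter (i + j).+1).2 i j.

Lemma miter_lim m : eqo m (miter m).1 mlim1 /\ eqo m (miter m).2 mlim2.
Proof.
split=> i j ij; have E : ((i + j).+1 + (m - (i + j).+1))%N = m by rewrite subnKC.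
  have [e _] := miter_steps (i + j).+1 (m - (i + j).+1)%N; rewrite E in e.
  by rewrite /mlim1 e.
have [_ e] := miter_steps (i + j).+1 (m - (i + j).+1)%N; rewrite E in e.
by rewrite /mlim2 e.
Qed.

Lemma order_mlim : order2 (mlim1, mlim2).
Proof.
have [e1 e2] := miter_lim 2; have [o1 o2] := order_miter 2.
split=> i j ij.
  exact: etrans (esym (e1 i j ij)) (o1 i j ij).
exact: etrans (esym (e2 i j ij)) (o2 i j ij).
Qed.

Lemma mlimE :
  mlim1 = mstep Y1 (mlim1, mlim2) /\ mlim2 = mstep Y2 (mlim1, mlim2).
Proof.
split; apply: eqoP => N; have [e1 e2] := miter_lim N;
  have [e1' e2'] := miter_lim N.+1.
- apply: (eqoW (leqnSn N)); apply: eqo_trans (eqo_sym e1') _.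
  exact: (mstep_causal Y1o (order_miter N) order_mlim e1 e2).
- apply: (eqoW (leqnSn N)); apply: eqo_trans (eqo_sym e2') _.
  exact: (mstep_causal Y2o (order_miter N) order_mlim e1 e2).
Qed.

Hypothesis c1 : forall k, cabs (c k) <= 1.

(** At radius s both components of id + v have norm at most s + s, and Y maps the ball of radius 2 s
    into that of radius s; multipliers of modulus at most 1 keep it there. *)
Lemma Bnorm_mstep s Y v K : 0 <= s -> order2 v ->
    (forall K, Bnorm 1 (s + s) K (bl Y) <= s) ->
    Bnorm 1 s K (bl v.1) <= s -> Bnorm 1 s K (bl v.2) <= s ->
  Bnorm 1 s K (bl (mstep Y v)) <= s.
Proof.
move=> s0 [v1 v2] Ys' b1 b2.
apply: (@le_trans _ _ (Bnorm 1 s K (bl (pscomp Y (Xs + v.1) (Ys + v.2))))).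
  by apply: ler_sum => d _; rewrite ler_wpM2r ?exprn_ge0 //; apply: pnorm_scale.
apply: le_trans (Ys' K).
apply: (@Bnorm_pscomp R s (s + s) K Y _ _ s0 (order_Xs_add v1) (order_Ys_add v2)).
  rewrite (rmorphD bl); apply: le_trans (BnormD _ _ _ _ _) _; [by [] | by [] |].
  by apply: lerD b1; apply/Bnorm_Xs.
rewrite (rmorphD bl); apply: le_trans (BnormD _ _ _ _ _) _; [by [] | by [] |].
by apply: lerD b2; apply/Bnorm_Ys.
Qed.

Lemma Bnorm_miter s m K : 0 <= s ->
    (forall K, Bnorm 1 (s + s) K (bl Y1) <= s) ->
    (forall K, Bnorm 1 (s + s) K (bl Y2) <= s) ->
  Bnorm 1 s K (bl (miter m).1) <= s /\ Bnorm 1 s K (bl (miter m).2) <= s.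
Proof.
move=> s0 Y1s Y2s; elim: m => [|m [b1 b2]]; first by rewrite /= (rmorph0 bl) Bnorm0.
by split; [apply: (Bnorm_mstep s0 (order_miter m) Y1s b1 b2)
          | apply: (Bnorm_mstep s0 (order_miter m) Y2s b1 b2)].
Qed.

Lemma convergent_mlim : convergent Y1 -> convergent Y2 ->
  convergent mlim1 /\ convergent mlim2.
Proof.
move=> Y1c Y2c.
have [s1 s10 Y1s] := Bnorm_order2 Y1c Y1o; have [s2 s20 Y2s] := Bnorm_order2 Y2c Y2o.
pose s := Num.min s1 s2.
have s0 : 0 < s by rewrite lt_min s10.
have sl1 : s <= s1 by rewrite ge_min lexx.
have sl2 : s <= s2 by rewrite ge_min lexx orbT.
have b m K := @Bnorm_miter s m K (ltW s0) (Y1s s (ltW s0) sl1) (Y2s s (ltW s0) sl2).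
(* Below order K the limit coincides with the K-th iterate, whose norm is at most s. *)
split; apply/(convergentP _ ltr01); exists s, s; split=> // K;
  have [e1 e2] := miter_lim K; have [b1 b2] := b K K.
  by move/eqo_bl: e1 => /eq_Bnorm <-.
by move/eqo_bl: e2 => /eq_Bnorm <-.
Qed.

End Iteration.

(* With [c = -1] the fixed point inverts [id + Y]; with [c k = 1 / (k - 1)] it
   linearizes the radial field [id + Y].  In both cases nothing is lost on the
   norms, so that the iterates stay in a fixed ball. *)
Lemma majorant_fixpoint (c : nat -> C) Y1 Y2 :
    (forall k, cabs (c k) <= 1) -> convergent Y1 -> convergent Y2 ->
    order_ge Y1 2 -> order_ge Y2 2 ->
  exists g1 g2 : series2 R,
    [/\ convergent g1, convergent g2, order_ge g1 2, order_ge g2 2 &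
      forall i j, g1 i j = c (i + j)%N * pscomp Y1 (Xs + g1) (Ys + g2) i j
               /\ g2 i j = c (i + j)%N * pscomp Y2 (Xs + g1) (Ys + g2) i j].
Proof.
move=> c1 Y1c Y2c Y1o Y2o.
have [cv1 cv2] := convergent_mlim Y1o Y2o c1 Y1c Y2c.
have [o1 o2] := order_mlim c Y1o Y2o; have [e1 e2] := mlimE c Y1o Y2o.
move: (mlim1 c Y1 Y2) (mlim2 c Y1 Y2) cv1 cv2 o1 o2 e1 e2 => g1 g2 cv1 cv2 o1 o2 e1 e2.
exists g1, g2; split; [exact: cv1 | exact: cv2 | exact: o1 | exact: o2 |].
move=> i j; split.
  exact: (congr1 (fun g : series2 R => g i j) e1).
exact: (congr1 (fun g : series2 R => g i j) e2).
Qed.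

End Majorant.

(** * Germs of maps and pull-backs *)

Section GermMaps.
Variable R : realType.
Local Notation C := R[i].
Implicit Types (f g p q : series2 R) (F G H : germmap R) (w : oneform R).
Local Notation bl := (@bl R).
Local Notation cser := (@cser R).

Definition germ F := order_ge F.1 1 /\ order_ge F.2 1.
Definition gcomp F G : germmap R := (pscomp F.1 G.1 G.2, pscomp F.2 G.1 G.2).
Definition gid : germmap R := (Xs, Ys).

Lemma order_Xs : order_ge (Xs : series2 R) 1. Proof. exact/order_ge1. Qed.
Lemma order_Ys : order_ge (Ys : series2 R) 1. Proof. exact/order_ge1. Qed.

Lemma germ_gcomp F G : germ F -> germ G -> germ (gcomp F G).
Proof. by move=> [F1 F2] [G1 G2]; split; apply: order_ge_pscomp. Qed.

Lemma gcompA F G H : germ G -> germ H -> gcomp (gcomp F G) H = gcomp F (gcomp G H).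
Proof.
move=> [G1 G2] [H1 H2].
exact: (congr2 pair (pscompA F.1 G1 G2 H1 H2) (pscompA F.2 G1 G2 H1 H2)).
Qed.

Lemma gcompF1 F : gcomp F gid = F.
Proof. by case: F => a b; rewrite /gcomp /= !pscomp_id. Qed.

Lemma gcomp1F F : germ F -> gcomp gid F = F.
Proof.
case: F => a b [/= a1 b1].
exact: (congr2 pair (pscomp_Xs a1 b1) (pscomp_Ys a1 b1)).
Qed.

Lemma pscompD f g p q : pscomp (f + g) p q = pscomp f p q + pscomp g p q.
Proof.
have -> : f + g = f - (0 - g) by rewrite sub0r opprK.
rewrite !pscompB (_ : pscomp 0 p q = 0) ?sub0r ?opprK //.
by have := pscomp_cser 0 p q; rewrite (rmorph0 cser).
Qed.

Lemma pscomp_lin2 a b c d p q : order_ge p 1 -> order_ge q 1 ->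
  pscomp (a * b + c * d) p q
  = pscomp a p q * pscomp b p q + pscomp c p q * pscomp d p q.
Proof. by move=> p1 q1; rewrite pscompD !pscompM. Qed.

Lemma pullback_gcomp F G w : germ F -> germ G ->
  pullback G (pullback F w) = pullback (gcomp F G) w.
Proof.
move=> [F1 F2] [G1 G2]; rewrite /pullback /gcomp.
have chx p := psdx_pscomp p G1 G2; have chy p := psdy_pscomp p G1 G2.
have A p := pscompA p F1 F2 G1 G2.
rewrite [(_, _).1]/= [(_, _).2]/= !chx !chy -!A.
rewrite !(pscomp_lin2 _ _ _ _ G1 G2).
by congr (_, _); ring.
Qed.

Lemma holomorphic_gcomp F G : germ G ->
  holomorphic F -> holomorphic G -> holomorphic (gcomp F G).
Proof.
move=> [G1 G2] [F1 F2] [Gc1 Gc2].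
by split; apply: (convergent_pscomp _ Gc1 Gc2 G1 G2).
Qed.

Definition jac F : C :=
  F.1 1%N 0%N * F.2 0%N 1%N - F.1 0%N 1%N * F.2 1%N 0%N.

Lemma pscomp_x f p q : order_ge f 1 -> order_ge p 1 -> order_ge q 1 ->
  pscomp f p q 1%N 0%N = f 1%N 0%N * p 1%N 0%N + f 0%N 1%N * q 1%N 0%N.
Proof.
move=> f1 p1 q1; have := hev_pscomp 1 0 p1 q1 f1.
by rewrite !hev1 !mulr0 !mulr1 !addr0.
Qed.

Lemma pscomp_y f p q : order_ge f 1 -> order_ge p 1 -> order_ge q 1 ->
  pscomp f p q 0%N 1%N = f 1%N 0%N * p 0%N 1%N + f 0%N 1%N * q 0%N 1%N.
Proof.
move=> f1 p1 q1; have := hev_pscomp 0 1 p1 q1 f1.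
by rewrite !hev1 !mulr0 !mulr1 !add0r.
Qed.

Lemma jac_gcomp F G : germ F -> germ G -> jac (gcomp F G) = jac F * jac G.
Proof.
move=> [F1 F2] [G1 G2]; rewrite /jac /gcomp.
rewrite [(_, _).1]/= [(_, _).2]/=.
by rewrite !pscomp_x // !pscomp_y //; ring.
Qed.

Lemma jac_gid : jac gid = 1.
Proof. by rewrite /jac /gid /Xs /Ys /= mulr1 mul0r subr0. Qed.

Definition lin (a b c d : C) : germmap R :=
  (cser a * Xs + cser b * Ys, cser c * Xs + cser d * Ys).

Lemma lin_coef a b i j : (cser a * Xs + cser b * Ys) i j
  = a * ((i == 1) && (j == 0))%:R + b * ((i == 0) && (j == 1))%:R.
Proof. by rewrite 2!psD !cserM. Qed.

Lemma germ_lin a b c d : germ (lin a b c d).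
Proof.
by split; apply/order_ge1; apply: etrans (lin_coef _ _ _ _) _; rewrite !mulr0 addr0.
Qed.

Lemma holomorphic_lin a b c d : holomorphic (lin a b c d).
Proof.
have cX := convergent_Xs R; have cY := convergent_Ys R.
have cC c' := @convergent_cser R c'.
by split; apply: convergentD; apply: convergentM.
Qed.

Lemma pscomp_lin a b p q : order_ge p 1 -> order_ge q 1 ->
  pscomp (cser a * Xs + cser b * Ys) p q = cser a * p + cser b * q.
Proof.
move=> p1 q1; rewrite (pscomp_lin2 _ _ _ _ p1 q1) !pscomp_cser.
by rewrite (pscomp_Xs p1 q1) (pscomp_Ys p1 q1).
Qed.

Definition linv F : germmap R :=
  let e := (jac F)^-1 in
  lin (e * F.2 0%N 1%N) (- e * F.1 0%N 1%N) (- e * F.2 1%N 0%N) (e * F.1 1%N 0%N).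

Definition glin F : germmap R :=
  lin (F.1 1%N 0%N) (F.1 0%N 1%N) (F.2 1%N 0%N) (F.2 0%N 1%N).

Lemma lin_gcomp a b c d a' b' c' d' :
  gcomp (lin a b c d) (lin a' b' c' d')
  = lin (a * a' + b * c') (a * b' + b * d') (c * a' + d * c') (c * b' + d * d').
Proof.
have [l1 l2] := germ_lin a' b' c' d'; rewrite {1}/lin /gcomp.
rewrite !(pscomp_lin _ _ l1 l2) /lin [(_, _).1]/= [(_, _).2]/=.
by congr (_, _); rewrite !(rmorphD cser) !(rmorphM cser); ring.
Qed.

Lemma lin1 : lin 1 0 0 1 = gid.
Proof. by rewrite /lin (rmorph1 cser) (rmorph0 cser) !mul1r !mul0r addr0 add0r. Qed.

Lemma glin_linv F : jac F != 0 -> gcomp (glin F) (linv F) = gid.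
Proof.
move=> jF; rewrite /glin /linv lin_gcomp -lin1 /jac.
by congr lin; field.
Qed.

Lemma order_ge2 f : f 0%N 0%N = 0 -> f 1%N 0%N = 0 -> f 0%N 1%N = 0 -> order_ge f 2.
Proof. by move=> f0 fx fy [|[|i]] [|[|j]]. Qed.

Lemma psd2 f g i j : (f + g) i j = f i j + g i j.
Proof. by []. Qed.

Lemma psb2 f g i j : (f - g) i j = f i j - g i j.
Proof. by []. Qed.

(* [id + Y] is inverted on the right by [id + g], with [g = - Y o (id + g)]. *)
Lemma gcomp_right_inverse F : germ F -> holomorphic F -> jac F != 0 ->
  exists G, [/\ germ G, holomorphic G & gcomp F G = gid].
Proof.
move=> gF hF jF; pose L := linv F; have gL : germ L by apply: germ_lin.
have hL : holomorphic L by apply: holomorphic_lin.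
have gF' : germ (gcomp L F) by apply: germ_gcomp.
have hF' : holomorphic (gcomp L F) by apply: holomorphic_gcomp.
have [F1 F2] := gF.
have [Y1 [Y2 [FE Y1o Y2o Y1c Y2c]]] : exists Y1 Y2 : series2 R, [/\ gcomp L F = (Xs + Y1, Ys + Y2),
    order_ge Y1 2, order_ge Y2 2, convergent Y1 & convergent Y2].
  have E1 f : f = Xs + (f - Xs) by rewrite addrC subrK.
  have E2 f : f = Ys + (f - Ys) by rewrite addrC subrK.
  have F10 : F.1 0%N 0%N = 0 by apply/order_ge1.
  have F20 : F.2 0%N 0%N = 0 by apply/order_ge1.
  have jF' : F.1 1%N 0%N * F.2 0%N 1%N - F.1 0%N 1%N * F.2 1%N 0%N != 0 := jF.
  have LF : gcomp L F = (cser ((jac F)^-1 * F.2 0%N 1%N) * F.1 + cser (- (jac F)^-1 * F.1 0%N 1%N) * F.2,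
      cser (- (jac F)^-1 * F.2 1%N 0%N) * F.1 + cser ((jac F)^-1 * F.1 1%N 0%N) * F.2).
    exact: (congr2 pair (pscomp_lin _ _ F1 F2) (pscomp_lin _ _ F1 F2)).
  exists ((gcomp L F).1 - Xs), ((gcomp L F).2 - Ys); split.
  - by rewrite -E1 -E2 -surjective_pairing.
  - rewrite LF /jac [(_, _).1]/=; apply: order_ge2; rewrite psb2 psd2 !cserM ?F10 ?F20 /Xs /=.
    + by rewrite !mulr0 addr0 subrr.
    + by field.
    + by field.
  - rewrite LF /jac [(_, _).2]/=; apply: order_ge2; rewrite psb2 psd2 !cserM ?F10 ?F20 /Ys /=.
    + by rewrite !mulr0 addr0 subrr.
    + by field.
    + by field.
  - by apply: convergentB (convergent_Xs R); case: hF'.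
  - by apply: convergentB (convergent_Ys R); case: hF'.
have c1 (k : nat) : cabs ((fun _ : nat => -1 : C) k) <= 1 by rewrite cabsN cabs1.
have [g1 [g2 [g1c g2c g1o g2o gE]]] :=
  majorant_fixpoint (c := fun _ => -1) c1 Y1c Y2c Y1o Y2o.
pose H : germmap R := (Xs + g1, Ys + g2).
have gH : germ H by split; [exact: order_Xs_add | exact: order_Ys_add].
have hH : holomorphic H.
  by split; apply: convergentD => //; [apply: convergent_Xs | apply: convergent_Ys].
have FH : gcomp (gcomp L F) H = gid.
  rewrite FE; have [H1 H2] := gH.
  have E1 : pscomp (Xs + Y1) H.1 H.2 = Xs.
    rewrite pscompD (pscomp_Xs H1 H2); apply/funext => i; apply/funext => j.
    rewrite psd2 [H.1 i j]psd2 (proj1 (gE i j)).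
    by rewrite mulN1r addrNK.
  have E2 : pscomp (Ys + Y2) H.1 H.2 = Ys.
    rewrite pscompD (pscomp_Ys H1 H2); apply/funext => i; apply/funext => j.
    rewrite psd2 [H.2 i j]psd2 (proj2 (gE i j)).
    by rewrite mulN1r addrNK.
  exact: (congr2 pair E1 E2).
have gFL : germ (gcomp F H) by apply: germ_gcomp.
exists (gcomp H L); split; [exact: germ_gcomp | exact: holomorphic_gcomp |].
have ggl : germ (glin F) by apply: germ_lin.
have FHE : gcomp F H = glin F.
  rewrite -[LHS](gcomp1F gFL) -(glin_linv jF) (gcompA _ gL gFL).
  rewrite -(gcompA L gF gH) FH; exact: gcompF1.
by rewrite -(gcompA F gH gL) FHE; apply: glin_linv.
Qed.

Lemma biholomorphismP F :
  biholomorphism F <-> [/\ germ F, holomorphic F & jac F != 0].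
Proof.
split=> [[hF F1 F2 [G [hG G1 G2 [FG1 FG2] [GF1 GF2]]]]|[gF hF jF]].
  have gF : germ F by split; apply/order_ge1.
  have gG : germ G by split; apply/order_ge1.
  split=> //; apply: contraTneq isT => jF.
  have FG : gcomp F G = gid by exact: (congr2 pair GF1 GF2).
  have := jac_gcomp gF gG; rewrite FG jac_gid jF mul0r => /eqP.
  by rewrite oner_eq0.
have [G [gG hG FG]] := gcomp_right_inverse gF hF jF.
have jG : jac G != 0.
  apply: contraTneq isT => jG; have := jac_gcomp gF gG.
  by rewrite FG jac_gid jG mulr0 => /eqP; rewrite oner_eq0.
(* The right inverse G of F has itself a right inverse H, and H = (F G) H = F (G H) = F: so G is
   two-sided. *)
have [H [gH hH GH]] := gcomp_right_inverse gG hG jG.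
have HF : H = F.
  by rewrite -[LHS](gcomp1F gH) -FG (gcompA F gG gH) GH gcompF1.
have GF : gcomp G F = gid by rewrite -HF.
have [F1 F2] := gF; have [G1 G2] := gG.
split; [exact: hF | exact/order_ge1 | exact/order_ge1 |].
exists G; split; [exact: hG | exact/order_ge1 | exact/order_ge1 | |].
  by split; [exact: (congr1 fst GF) | exact: (congr1 snd GF)].
by split; [exact: (congr1 fst FG) | exact: (congr1 snd FG)].
Qed.

Lemma germ_inverse F : biholomorphism F ->
  exists G, [/\ biholomorphism G, germ G, gcomp F G = gid & gcomp G F = gid].
Proof.
move=> bF; have [hF F1 F2 [G [hG G1 G2 [FG1 FG2] [GF1 GF2]]]] := bF.
exists G; split.
- split; [exact: hG | exact: G1 | exact: G2 |].
  by exists F; split; [exact: hF | exact: F1 | exact: F2 | split | split].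
- by split; apply/order_ge1.
- exact: (congr2 pair GF1 GF2).
- exact: (congr2 pair FG1 FG2).
Qed.

End GermMaps.

(** * The tangency divisor *)

Section Blowup.
Variable R : realType.
Local Notation C := R[i].
Implicit Types (f g : series2 R) (w : oneform R) (X : vfield R).
Local Notation bl := (@bl R).

Lemma psswapM f g : psswap (f * g) = psswap f * psswap g.
Proof.
apply/funext => i; apply/funext => j; rewrite /psswap 2!psM 2!ps_sum.
under eq_bigr => k _ do rewrite psM.
rewrite exchange_big; apply: eq_bigr => k _.
by rewrite psM.
Qed.

Lemma psswapD f g : psswap (f + g) = psswap f + psswap g.
Proof. by []. Qed.

Lemma order_ge_psswap f N : order_ge f N -> order_ge (psswap f) N.
Proof. by move=> fN i j ij; rewrite /psswap fN // addnC. Qed.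

Lemma horner_bl f d t : (bl f d).[t] = hev d f 1 t.
Proof.
rewrite (horner_coef_wide _ (size_bl f d)); apply: eq_bigr => -[j /= jd] _.
by rewrite coef_bl -ltnS jd expr1n mulr1.
Qed.

Lemma hev01 f d : hev d f 0 1 = f 0%N d.
Proof.
rewrite /hev big_ord_recr /= subnn !expr1n !mulr1 big1 ?add0r // => -[j /= jd] _.
by rewrite expr0n subn_eq0 leqNgt jd mulr0 mul0r.
Qed.

Lemma hev10 f d : hev d f 1 0 = f d 0%N.
Proof.
rewrite /hev big_ord_recl /= subn0 !expr1n !mulr1 big1 ?addr0 // => -[j /= jd] _.
by rewrite exprS mul0r mulr0.
Qed.

Lemma hev_psswap f d a b : hev d (psswap f) a b = hev d f b a.
Proof.
rewrite /hev (reindex_inj rev_ord_inj) /=; apply: eq_bigr => -[j /= jd] _.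
by rewrite !subSS subKn // /psswap mulrAC.
Qed.

Lemma contract_swap w X :
  contract (swap_pair w) (swap_pair X) = psswap (contract w X).
Proof. by rewrite /contract psswapD !psswapM addrC. Qed.

Definition blA w : pseries {poly C} := bl w.1 + psC 'X * bl w.2.

Lemma blAE w d : blA w d = bl w.1 d + 'X * bl w.2 d.
Proof. by rewrite /blA psD psCM. Qed.

Lemma bl_contract w X :
  bl (contract w X) = blA w * bl X.1 + bl w.2 * (bl X.2 - psC 'X * bl X.1).
Proof. by rewrite /contract (rmorphD bl) !(rmorphM bl) /blA; ring. Qed.

Section Saturation.
Variables (n : nat) (w : oneform R).
Hypotheses (w1o : order_ge w.1 n.+1) (w2o : order_ge w.2 n.+1).

Let w1v : psvanish n.+1 (bl w.1). Proof. exact/order_ge_bl. Qed.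
Let w2v : psvanish n.+1 (bl w.2). Proof. exact/order_ge_bl. Qed.

Lemma blA_order : psvanish n.+1 (blA w).
Proof. by move=> d dn; rewrite blAE w1v // w2v // mulr0 addr0. Qed.

(** The dt-coefficient carries an additional factor x, so after division by x^(n + 1) only dx
    remains on E: E is invariant. *)
Lemma saturated_nondicritical a0 b0 : blA w n.+1 != 0 ->
  saturated_on_E (blowup_form w) a0 b0 -> a0 = blA w n.+1 /\ b0 = 0.
Proof.
move=> An [m [mv a0E b0E ab0]].
have mn : m = n.+1.
  apply/eqP; rewrite eqn_leq; apply/andP; split; rewrite leqNgt; apply/negP => lt.
    by move/eqP: An; apply; rewrite blAE; case: (mv _ lt).
  move: ab0; rewrite a0E b0E.
  have -> : (blowup_form w).1 m = blA w m by rewrite blAE.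
  rewrite blA_order // eqxx /=; case: m lt {mv a0E b0E} => [|m] lt /=; first by rewrite eqxx.
  have -> : blowup w.2 m = 0 by apply: w2v; apply: ltnW.
  by rewrite eqxx.
subst m; rewrite a0E b0E blAE; split=> //=.
exact: w2v.
Qed.

(** Here x^(n + 2) divides the pull-back, one power more than in the non-dicritical case, and the
    restriction of the dt-coefficient to E survives. *)
Lemma saturated_dicritical a0 b0 : blA w n.+1 = 0 -> bl w.2 n.+1 != 0 ->
  saturated_on_E (blowup_form w) a0 b0 -> a0 = blA w n.+2 /\ b0 = bl w.2 n.+1.
Proof.
move=> An bn [m [mv a0E b0E ab0]].
have mn : m = n.+2.
  apply/eqP; rewrite eqn_leq; apply/andP; split; rewrite leqNgt; apply/negP => lt.
    by move/eqP: bn; apply; case: (mv _ lt).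
  move: ab0; rewrite a0E b0E.
  have -> : (blowup_form w).1 m = blA w m by rewrite blAE.
  have -> : blA w m = 0.
    by move: lt; rewrite ltnS leq_eqVlt => /orP[/eqP->|/blA_order].
  rewrite eqxx /=; case: m lt {mv a0E b0E} => [|m] lt /=; first by rewrite eqxx.
  have -> : blowup w.2 m = 0 by apply: w2v.
  by rewrite eqxx.
by subst m; rewrite a0E b0E blAE.
Qed.

End Saturation.

Lemma radial_bl X : radial X ->
  [/\ bl X.1 0%N = 0, bl X.1 1%N = 1, (bl X.2 - psC 'X * bl X.1) 0%N = 0 &
      (bl X.2 - psC 'X * bl X.1) 1%N = 0].
Proof.
move=> [_ X10 X20 X1 X2].
have lx i j : (i + j)%N = 1%N -> X.1 i j = Xs i j.
  by move=> ij; have := congr1 (fun f : series2 R => f i j) X1; rewrite /linear_part ij.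
have ly i j : (i + j)%N = 1%N -> X.2 i j = Ys i j.
  by move=> ij; have := congr1 (fun f : series2 R => f i j) X2; rewrite /linear_part ij.
have x0 : bl X.1 0%N = 0.
  by apply/polyP => -[|j]; rewrite coef_bl coef0.
have x1 : bl X.1 1%N = 1.
  by apply/polyP => -[|[|j]]; rewrite coef_bl coef1 //= lx.
split=> //; rewrite psB psCM ?x0 ?x1 ?mulr0 ?mulr1 ?subr0.
  by apply/polyP => -[|j]; rewrite coef_bl coef0.
apply/eqP; rewrite subr_eq0; apply/eqP.
by apply/polyP => -[|[|j]]; rewrite coef_bl coefX //= ly.
Qed.

(** The power divided out is x^2: one factor comes from the encoding of [blowup_field], the other
    from the vanishing on E of the lift of a radial field. *)
Lemma saturated_radial X u0 v0 : radial X ->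
  saturated_on_E (blowup_field X) u0 v0 ->
  u0 = 1 /\ v0 = (bl X.2 - psC 'X * bl X.1) 2.
Proof.
move=> /radial_bl[x0 x1 y0 y1] [m [mv u0E v0E uv0]].
have E d : (blowup_field X).2 d = (bl X.2 - psC 'X * bl X.1) d by rewrite psB psCM.
have mn : m = 2.
  case: m mv u0E v0E uv0 => [|[|[|m]]] mv u0E v0E //.
  - by rewrite u0E v0E E y0 eqxx.
  - by rewrite u0E v0E E y1 /= [blowup _ _]x0 eqxx.
  - by have [/eqP] := mv 2 isT; rewrite /= [blowup _ _]x1 oner_eq0.
by subst m; rewrite u0E v0E E; split=> //; exact: x1.
Qed.

Lemma bl_contract_low n w X : order_ge w.1 n.+1 -> order_ge w.2 n.+1 ->
    blA w n.+1 = 0 -> radial X ->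
  psvanish n.+3 (bl (contract w X)) /\
  bl (contract w X) n.+3
  = blA w n.+2 + bl w.2 n.+1 * (bl X.2 - psC 'X * bl X.1) 2.
Proof.
move=> w1o w2o An /radial_bl[x0 x1 y0 y1].
have Av : psvanish n.+2 (blA w).
  by move=> d; rewrite ltnS leq_eqVlt => /orP[/eqP->//|]; apply: blA_order.
have bv : psvanish n.+1 (bl w.2) by apply/order_ge_bl.
have xv : psvanish 1 (bl X.1) by case.
have yv : psvanish 2 (bl X.2 - psC 'X * bl X.1) by case=> [|[|d]].
rewrite bl_contract; split.
  apply: psvanishD; first by have := psvanishM Av xv; rewrite addn1.
  by have := psvanishM bv yv; rewrite addn2.
rewrite psD; congr (_ + _).
  by have := psM_lead Av xv; rewrite addn1 x1 mulr1.
by have := psM_lead bv yv; rewrite addn2.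
Qed.

(** Both polynomials dehomogenize the component of degree n + 2 of x a + y b, one in y / x and the
    other in x / y, hence the reversal. *)
Lemma coef_blA_swap n w j : (j <= n.+2)%N ->
  (blA (swap_pair w) n.+1)`_j = (blA w n.+1)`_(n.+2 - j).
Proof.
move=> jn; rewrite !blAE !coefD !coefXM !coef_bl /swap_pair /psswap /=.
case: j jn => [|j] jn; rewrite ?subn0 /=.
  by rewrite ?ltnn ?leqnn ?subnn ?addr0 ?add0r.
have [->|jn'] := eqVneq j n.+1; first by rewrite ?ltnn ?subnn /= ?leqnn ?subnn ?subn0 ?add0r ?addr0.
have lt : (j < n.+1)%N by rewrite ltn_neqAle jn'.
rewrite lt (ltnW lt) subSS (_ : (n.+1 - j == 0)%N = false); last by lia.
rewrite (_ : (n.+1 - j <= n.+1)%N) ?leq_subr //.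
rewrite (_ : ((n.+1 - j).-1 <= n.+1)%N); last by lia.
rewrite addrC; congr (w.1 _ _ + w.2 _ _); lia.
Qed.

Lemma multiplicity_swap n w : multiplicity w n -> multiplicity (swap_pair w) n.
Proof.
move=> [w1 w2 nw]; split; [exact: order_ge_psswap | exact: order_ge_psswap |].
move=> [s1 s2]; apply: nw; split; [exact: (order_ge_psswap s2)|exact: (order_ge_psswap s1)].
Qed.

(* If the blow-up were not dicritical, the singular points on E would be the
   zeros of the form x a + y b of degree n + 2, which has some. *)
Lemma regular_dicritical n w : multiplicity w n.+1 -> regular_on_E w ->
  blA w n.+1 = 0.
Proof.
move=> mw [[a0 [b0 [sat reg]]] [a0' [b0' [sat' reg']]]].
have [w1o w2o _] := mw; have [w1o' w2o' _] := multiplicity_swap mw.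
apply/eqP; apply: contraT => An.
have [a0E b0E] := saturated_nondicritical w1o w2o An sat.
have sA : (size (blA w n.+1) <= 1)%N.
  rewrite leqNgt; apply/negP => sA.
  have [t rt] : exists t, root (blA w n.+1) t.
    by apply/closed_rootP; case: (size _) sA => [|[]].
  by apply: (reg t); rewrite a0E b0E root0.
have cE j : (j <= n.+2)%N -> (blA (swap_pair w) n.+1)`_j = (blA w n.+1)`_(n.+2 - j).
  exact: coef_blA_swap.
have An' : blA (swap_pair w) n.+1 != 0.
  apply: contra An => /eqP An'; rewrite [blA w n.+1](size1_polyC sA).
  by have := cE _ (leqnn _); rewrite An' coef0 subnn => <-.
have [a0'E b0'E] := saturated_nondicritical w1o' w2o' An' sat'.
exfalso; apply: (reg' 0); rewrite a0'E b0'E root0; split=> //.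
by rewrite /root horner_coef0 cE // subn0 nth_default // (leq_trans sA).
Qed.

(** Regularity along E expressed by directions instead of charts, a form that is easily transported
    by linear changes of coordinates. *)
Definition no_common_direction n w f := forall u v : C, (u != 0) || (v != 0) ->
  hev n.+1 w.1 u v = 0 -> hev n.+1 w.2 u v = 0 -> hev n.+3 f u v = 0 -> False.

Section Tangency.
Variables (n : nat) (w : oneform R) (X : vfield R).
Hypotheses (mw : multiplicity w n.+1) (rw : regular_on_E w) (rX : radial X).

Lemma bl2_neq0 : bl w.2 n.+1 != 0.
Proof.
have [w1o w2o nw] := mw; have An := regular_dicritical mw rw.
apply/eqP => bn; apply: nw; split; apply/order_ge_bl => d;
  rewrite ltnS leq_eqVlt => /orP[/eqP->|dn].
- by move: An; rewrite blAE bn mulr0 addr0.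
- exact: (proj1 (order_ge_bl _ _) w1o d dn).
- exact: bn.
- exact: (proj1 (order_ge_bl _ _) w2o d dn).
Qed.

Lemma tang_chart_bl P : tang_chart w X P -> P = bl (contract w X) n.+3.
Proof.
have [w1o w2o nw] := mw; have An := regular_dicritical mw rw.
move=> [a0 [b0 [u0 [v0 [sw sX ->]]]]].
have [-> ->] := saturated_dicritical w1o w2o An bl2_neq0 sw.
have [-> ->] := saturated_radial rX sX.
by have [_ ->] := bl_contract_low w1o w2o An rX; rewrite mulr1.
Qed.

(** On E the tangency is a0 + b0 v0; where it vanishes together with b0, so does a0, and the point
    is singular. *)
Lemma no_common_chart v : hev n.+1 w.1 1 v = 0 -> hev n.+1 w.2 1 v = 0 ->
  hev n.+3 (contract w X) 1 v = 0 -> False.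
Proof.
have [w1o w2o nw] := mw; have An := regular_dicritical mw rw.
rewrite -!horner_bl => _ w2v fv; have [[a0 [b0 [sw reg]]] _] := rw.
have [a0E b0E] := saturated_dicritical w1o w2o An bl2_neq0 sw.
apply: (reg v); rewrite a0E b0E /root w2v; split; last by [].
have [_ fE] := bl_contract_low w1o w2o An rX.
by move: fv; rewrite fE hornerD hornerM w2v mul0r addr0 => ->.
Qed.

End Tangency.

Lemma radial_swap X : radial X -> radial (swap_pair X).
Proof.
move=> [[hX1 hX2] X10 X20 X1 X2]; split.
- by split; apply: convergent_psswap.
- exact: X20.
- exact: X10.
- apply/funext => i; apply/funext => j.
  have := congr1 (fun f : series2 R => f j i) X2.
  by rewrite /linear_part /swap_pair /psswap /= addnC => ->; rewrite /Ys /Xs andbC.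
- apply/funext => i; apply/funext => j.
  have := congr1 (fun f : series2 R => f j i) X1.
  by rewrite /linear_part /swap_pair /psswap /= addnC => ->; rewrite /Ys /Xs andbC.
Qed.

Lemma tangency_data n w X D : multiplicity w n.+1 -> regular_on_E w -> radial X ->
    tang_on_E w X D ->
  [/\ order_ge (contract w X) n.+3, bl (contract w X) n.+3 != 0,
      bl (psswap (contract w X)) n.+3 != 0,
      no_common_direction n w (contract w X) &
      forall e, D e = zero_divisor n.+3 (contract w X) e].
Proof.
move=> mw rw rX [P [P' [tP tP' P0 P'0 [DP DP']]]].
have mw' := multiplicity_swap mw; have rX' := radial_swap rX.
have swapK v : swap_pair (swap_pair v) = v :> oneform R by case: v.
have rw' : regular_on_E (swap_pair w).
  by case: rw => r1 r2; split; [exact: r2 | rewrite swapK; exact: r1].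
have PE := tang_chart_bl mw rw rX tP; have P'E := tang_chart_bl mw' rw' rX' tP'.
rewrite contract_swap in P'E.
split.
- apply/order_ge_bl; have [w1o w2o _] := mw.
  by have [] := bl_contract_low w1o w2o (regular_dicritical mw rw) rX.
- by rewrite -PE.
- by rewrite -P'E.
- move=> u v uv w1v w2v fv.
  have [u0|u0] := eqVneq u 0.
    rewrite u0 eqxx /= in uv.
    apply: (@no_common_chart n (swap_pair w) (swap_pair X) mw' rw' rX' 0);
      rewrite ?contract_swap hev_psswap.
    + by have := hevZ n.+1 w.2 0 1 v; rewrite mulr0 mulr1 -{1}u0 w2v => /esym/eqP; rewrite mulf_eq0 expf_eq0 (negbTE uv) andbF => /eqP.
    + by have := hevZ n.+1 w.1 0 1 v; rewrite mulr0 mulr1 -{1}u0 w1v => /esym/eqP; rewrite mulf_eq0 expf_eq0 (negbTE uv) andbF => /eqP.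
    + by have := hevZ n.+3 (contract w X) 0 1 v; rewrite mulr0 mulr1 -{1}u0 fv => /esym/eqP; rewrite mulf_eq0 expf_eq0 (negbTE uv) andbF => /eqP.
  have Z k g : hev k g u v = 0 -> hev k g 1 (v / u) = 0.
    have := hevZ k g 1 (v / u) u; rewrite mulr1 mulrCA divff // mulr1 => -> /eqP.
    by rewrite mulf_eq0 expf_eq0 (negbTE u0) andbF => /eqP.
  exact: (no_common_chart mw rw rX (Z _ _ w1v) (Z _ _ w2v) (Z _ _ fv)).
- by case=> [t|]; rewrite /zero_divisor; [rewrite DP PE | rewrite DP' P'E].
Qed.

End Blowup.

(** * Linearization of the radial field and its effect on the form *)

Section Straightening.
Variable R : realType.
Local Notation C := R[i].
Implicit Types (f g : series2 R) (F G : germmap R) (w : oneform R) (X : vfield R).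
Local Notation bl := (@bl R).
Local Notation cser := (@cser R).

(* Poincare's linearization: [euler (G_i) = X_i o G] reads
   [(k - 1) g_k = [Y (id + g)]_k] for [X = id + Y] and [G = id + g]. *)
Lemma radial_linearization X : radial X -> exists G,
  [/\ germ G, holomorphic G, G.1 1%N 0%N = 1 /\ G.1 0%N 1%N = 0,
      G.2 1%N 0%N = 0 /\ G.2 0%N 1%N = 1 &
      euler G.1 = pscomp X.1 G.1 G.2 /\ euler G.2 = pscomp X.2 G.1 G.2].
Proof.
move=> [[X1c X2c] X10 X20 X1 X2].
have lx i j : (i + j)%N = 1%N -> X.1 i j = Xs i j.
  by move=> ij; have := congr1 (fun f : series2 R => f i j) X1; rewrite /linear_part ij.
have ly i j : (i + j)%N = 1%N -> X.2 i j = Ys i j.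
  by move=> ij; have := congr1 (fun f : series2 R => f i j) X2; rewrite /linear_part ij.
have [Y1 Y1E] : exists Y1, X.1 = Xs + Y1 by exists (X.1 - Xs); rewrite addrC subrK.
have [Y2 Y2E] : exists Y2, X.2 = Ys + Y2 by exists (X.2 - Ys); rewrite addrC subrK.
have Y1o : order_ge Y1 2.
  have e i j : Y1 i j = X.1 i j - Xs i j by rewrite Y1E psd2 addrC addKr.
  by apply: order_ge2; rewrite e ?X10 ?subr0 // lx // subrr.
have Y2o : order_ge Y2 2.
  have e i j : Y2 i j = X.2 i j - Ys i j by rewrite Y2E psd2 addrC addKr.
  by apply: order_ge2; rewrite e ?X20 ?subr0 // ly // subrr.
have Y1c : convergent Y1.
  have -> : Y1 = X.1 - Xs by rewrite Y1E addrC addKr.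
  exact: convergentB (convergent_Xs R).
have Y2c : convergent Y2.
  have -> : Y2 = X.2 - Ys by rewrite Y2E addrC addKr.
  exact: convergentB (convergent_Ys R).
(* For k <= 1 this is 0^-1 = 0, in agreement with g of order 2. *)
pose c (k : nat) : C := (k.-1%:R)^-1.
have c1 k : cabs (c k) <= 1.
  rewrite /c cabsV; case: k => [|[|k]] /=; rewrite ?cabs0 ?invr0 ?ler01 //.
  have -> : cabs (k.+1%:R : C) = k.+1%:R by rewrite cabsMn cabs1.
  by rewrite invf_le1 // ler1n.
have [g1 [g2 [g1c g2c g1o g2o gE]]] := majorant_fixpoint c1 Y1c Y2c Y1o Y2o.
have ox := order_Xs_add g1o; have oy := order_Ys_add g2o.
have key (g Y : series2 R) (z : series2 R) : order_ge g 2 -> order_ge Y 2 ->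
    (forall i j, g i j = c (i + j)%N * pscomp Y (Xs + g1) (Ys + g2) i j) ->
    (forall i j, (i + j)%N <> 1%N -> z i j = 0) ->
    euler (z + g) = (z + g) + pscomp Y (Xs + g1) (Ys + g2).
  move=> go Yo E zE; have Po := order_ge_pscomp ox oy Yo.
  apply/funext => i; apply/funext => j; rewrite !psd2 /euler psd2.
  have [ij|ij] := ltnP (i + j) 2; last first.
    rewrite zE; last by move: ij; case: (i + j)%N => [|[|]].
    rewrite add0r E /c; case: (i + j)%N ij => [|[|k]] // _.
    have k0 : k.+1%:R != 0 :> C by rewrite pnatr_eq0.
    by rewrite -[LHS]mulr_natl /= [k.+2%:R]mulrSr; move: (k.+1%:R) k0 => m m0; field.
  rewrite go // Po // !addr0; case e : (i + j)%N ij => [|[|]] // _.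
  by rewrite zE ?e.
exists (Xs + g1, Ys + g2); split; [by split | | | |].
- by split; apply: convergentD => //; [apply: convergent_Xs | apply: convergent_Ys].
- by rewrite /= !psd2 !g1o // /Xs /= !addr0.
- by rewrite /= !psd2 !g2o // /Ys /= !addr0.
rewrite Y1E Y2E [(_, _).1]/= [(_, _).2]/= !pscompD (pscomp_Xs ox oy) (pscomp_Ys ox oy).
split; apply: key => //; first by move=> i j; case: (gE i j).
- by move=> [|[|i]] [|j].
- by move=> i j; case: (gE i j).
- by move=> [|i] [|[|j]].
Qed.

Lemma euler_lin a b : euler (cser a * Xs + cser b * Ys) = cser a * Xs + cser b * Ys.
Proof.
apply/funext => i; apply/funext => j; rewrite /euler lin_coef.
by case: i => [|[|i]]; case: j => [|[|j]]; rewrite /= ?mulr0 ?addr0 ?mul0rn ?mulr1n.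
Qed.

(** The Euler field commutes with linear maps, so the linear part of a linearization can be
    prescribed. The image (v1, v2) of (0, 1) will be a point of the divisor. *)
Lemma radial_straightening X v1 v2 u1 u2 : radial X -> exists G,
  [/\ germ G, holomorphic G,
      G.1 1%N 0%N = u1 /\ G.1 0%N 1%N = v1, G.2 1%N 0%N = u2 /\ G.2 0%N 1%N = v2 &
      euler G.1 = pscomp X.1 G.1 G.2 /\ euler G.2 = pscomp X.2 G.1 G.2].
Proof.
move=> rX; have [G [gG hG [a1 b1] [a2 b2] [e1 e2]]] := radial_linearization rX.
have [G1 G2] := gG; pose L := lin u1 v1 u2 v2.
have gL : germ L := germ_lin _ _ _ _; have [L1 L2] := gL.
have hL : holomorphic L := holomorphic_lin _ _ _ _.
exists (gcomp G L); split.
- exact: germ_gcomp.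
- exact: holomorphic_gcomp.
- rewrite /gcomp [(_, _).1]/= pscomp_x // pscomp_y // a1 b1.
  by rewrite /L /lin !lin_coef /= !mulr0 !mulr1 !mul1r !mul0r !addr0 add0r.
- rewrite /gcomp [(_, _).2]/= pscomp_x // pscomp_y // a2 b2.
  by rewrite /L /lin !lin_coef /= !mulr0 !mulr1 !mul1r !mul0r !addr0 !add0r.
have eL (f : series2 R) : euler (pscomp f L.1 L.2) = pscomp (euler f) L.1 L.2.
  rewrite (euler_pscomp f L1 L2) /L [euler (lin _ _ _ _).1]euler_lin.
  rewrite [euler (lin _ _ _ _).2]euler_lin -/L.
  rewrite [in RHS]eulerE (pscomp_lin2 _ _ _ _ L1 L2) (pscomp_Xs L1 L2) (pscomp_Ys L1 L2).
  by rewrite mulrC [X in _ + X]mulrC.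
clearbody L; rewrite /gcomp [(_, _).1]/= [(_, _).2]/=; split.
  by rewrite eL e1; exact: (pscompA X.1 G1 G2 L1 L2).
by rewrite eL e2; exact: (pscompA X.2 G1 G2 L1 L2).
Qed.

(** G sends the Euler field to X, so contracting the pull-back with the former is pulling back the
    contraction with the latter. *)
Lemma contract_pullback w X G : germ G ->
    euler G.1 = pscomp X.1 G.1 G.2 /\ euler G.2 = pscomp X.2 G.1 G.2 ->
  Xs * (pullback G w).1 + Ys * (pullback G w).2 = pscomp (contract w X) G.1 G.2.
Proof.
move=> [G1 G2] [e1 e2]; rewrite /contract (pscomp_lin2 _ _ _ _ G1 G2) -e1 -e2.
by rewrite !eulerE /pullback [(_, _).1]/= [(_, _).2]/=; ring.
Qed.

(** Pull-back of the 2-form w /\ df, whence the Jacobian determinant; invariance of the divisor is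
    thus preserved. *)
Lemma wedge_pullback w f G : germ G ->
  (pullback G w).1 * psdy (pscomp f G.1 G.2) - (pullback G w).2 * psdx (pscomp f G.1 G.2)
  = pscomp (w.1 * psdy f - w.2 * psdx f) G.1 G.2
    * (psdx G.1 * psdy G.2 - psdy G.1 * psdx G.2).
Proof.
move=> [G1 G2]; rewrite (psdx_pscomp f G1 G2) (psdy_pscomp f G1 G2).
rewrite pscompB !(pscompM _ _ G1 G2) /pullback [(_, _).1]/= [(_, _).2]/=; ring.
Qed.

(** Contract w /\ df = f h dx /\ dy with the Euler field E, using w(E) = f: this gives f df - E(f) w
    = f h (x dy - y dx). *)
Lemma euler_divisible (a b f h : series2 R) : Xs * a + Ys * b = f ->
  a * psdy f - b * psdx f = f * h ->
  b * euler f = f * (psdy f - Xs * h) /\ a * euler f = f * (psdx f + Ys * h).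
Proof.
move=> fE eh; rewrite eulerE; split.
  rewrite (_ : b * _ = (Xs * a + Ys * b) * psdy f - Xs * (a * psdy f - b * psdx f)); last by ring.
  by rewrite eh fE; ring.
rewrite (_ : a * _ = (Xs * a + Ys * b) * psdx f + Ys * (a * psdy f - b * psdx f)); last by ring.
by rewrite eh fE; ring.
Qed.

Lemma hev_pullback n w G u v : germ G -> order_ge w.1 n -> order_ge w.2 n ->
  let u' := hev 1 G.1 u v in let v' := hev 1 G.2 u v in
  hev n (pullback G w).1 u v
    = hev n w.1 u' v' * G.1 1%N 0%N + hev n w.2 u' v' * G.2 1%N 0%N /\
  hev n (pullback G w).2 u v
    = hev n w.1 u' v' * G.1 0%N 1%N + hev n w.2 u' v' * G.2 0%N 1%N.
Proof.
move=> [G1 G2] w1 w2 u' v'.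
have w1o := order_ge_pscomp G1 G2 w1; have w2o := order_ge_pscomp G1 G2 w2.
have H f g : order_ge f n -> hev n (f * g) u v = hev n f u v * g 0%N 0%N.
  by move=> fn; rewrite -[n in LHS]addn0 hevM // hev0.
rewrite /pullback [(_, _).1]/= [(_, _).2]/= !hevD !(H _ _ w1o) !(H _ _ w2o).
by rewrite !(hev_pscomp _ _ G1 G2) // /psdx /psdy !mulr1n.
Qed.

Lemma order_ge_pullback n w G : germ G -> order_ge w.1 n -> order_ge w.2 n ->
  order_ge (pullback G w).1 n /\ order_ge (pullback G w).2 n.
Proof.
move=> [G1 G2] w1 w2.
have w1o := order_ge_pscomp G1 G2 w1; have w2o := order_ge_pscomp G1 G2 w2.
have H f g : order_ge f n -> order_ge (f * g) n.
  by move=> fn; rewrite -[n]addn0; apply: order_geM.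
by split; apply: order_geD; apply: H.
Qed.

Lemma holomorphic_pullback w G : germ G -> holomorphic G -> holomorphic w ->
  holomorphic (pullback G w).
Proof.
move=> [G1 G2] [c1 c2] [w1 w2].
have C1 := convergent_pscomp w1 c1 c2 G1 G2.
have C2 := convergent_pscomp w2 c1 c2 G1 G2.
by split; apply: convergentD; apply: convergentM => //;
  (apply: convergent_psdx || apply: convergent_psdy).
Qed.

Lemma no_common_pullback n w f G : germ G -> jac G != 0 ->
    order_ge w.1 n.+1 -> order_ge w.2 n.+1 -> order_ge f n.+3 ->
    no_common_direction n w f ->
  no_common_direction n (pullback G w) (pscomp f G.1 G.2).
Proof.
move=> gG jG w1 w2 fo nc u v uv; have [G1 G2] := gG.
have [-> ->] := hev_pullback u v gG w1 w2.
rewrite (hev_pscomp _ _ G1 G2 fo).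
set u' := hev 1 G.1 u v; set v' := hev 1 G.2 u v => e1 e2.
have uv' : (u' != 0) || (v' != 0).
  apply: contraT; rewrite negb_or !negbK => /andP[/eqP u0 /eqP v0].
  move: u0 v0; rewrite /u' /v' !hev1 => u0 v0.
  have eu : jac G * u = 0.
    by rewrite /jac; transitivity (G.2 0%N 1%N * (G.1 1%N 0%N * u + G.1 0%N 1%N * v)
      - G.1 0%N 1%N * (G.2 1%N 0%N * u + G.2 0%N 1%N * v)); [ring | rewrite u0 v0; ring].
  have ev : jac G * v = 0.
    by rewrite /jac; transitivity (G.1 1%N 0%N * (G.2 1%N 0%N * u + G.2 0%N 1%N * v)
      - G.2 1%N 0%N * (G.1 1%N 0%N * u + G.1 0%N 1%N * v)); [ring | rewrite u0 v0; ring].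
  move/eqP: eu; move/eqP: ev; rewrite !mulf_eq0 (negbTE jG) /= => /eqP v00 /eqP u00.
  by move: uv; rewrite u00 v00 eqxx.
move=> fz; apply: (nc u' v' uv' _ _ fz); apply: (mulfI jG); rewrite mulr0 /jac;
  move: (hev n.+1 w.1 u' v') (hev n.+1 w.2 u' v') e1 e2 => a b e1 e2.
  by transitivity (G.2 0%N 1%N * (a * G.1 1%N 0%N + b * G.2 1%N 0%N)
      - G.2 1%N 0%N * (a * G.1 0%N 1%N + b * G.2 0%N 1%N)); [ring | rewrite e1 e2; ring].
by transitivity (G.1 1%N 0%N * (a * G.1 0%N 1%N + b * G.2 0%N 1%N)
      - G.1 0%N 1%N * (a * G.1 1%N 0%N + b * G.2 1%N 0%N)); [ring | rewrite e1 e2; ring].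
Qed.

End Straightening.

Section BlowupMorphism.
Variable R : realType.
Implicit Types f g : series2 R.

Lemma blD f g : bl (f + g) = bl f + bl g.
Proof. exact: (rmorphD (@bl R)). Qed.

Lemma blB f g : bl (f - g) = bl f - bl g.
Proof. exact: (rmorphB (@bl R)). Qed.

Lemma blM f g : bl (f * g) = bl f * bl g.
Proof. exact: (rmorphM (@bl R)). Qed.

Lemma blXn f k : bl (f ^+ k) = bl f ^+ k.
Proof. exact: (rmorphXn (@bl R)). Qed.

End BlowupMorphism.

(** * Norm bounds for Euclidean division *)

Section MonicDivision.
Variable R : realType.
Local Notation C := R[i].
Implicit Types P Q S : {poly C}.

Lemma pnorm_split (rho : R) s Q S : 0 < rho -> (size S <= s)%N ->
  pnorm rho ('X^s * Q + S) = rho ^+ s * pnorm rho Q + pnorm rho S.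
Proof.
move=> rho0 sS; have sz : (size ('X^s * Q + S)%R <= s + size Q)%N.
  apply: leq_trans (size_polyD _ _) _; rewrite geq_max (leq_trans sS) ?leq_addr // andbT.
  by apply: leq_trans (size_polyMleq _ _) _; rewrite size_polyXn.
rewrite (pnormE _ sz) big_split_ord [RHS]addrC; congr (_ + _).
  rewrite (pnormE _ sS); apply: eq_bigr => j _.
  by rewrite /= coefD coefXnM ltn_ord add0r.
rewrite /pnorm mulr_sumr; apply: eq_bigr => j _.
rewrite /= coefD coefXnM ltnNge leq_addr addKn exprD mulrCA.
by rewrite [S`_ _]nth_default ?addr0 // (leq_trans sS) ?leq_addr.
Qed.

(* For large rho the leading term of P dominates, which makes Euclidean division
   by P bounded uniformly in the degree. *)
Lemma monic_division_bound P : P \is monic -> exists2 rho : R, 0 < rho &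
  forall Q S, (size S < size P)%N ->
    rho ^+ (size P).-1 * pnorm rho Q <= 2 * pnorm rho (P * Q + S) /\
    pnorm rho S <= pnorm rho (P * Q + S).
Proof.
move=> mP; set s := (size P).-1; have sP : size P = s.+1.
  by rewrite /s prednK // size_poly_gt0 monic_neq0.
pose P' := P - 'X^s.
have sP' : (size P' <= s)%N.
  apply/leq_sizeP => j; rewrite leq_eqVlt coefB coefXn => /orP[/eqP<-|sj].
    by rewrite eqxx; move/monicP: mP; rewrite /lead_coef -/s => ->; rewrite subrr.
  by rewrite gtn_eqF // subr0 nth_default // sP.
pose N0 := \sum_(j < s) cabs P'`_j.
have N00 : 0 <= N0 by apply: sumr_ge0.
(* For rho >= 1 the lower terms P' have norm at most N0 rho^(s - 1), hence at most half of rho^s. *)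
pose rho := 1 + 2 * N0; have rhoE : 1 + 2 * N0 = rho by [].
have rho1 : 1 <= rho by rewrite lerDl mulr_ge0.
have rho0 : 0 < rho by apply: lt_le_trans rho1.
clearbody rho; exists rho => //.
have nP' : 2 * pnorm rho P' <= rho ^+ s.
  rewrite (pnormE _ sP').
  apply: (@le_trans _ _ (2 * (N0 * rho ^+ s.-1))).
    rewrite ler_wpM2l // mulr_suml; apply: ler_sum => j _.
    by rewrite ler_wpM2l // ler_weXn2l //; case: j => j /= js; lia.
  have [s0|s0] := posnP s.
    have -> : N0 = 0 by rewrite /N0 big1 // => -[j /= js]; lia.
    by rewrite mul0r mulr0 exprn_ge0 // ltW.
  rewrite mulrA -[in leRHS](prednK s0) exprS ler_wpM2r ?exprn_ge0 ?(ltW rho0) //.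
  by rewrite -rhoE lerDr ler01.
move=> Q S sS.
have sS' : (size S <= s)%N by rewrite -ltnS -sP.
(* The supports of X^s Q and S are disjoint, so the norm of the left-hand side is a sum, while P' Q
   costs at most half of rho^s |Q|, which is moved to the other side. *)
have E : 'X^s * Q + S = (P * Q + S) - P' * Q by rewrite /P'; ring.
have := pnormD rho0 (P * Q + S) (- (P' * Q)); rewrite -E pnormN //.
rewrite pnorm_split //.
have := pnormM rho0 P' Q; have := pnorm_ge0 rho0 Q; have := pnorm_ge0 rho0 S.
have := pnorm_ge0 rho0 (P' * Q).
have := ler_wpM2r (pnorm_ge0 rho0 Q) nP'.
move: (pnorm rho (P' * Q)) (pnorm rho P') (pnorm rho Q) (pnorm rho S)
  (pnorm rho (P * Q + S)) (rho ^+ s) => A B q r t x h1 h2 h3 h4 h5 h6.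
rewrite -mulrA in h1.
by split; lra.
Qed.

End MonicDivision.

(** * Factorization of an invariant tangency divisor *)

Section InvariantTangency.
Variable R : realType.
Local Notation C := R[i].
Implicit Types (f g a b : series2 R).
Local Notation bl := (@bl R).
Local Notation cser := (@cser R).

Lemma ler_rearrange (t u z x y : R) :
  t * u <= 2 * z -> 0 <= x -> 0 <= y -> t * x * (u * y) <= 2 * (z * (x * y)).
Proof.
move=> h x0 y0; rewrite (_ : t * x * (u * y) = t * u * (x * y)); last by ring.
by rewrite [leRHS]mulrA ler_wpM2r // mulr_ge0.
Qed.

Lemma psvanish_cancel (K : idomainType) (F H : pseries K) N : F 0%N != 0 ->
  psvanish N (F * H) -> psvanish N H.
Proof.
move=> F0 FH d; elim/ltn_ind: d => d IH dN.
have := FH d dN; rewrite psM big_ord_recl subn0 /= big1 ?addr0; last first.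
  move=> [j /= jd] _; rewrite /bump /= add1n IH ?mulr0 //; lia.
by move/eqP; rewrite mulf_eq0 (negbTE F0) => /eqP.
Qed.

(* By induction on k, the coefficient of degree k of G * D = F * h, where
   D_k = k F_k, shows that F_0 divides k G_0 F_k. *)
Lemma divisible_propagation (F G D h : pseries {poly C}) n :
    F 0%N != 0 -> (size (G 0%N) = n.+2)%N -> coprimep (F 0%N) (G 0%N) ->
    (forall k, size (G k) <= n.+2 + k)%N -> (forall k, size (h k) <= n.+2 + k)%N ->
    h 0%N = 0 -> (forall k, D k = F k *+ k) -> G * D = F * h ->
  forall k, F 0%N %| F k /\ (size (F k) <= size (F 0%N) + k)%N.
Proof.
move=> F0 sG cop sGk shk h0 DE E; elim/ltn_ind => -[_|k IH].
  by rewrite dvdpp addn0.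
have Ek : (D * G) k.+1 = (F * h) k.+1 by rewrite mulrC E.
(* Since h_0 = 0, the unknown F_(k+1) occurs only in the term D_(k+1) G_0. *)
rewrite 2!psM big_ord_recr [RHS]big_ord_recr /= subnn h0 mulr0 addr0 in Ek.
set A := \sum_(i < k.+1) _ in Ek; set B := \sum_(i < k.+1) _ in Ek.
have EBA : F k.+1 * G 0%N *+ k.+1 = B - A by rewrite -Ek DE [X in X - A]addrC addrK mulrnAl.
have dA : F 0%N %| A.
  apply: (big_ind (fun p => F 0%N %| p) (dvdp0 _) (@dvdp_add _ (F 0%N))) => -[i /= ik] _.
  apply: dvdp_mulr.
  by rewrite DE -mulr_natl; apply: dvdp_mull; case: (IH i ik).
have dB : F 0%N %| B.
  apply: (big_ind (fun p => F 0%N %| p) (dvdp0 _) (@dvdp_add _ (F 0%N))) => -[i /= ik] _.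
  by apply: dvdp_mulr; case: (IH i ik).
have szM (p q : {poly C}) i : (i < k.+1)%N -> (size p <= size (F 0%N) + i)%N ->
    (size q <= n.+2 + (k.+1 - i))%N -> (size (p * q)%R <= size (F 0%N) + n.+1 + k.+1)%N.
  move=> ik sp sq; apply: leq_trans (size_polyMleq _ _) _; lia.
have sA : (size A <= size (F 0%N) + n.+1 + k.+1)%N.
  apply: leq_trans (size_sum _ _ _) _; apply/bigmax_leqP => -[i /= ik] _.
  apply: (szM _ _ i) => //; rewrite DE -scaler_nat.
  by apply: leq_trans (size_scale_leq _ _) _; case: (IH i ik).
have sB : (size B <= size (F 0%N) + n.+1 + k.+1)%N.
  apply: leq_trans (size_sum _ _ _) _; apply/bigmax_leqP => -[i /= ik] _.
  by apply: (szM _ _ i) => //; case: (IH i ik).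
have k0 : (k.+1%:R : C) != 0 by rewrite pnatr_eq0.
have EFG : F k.+1 * G 0%N = (k.+1%:R)^-1 *: (B - A).
  by rewrite -EBA -[F _ * _ *+ _]scaler_nat scalerA mulVf // scale1r.
split.
  rewrite -(Gauss_dvdpl _ cop) EFG dvdpZr ?invr_eq0 //.
  exact: dvdp_sub.
(* The exact degree n + 1 of G_0 is subtracted from the bound on the right-hand side. The resulting
   bound on F_k will allow the quotient by F_0 to be blown down. *)
have [->|Fk] := eqVneq (F k.+1) 0; first by rewrite size_poly0.
have : (size (F k.+1 * G 0%N)%R <= size (F 0%N) + n.+1 + k.+1)%N.
  rewrite EFG; apply: leq_trans (size_scale_leq _ _) _.
  apply: leq_trans (size_polyD _ _) _.
  by rewrite geq_max sB size_polyN sA.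
have G0 : G 0%N != 0 by rewrite -size_poly_gt0 sG.
rewrite size_mul // sG; move: (size (F k.+1)) (size (F 0%N)) => x y; lia.
Qed.

Lemma bl_euler f d : bl (euler f) d = bl f d *+ d.
Proof.
apply/polyP => j; rewrite coefMn !coef_bl; case: ifP => jd; last by rewrite mul0rn.
by rewrite /euler subnK.
Qed.

Lemma bl_XY a b d : bl (Xs * a + Ys * b) d.+1 = bl a d + 'X * bl b d.
Proof.
rewrite blD !blM bl_Xs bl_Ys psD psXM -mulrA psCM psXM //.
Qed.

(** The coefficient of y^(n + 2) in f is that of y^(n + 1) in b, and f has order n + 3. As f also
    vanishes in the direction (0 : 1), regularity there leaves only a. *)
Lemma transverse_at_infinity n a b f :
    Xs * a + Ys * b = f -> order_ge f n.+3 -> f 0%N n.+3 = 0 ->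
    no_common_direction n (a, b) f ->
  b 0%N n.+1 = 0 /\ a 0%N n.+1 != 0.
Proof.
move=> fE fo finf nc.
have b0 : b 0%N n.+1 = 0.
  have := congr1 (fun g : series2 R => g 0%N n.+2) fE; rewrite /= psd2 XsM YsM add0r => ->.
  by apply: fo.
split=> //; apply/eqP => a0; apply: (nc 0 1); first by rewrite oner_eq0 orbT.
- by rewrite hev01.
- by rewrite hev01.
- by rewrite hev01.
Qed.

(** Write f = x^(n + 3) (tau + ...) in the chart. Once tau divides every coefficient, with control
    of the degrees, the quotient is the blow-up of a unit of the plane, and tau accounts for x Q. *)
Lemma invariant_tangency_factor n a b f s1 s2 :
    Xs * a + Ys * b = f -> order_ge a n.+1 -> order_ge b n.+1 ->
    order_ge f n.+3 -> bl f n.+3 != 0 -> f 0%N n.+3 = 0 ->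
    no_common_direction n (a, b) f ->
    b * euler f = f * s1 -> a * euler f = f * s2 -> convergent f ->
  exists U Q : series2 R, [/\ convergent U, U 0%N 0%N != 0, homogeneous n.+2 Q,
    dehom n.+2 Q \is monic & f = U * (Xs * Q)].
Proof.
move=> fE a1 b1 fo f0 finf nc bs as2 fc.
set tau := bl f n.+3 in f0.
have av : psvanish n.+1 (bl a) by apply/order_ge_bl.
have bv : psvanish n.+1 (bl b) by apply/order_ge_bl.
have fv : psvanish n.+3 (bl f) by apply/order_ge_bl.
have ab : bl a n.+1 = - ('X * bl b n.+1).
  by apply/eqP; rewrite -addr_eq0 -bl_XY fE fv.
have [b0 a0] := transverse_at_infinity fE fo finf nc.
(* The combination beta b - a has leading term (beta + t) b_(n+1). This choice keeps beta + t prime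
   to tau, and the roots of b_(n+1) avoid those of tau by regularity. *)
have [beta tb] : exists beta, tau.[- beta] != 0.
  have /closed_nonrootP[x nx] := f0; exists (- x).
  by rewrite opprK.
pose g := cser beta * b - a; pose gam := bl g n.+1.
have gamE : gam = (beta%:P + 'X) * bl b n.+1.
  rewrite /gam /g blB blM bl_cser psB psCM ab opprK; ring.
have gv : psvanish n.+1 (bl g).
  by move=> d dn; rewrite /g blB blM bl_cser psB psCM av // bv // mulr0 subr0.
have sgam : size gam = n.+2.
  apply/eqP; rewrite eqn_leq size_bl ltnNge; apply/negP => /leq_sizeP/(_ n.+1 (leqnn _)).
  rewrite coef_bl leqnn subnn /g psb2 cserM b0 mulr0 sub0r => /eqP.
  by rewrite oppr_eq0 (negbTE a0).
have cop : coprimep tau gam.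
  apply: Pdiv.ClosedField.root_coprimep => x /eqP tx; rewrite gamE hornerM hornerD hornerC hornerX.
  rewrite mulf_neq0 //; last first.
    apply/eqP => bx; apply: (nc 1 x); first by rewrite oner_eq0.
    - by rewrite -horner_bl ab hornerN hornerM bx mulr0 oppr0.
    - by rewrite -horner_bl.
    - by rewrite -horner_bl.
  by apply: contraNneq tb => bx; rewrite (_ : - beta = x) ?tx //; apply/eqP; rewrite eq_sym -addr_eq0 addrC bx.
pose q := cser beta * s1 - s2.
have gq : g * euler f = f * q.
  rewrite /g /q mulrBl -mulrA bs as2; ring.
(* Replacing E(f) by E(f) - (n + 3) f turns the weight n + 3 + k of the coefficients into k, the
   form required by the propagation of divisibility. *)
pose m := cser n.+3%:R; pose q' := q - m * g.
have [F' F'E] := psvanishXn fv; have [G' G'E] := psvanishXn gv.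
have F'n k : F' k = bl f (n.+3 + k)%N by rewrite F'E psXnM leq_addr addKn.
have G'n k : G' k = bl g (n.+1 + k)%N by rewrite G'E psXnM leq_addr addKn.
have F'0 : F' 0%N = tau by rewrite F'n addn0.
have G'0 : G' 0%N = gam by rewrite G'n addn0.
pose D : pseries {poly C} := fun k => F' k *+ k.
have DE : bl (euler f - m * f) = psX _ ^+ n.+3 * D.
  apply/funext => d; rewrite blB blM bl_cser psB psCM bl_euler psXnM mul_polyC scaler_nat.
  case: (leqP n.+3 d) => dn; first by rewrite /D F'n subnKC // mulrnBr.
  by rewrite fv // !mul0rn subrr.
have E1 : bl g * bl (euler f - m * f) = bl f * bl q'.
  rewrite -!blM; congr bl; rewrite /q' mulrBr gq; ring.
have E2 : psX _ ^+ n.+1 * (G' * D) = F' * bl q'.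
  apply: (@psXn_inj _ n.+3).
  transitivity (bl g * bl (euler f - m * f)); first by rewrite DE {1}G'E; ring.
  by rewrite E1 {1}F'E; ring.
have qv : psvanish n.+1 (bl q').
  apply: (@psvanish_cancel _ F'); first by rewrite F'0.
  by rewrite -E2 => d dn; rewrite psXnM leqNgt dn.
have [H HE] := psvanishXn qv.
have Hn k : H k = bl q' (n.+1 + k)%N by rewrite HE psXnM leq_addr addKn.
have E3 : G' * D = F' * H.
  by apply: (@psXn_inj _ n.+1); rewrite E2 HE; ring.
have H0 : H 0%N = 0.
  have := congr1 (fun S : pseries {poly C} => S 0%N) E3; rewrite !psM0 /D mulr0n mulr0 F'0.
  by move/esym/eqP; rewrite mulf_eq0 (negbTE f0) => /eqP.
have prop := @divisible_propagation F' G' D H n.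
rewrite F'0 G'0 in prop.
have {}prop k : tau %| F' k /\ (size (F' k) <= size tau + k)%N.
  apply: prop => //.
  - by move=> i; rewrite G'n addSn; apply: size_bl.
  - by move=> i; rewrite Hn addSn; apply: size_bl.
pose lc := lead_coef tau; have lc0 : lc != 0 by rewrite lead_coef_eq0.
pose tau' := lc^-1 *: tau.
have mtau' : tau' \is monic by rewrite monicE lead_coefZ mulVf.
have stau' : size tau' = size tau by rewrite size_scale // invr_eq0.
(* The vanishing of f at (0 : 1) lowers the degree of tau to n + 2, leaving room for the factor x in
   x Q. *)
have stau : (size tau <= n.+3)%N.
  apply/leq_sizeP => j; rewrite leq_eqVlt => /orP[/eqP<-|nj].
    by rewrite coef_bl leqnn subnn finf.
  by rewrite nth_default // (leq_trans (size_bl _ _)).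
pose p k := F' k %/ tau'.
have pE k : F' k = tau' * p k.
  by rewrite mulrC divpK // dvdpZl ?invr_eq0 //; case: (prop k).
have sp k : (size (p k) <= k.+1)%N.
  rewrite size_divp ?monic_neq0 // stau'.
  case: (prop k) => _; have := f0; rewrite -size_poly_gt0.
  move: (size (F' k)) (size tau) => x y; lia.
pose U := unbl (p : pseries {poly C}); have UE : bl U = p := unblK sp.
pose Q : series2 R := fun i j => if (i + j == n.+2)%N then tau'`_j else 0.
have QE : dehom n.+2 Q = tau'.
  apply/polyP => j; rewrite coef_poly; case: ltnP => jn.
    by rewrite /Q subnK ?eqxx.
  by rewrite nth_default // stau' (leq_trans stau).
have blQ : bl Q = psX _ ^+ n.+2 * psC tau'.
  apply/funext => d; rewrite psXnM; case: (leqP n.+2 d) => dn; last first.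
    apply/polyP => j; rewrite coef_bl coef0; case: ifP => // jd.
    by rewrite /Q subnK // ltn_eqF.
  have [->|dn'] := eqVneq d n.+2; first by rewrite subnn /= -QE.
  rewrite (_ : (d - n.+2)%N = (d - n.+2).-1.+1); last by lia.
  apply/polyP => j; rewrite coef_bl coef0; case: ifP => // jd.
  by rewrite /Q subnK // (negbTE dn').
exists U, Q; split.
(* Each coefficient of U is an exact quotient by the monic multiple of tau; with S = 0 the bound is
   uniform in k, so U converges where f does. *)
- have [rho rho0 db] := monic_division_bound mtau'.
  apply/(convergentP _ rho0).
  have /(convergentP _ rho0)[r [M [r0 fM]]] := fc.
  apply: (@cvB_le _ _ _ (rho ^+ (size tau').-1 * r ^+ n.+3)).
    by rewrite mulr_gt0 // exprn_gt0.
  exists r, (2 * M); split=> // K.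
  have rn k : 0 <= r ^+ k by rewrite exprn_ge0 // ltW.
  apply: (@le_trans _ _ (2 * Bnorm rho r (n.+3 + K) (bl f))); last first.
    by rewrite ler_wpM2l.
  rewrite /Bnorm big_split_ord /=; apply: (@le_trans _ _ (2 * \sum_(i < K) pnorm rho (bl f (n.+3 + i)%N) * r ^+ (n.+3 + i))).
    rewrite !mulr_sumr; apply: ler_sum => k _.
    have sz : (size (0 : {poly C})%R < size tau')%N by rewrite size_poly0 stau' size_poly_gt0.
    have [] := db (p k) 0%R sz; rewrite addr0 -pE F'n => h _.
    have Er : r ^+ (n.+3 + k) = r ^+ n.+3 * r ^+ k by exact: exprD.
    rewrite Er UE; exact: ler_rearrange h (rn n.+3) (rn k).
  rewrite ler_wpM2l // lerDr; apply: sumr_ge0 => k _.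
  by rewrite mulr_ge0 // pnorm_ge0.
- have -> : U 0%N 0%N = (p 0%N)`_0 by [].
  have := pE 0%N; rewrite F'0 -[tau](scale1r) -(mulfV lc0) -scalerA -/tau' => e.
  have -> : p 0%N = lc%:P.
    apply: (mulfI (monic_neq0 mtau')); rewrite -e -mul_polyC mulrC //.
  by rewrite coefC.
- by move=> i j ij; rewrite /Q (negbTE ij).
- by rewrite QE.
apply: bl_inj; rewrite !blM UE blQ bl_Xs F'E.
have -> : F' = psC tau' * p by apply/funext => k; rewrite psCM pE.
by rewrite [psX _ ^+ n.+3]exprS; ring.
Qed.

(** After division by U the relation x a + y b = x Q shows that x divides b, and W = b / x gives a =
    Q - y W. The order n of W(0, y) comes from the y^(n + 1) term of a. *)
Lemma nform_representation n a b U Q :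
    Xs * a + Ys * b = U * (Xs * Q) -> convergent U -> U 0%N 0%N != 0 ->
    convergent a -> convergent b -> order_ge b n.+1 -> a 0%N n.+1 != 0 ->
    homogeneous n.+2 Q ->
  exists W : series2 R, [/\ convergent W, order_ge W n, W 0%N n != 0,
    a = U * (nform W Q).1 & b = U * (nform W Q).2].
Proof.
move=> E Uc U0 ac bc bo a0 hQ; have [V UV] := series2_inv U0.
have Vc := convergent_inv Uc UV.
have VK g : U * (V * g) = g by rewrite mulrA UV mul1r.
have E' : Xs * (V * a) + Ys * (V * b) = Xs * Q.
  transitivity (V * (Xs * a + Ys * b)); first by ring.
  by rewrite E mulrA [V * U]mulrC UV mul1r.
move aE : (V * a) E' => a2; move bE : (V * b) => b2 E'.
have b2o : order_ge b2 n.+1 by rewrite -bE -[n.+1]add0n; apply: order_geM.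
have b20 j : b2 0%N j = 0.
  by have := congr1 (fun g : series2 R => g 0%N j.+1) E'; rewrite /= psd2 !XsM YsM add0r.
pose W : series2 R := fun i j => b2 i.+1 j.
have b2E : b2 = Xs * W.
  by apply/funext => -[|i]; apply/funext => j; rewrite XsM // b20.
have Wo : order_ge W n by move=> i j ij; rewrite /W b2o // addSn ltnS.
have a2E : a2 = Q - W * Ys.
  have := E'; rewrite b2E => E2.
  apply/eqP; rewrite eq_sym subr_eq; apply/eqP; rewrite Xs_psX in E2.
  apply: (@psXn_inj _ 1); rewrite expr1 -E2; ring.
have Wc : convergent W by apply: convergent_shiftx; rewrite -bE; apply: convergentM.
exists W; split=> //.
- apply: contraNneq a0 => W0; rewrite -(VK a) aE.
  have a2o : order_ge a2 n.+1.
    rewrite a2E => i j ij; rewrite psb2 hQ; last by rewrite ltn_eqF // ltnW.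
    by rewrite (mulrC W) YsM; case: j ij => [|j] ij; rewrite ?subr0 // Wo ?subr0 //; lia.
  rewrite -hev01 -[n.+1]add0n hevM // [hev _ a2 _ _]hev01 a2E psb2.
  by rewrite (mulrC W) YsM W0 subr0 hQ ?mulr0 // add0n ltn_eqF.
- by rewrite /nform -[a](VK a) aE a2E.
- by rewrite /nform -[b](VK b) bE b2E [W * Xs]mulrC.
Qed.

End InvariantTangency.

(** * Weierstrass normalization *)

Lemma rhs_diff_identity (A : comNzRingType) (q x x' y y' z b b' v v' : A) :
  q * x + y - z * (b * v) - (q * x' + y' - z * (b' * v'))
  = q * (x - x') + (y - y') - z * ((b - b') * v + b' * (v - v')).
Proof. by ring. Qed.

(** * The recursion for u, its degrees and its bounds *)

Section RadialRecursion.
Variable R : realType.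
Local Notation C := R[i].
Local Notation B := (pseries {poly C}).
Implicit Types (F G u beta v : B).

(** For c >= 1, the condition for x^(c - 1) F to be the blow-up of a series of the plane. *)
Definition gsize c F := forall k, (size (F k) <= c + k)%N.

Lemma gsizeM a b F G : gsize a.+1 F -> gsize b.+1 G -> gsize (a + b).+1 (F * G).
Proof.
move=> sF sG k; rewrite psM; apply: leq_trans (size_sum _ _ _) _.
apply/bigmax_leqP => -[i /= ik] _; apply: leq_trans (size_polyMleq _ _) _.
have := sF i; have := sG (k - i)%N.
move: (size (F i)) (size (G (k - i)%N)) => x y; lia.
Qed.

Lemma gsize1 : gsize 1 (1 : B).
Proof. by case=> [|k]; rewrite ps1 /= ?size_poly1 ?size_poly0. Qed.

Lemma gsizeX F e : gsize 1 F -> gsize 1 (F ^+ e).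
Proof.
move=> sF; elim: e => [|e IH]; first by rewrite expr0; apply: gsize1.
by rewrite exprS; apply: (@gsizeM 0 0).
Qed.

Lemma psvanish_diffX N F G e : psvanish N (F - G) -> psvanish N (F ^+ e - G ^+ e).
Proof.
move=> FG; elim: e => [|e IH]; first by rewrite !expr0 subrr.
rewrite (_ : _ - _ = (F - G) * F ^+ e + G * (F ^+ e - G ^+ e)); last by rewrite !exprS; ring.
by apply: psvanishD; [apply: psvanishMr | apply: psvanishMl].
Qed.

(* [u] with [u + x u_x = 1 + x beta]. *)
Definition ushift beta : B := fun k =>
  if k is k'.+1 then (k'.+2%:R)^-1 *: beta k' else 1.

Definition dt F : B := fun k => (F k)^`().

Variables (n : nat) (w0 q : {poly C}) (w : nat -> {poly C}).
Hypotheses (w0_monic : w0 \is monic) (sw0 : size w0 = n.+1).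
Hypotheses (sq : (size q <= n.+3)%N) (sw : forall d, (size (w d) <= n.+2 + d)%N).

(* [w d] is the coefficient of x^(d + 1). *)
Definition wsum u : B := fun k => \sum_(d < k.+1) w d * (u ^+ d.+1) (k - d)%N.

(** The new W will be x^n (w0 + x v), subject to (1 + x beta) (w0 + x v) = w0 + x (q u_t + [wsum]
    u). Subtracting w0 and dividing by x gives w0 beta + v = [rhs], solved with v of degree less
    than n by Euclidean division. *)
Definition rhs beta v : B :=
  psC q * dt (ushift beta) + wsum (ushift beta) - psX _ * (beta * v).

Definition rstep (bv : B * B) : B * B :=
  (fun k => rhs bv.1 bv.2 k %/ w0, fun k => rhs bv.1 bv.2 k %% w0).

Definition riter m := iter m rstep (0, 0).

Lemma ushift_diff N beta beta' : psvanish N (beta - beta') ->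
  psvanish N.+1 (ushift beta - ushift beta').
Proof.
move=> e [|k] kN; rewrite psB /=; first by rewrite subrr.
by rewrite -scalerBr -psB e ?scaler0.
Qed.

Lemma wsum_diff N u u' : psvanish N (u - u') -> psvanish N (wsum u - wsum u').
Proof.
move=> e k kN; rewrite psB /wsum -sumrB big1 // => -[d /= dk] _.
by rewrite -mulrBr -psB (psvanish_diffX d.+1 e) ?mulr0 //; lia.
Qed.

(** The recursion is causal: beta enters u with a shift of one index, and the quadratic term carries
    a factor x. *)
Lemma rhs_diff N beta beta' v v' : psvanish N (beta - beta') -> psvanish N (v - v') ->
  psvanish N.+1 (rhs beta v - rhs beta' v').
Proof.
move=> e e'; have ue := ushift_diff e.
rewrite /rhs rhs_diff_identity.
apply: psvanishB; last first.
  have X1 : psvanish 1 (psX {poly C}) by case.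
  apply: (psvanishM (M := 1)) => //; apply: psvanishD; first exact: psvanishMr.
  exact: psvanishMl.
apply: psvanishD; last exact: wsum_diff.
apply: psvanishMl => k kN; rewrite psB /dt -derivB -psB ue ?deriv0 //.
Qed.

Lemma rstep_diff N bv bv' : psvanish N (bv.1 - bv'.1) -> psvanish N (bv.2 - bv'.2) ->
  psvanish N.+1 ((rstep bv).1 - (rstep bv').1) /\
  psvanish N.+1 ((rstep bv).2 - (rstep bv').2).
Proof.
move=> e e'; have E := rhs_diff e e'.
have {}E k : (k < N.+1)%N -> rhs bv.1 bv.2 k = rhs bv'.1 bv'.2 k.
  by move=> kN; apply/eqP; rewrite -subr_eq0 -psB E.
by split=> k kN; rewrite psB /= E // subrr.
Qed.

Lemma riter_step m : psvanish m ((riter m).1 - (riter m.+1).1) /\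
  psvanish m ((riter m).2 - (riter m.+1).2).
Proof.
elim: m => [|m [e1 e2]]; first by split; apply: psvanish0.
exact: (rstep_diff e1 e2).
Qed.

Lemma riter_steps m k : psvanish m ((riter m).1 - (riter (m + k)).1) /\
  psvanish m ((riter m).2 - (riter (m + k)).2).
Proof.
elim: k => [|k [e1 e2]]; first by rewrite addn0 !subrr.
have [f1 f2] := riter_step (m + k)%N; rewrite addnS.
split.
  rewrite -[(riter m).1](subrK (riter (m + k)).1) -addrA; apply: psvanishD => //.
  exact: psvanishW (leq_addr _ _) f1.
rewrite -[(riter m).2](subrK (riter (m + k)).2) -addrA; apply: psvanishD => //.
exact: psvanishW (leq_addr _ _) f2.
Qed.

Definition rbeta : B := fun k => (riter k.+1).1 k.
Definition rv : B := fun k => (riter k.+1).2 k.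

Lemma riter_lim m : psvanish m ((riter m).1 - rbeta) /\ psvanish m ((riter m).2 - rv).
Proof.
split=> k km; have E : (k.+1 + (m - k.+1))%N = m by rewrite subnKC.
  have [e _] := riter_steps k.+1 (m - k.+1)%N; rewrite E in e.
  by have := e k (ltnSn k); rewrite !psB -opprB /rbeta => /eqP; rewrite oppr_eq0 => /eqP.
have [_ e] := riter_steps k.+1 (m - k.+1)%N; rewrite E in e.
by have := e k (ltnSn k); rewrite !psB -opprB /rv => /eqP; rewrite oppr_eq0 => /eqP.
Qed.

Lemma rfix k : rbeta k = rhs rbeta rv k %/ w0 /\ rv k = rhs rbeta rv k %% w0.
Proof.
have [e1 e2] := riter_lim k.
have [f1 f2] := @rstep_diff k (riter k) (rbeta, rv) e1 e2.
have [g1 g2] := riter_lim k.+1.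
have F1 : (rstep (riter k)).1 k = (rstep (rbeta, rv)).1 k.
  by apply/eqP; rewrite -subr_eq0 -psB f1.
have F2 : (rstep (riter k)).2 k = (rstep (rbeta, rv)).2 k.
  by apply/eqP; rewrite -subr_eq0 -psB f2.
have G1 : (riter k.+1).1 k = rbeta k by apply/eqP; rewrite -subr_eq0 -psB g1.
have G2 : (riter k.+1).2 k = rv k by apply/eqP; rewrite -subr_eq0 -psB g2.
by split; [exact: etrans (esym G1) F1 | exact: etrans (esym G2) F2].
Qed.

Lemma gsize_ushift beta : gsize 2 beta -> gsize 1 (ushift beta).
Proof.
move=> sb [|k] /=; first by rewrite size_poly1.
by apply: leq_trans (size_scale_leq _ _) _; apply: sb.
Qed.

(** Degree n + 1 + k here becomes at most k + 1 after division by w0, so that u_k has degree at most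
    k and u descends to the plane. *)
Lemma gsize_rhs beta v : gsize 2 beta -> gsize n.+1 v -> gsize n.+2 (rhs beta v).
Proof.
move=> sb sv k; have su := gsize_ushift sb; rewrite /rhs psB psD psCM.
apply: leq_trans (size_polyD _ _) _; rewrite size_polyN geq_max; apply/andP; split.
  apply: leq_trans (size_polyD _ _) _; rewrite geq_max; apply/andP; split.
    apply: leq_trans (size_polyMleq _ _) _.
    have sd : (size (dt (ushift beta) k) <= k)%N.
      have := su k; rewrite /dt; case: (eqVneq (ushift beta k) 0) => [->|/lt_size_deriv].
        by rewrite deriv0 size_poly0.
      by rewrite add1n => lt le; rewrite -ltnS; apply: leq_trans lt le.
    move: sd sq; move: (size q) (size (dt _ k)) => x y; lia.
  apply: leq_trans (size_sum _ _ _) _; apply/bigmax_leqP => -[d /= dk] _.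
  apply: leq_trans (size_polyMleq _ _) _.
  have := gsizeX d.+1 su (k - d)%N; have := sw d.
  move: (size (w d)) (size ((ushift beta ^+ d.+1) (k - d)%N)) => x y; lia.
rewrite psXM; case: k => [|k]; first by rewrite size_poly0.
have := gsizeM (a := 1) (b := n) sb sv k.
move: (size ((beta * v) k)) => x; lia.
Qed.

Lemma size_rstep bv : gsize 2 bv.1 -> gsize n.+1 bv.2 ->
  gsize 2 (rstep bv).1 /\ (forall k, size ((rstep bv).2 k) <= n)%N.
Proof.
move=> sb sv; have sr := gsize_rhs sb sv; split=> k /=.
  rewrite size_divp ?monic_neq0 // sw0 /=.
  by have := sr k; move: (size (rhs _ _ k)) => x; lia.
by rewrite -ltnS -sw0 ltn_modp monic_neq0.
Qed.

Lemma gsize_riter m : gsize 2 (riter m).1 /\ gsize n.+1 (riter m).2.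
Proof.
have s0 c : gsize c (0 : B) by move=> k; rewrite ps0 size_poly0.
elim: m => [|m [s1 s2]]; first by split; apply: s0.
have [t1 t2] := size_rstep s1 s2; split=> // k.
by apply: leq_trans (t2 k) _; rewrite addSn ltnW // ltnS leq_addr.
Qed.

Lemma size_rbeta : gsize 2 rbeta.
Proof. by move=> k; case: (gsize_riter k.+1) => + _; apply. Qed.

Lemma size_rv k : (size (rv k) <= n)%N.
Proof. by have [_ ->] := rfix k; rewrite -ltnS -sw0 ltn_modp monic_neq0. Qed.

Lemma rfixE : psC w0 * rbeta + rv = rhs rbeta rv.
Proof.
apply/funext => k; rewrite psD psCM; have [e1 e2] := rfix k.
by rewrite [in RHS](divp_eq (rhs rbeta rv k) w0) -e1 -e2 mulrC.
Qed.

Section Bounds.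
Variables (rho : R).
Hypothesis rho0 : 0 < rho.
Local Notation pn := (pnorm rho).

Lemma pnormZ c (P : {poly C}) : pn (c *: P) = cabs c * pn P.
Proof.
rewrite (pnormE _ (size_scale_leq c P)) /pnorm mulr_sumr.
by apply: eq_bigr => j _; rewrite coefZ cabsM mulrA.
Qed.

Lemma cabs_nat k : cabs (k%:R : C) = k%:R.
Proof. by rewrite cabsMn cabs1. Qed.

Lemma pnorm_ushift beta k : pn (ushift beta k.+1) <= pn (beta k).
Proof.
rewrite /= pnormZ cabsV cabs_nat -[leRHS]mul1r ler_wpM2r ?pnorm_ge0 //.
by rewrite invf_le1 ?ltr0n // ler1n.
Qed.

(** The derivative costs the degree, at most k + 1, and [ushift] divides by k + 2. Because of this
    compensation no radius is lost along the iteration. *)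
Lemma pnorm_dt_ushift beta k : gsize 2 beta ->
  pn (dt (ushift beta) k.+1) * rho <= pn (beta k).
Proof.
move=> sb; rewrite /dt; apply: le_trans (pnorm_deriv rho0 _) _.
rewrite /= pnormZ cabsV cabs_nat -[leLHS]mulr_natl.
have k0 : 0 < k.+2%:R :> R by rewrite ltr0n.
rewrite mulrCA ler_pdivrMl // ler_wpM2r ?pnorm_ge0 // ler_nat.
have := leq_trans (size_scale_leq (k.+2%:R)^-1 (beta k)) (sb k).
by move: (size _) => x; lia.
Qed.

Lemma Bnorm_ushift r K beta : 0 <= r ->
  Bnorm rho r K (ushift beta) <= 1 + r * Bnorm rho r K beta.
Proof.
move=> r0; case: K => [|K].
  by rewrite /Bnorm !big_ord0 mulr0 addr0.
rewrite /Bnorm big_ord_recl mulr1 pnormC cabs1 lerD2l.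
rewrite [in leRHS]big_ord_recr mulrDr /=; apply: ler_wpDr.
  by rewrite !mulr_ge0 ?pnorm_ge0 ?exprn_ge0.
rewrite mulr_sumr; apply: ler_sum => k _.
have := ler_wpM2r (exprn_ge0 k.+1 r0) (pnorm_ushift beta k).
by rewrite [X in _ <= X -> _]mulrC exprS -mulrA [r ^+ k * _]mulrC mulrA.
Qed.

Lemma Bnorm_dt_ushift r K beta : 0 <= r -> gsize 2 beta ->
  Bnorm rho r K (dt (ushift beta)) * rho <= r * Bnorm rho r K beta.
Proof.
move=> r0 sb; case: K => [|K].
  by rewrite /Bnorm !big_ord0 mulr0 mul0r.
rewrite /Bnorm big_ord_recl [X in X + _](_ : _ = 0) ?add0r; last first.
  by rewrite /dt /= derivC pnorm0 mul0r.
rewrite [in leRHS]big_ord_recr mulrDr /=; apply: ler_wpDr.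
  by rewrite !mulr_ge0 ?pnorm_ge0 ?exprn_ge0.
rewrite mulr_sumr mulr_suml; apply: ler_sum => k _.
have := ler_wpM2r (exprn_ge0 k.+1 r0) (pnorm_dt_ushift k sb).
by rewrite mulrAC [X in _ <= X -> _]mulrC exprS -[X in _ <= X -> _]mulrA [r ^+ k * pn _]mulrC.
Qed.

Lemma wsum_trunc K u :
  psvanish K (wsum u - \sum_(d < K) psC (w d) * (psX _ ^+ d * u ^+ d.+1)).
Proof.
move=> k kK; rewrite psB ps_sum /wsum; apply/eqP; rewrite subr_eq0; apply/eqP.
rewrite (big_ord_widen K (fun d => w d * (u ^+ d.+1) (k - d)%N)) // big_mkcond.
apply: eq_bigr => d _; rewrite psCM psXnM ltnS.
by case: ifP => // _; rewrite mulr0.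
Qed.

Lemma Bnorm_psXn r K F d : 0 <= r -> Bnorm rho r K (psX _ ^+ d * F) <= r ^+ d * Bnorm rho r K F.
Proof.
move=> r0; elim: d => [|d IH]; first by rewrite !expr0 !mul1r.
rewrite exprS -mulrA; apply: le_trans (Bnorm_psX _ _ _ _) _ => //.
by rewrite exprS -mulrA ler_wpM2l.
Qed.

(** Each factor u costs at most 2, hence the radius 2 r for w and one spare factor 2. *)
Lemma Bnorm_wsum r K u M : 0 <= r -> Bnorm rho r K u <= 2 ->
    (forall K, \sum_(d < K) pn (w d) * (2 * r) ^+ d <= M) ->
  Bnorm rho r K (wsum u) <= 2 * M.
Proof.
move=> r0 u2 wM; rewrite (eq_Bnorm rho r (wsum_trunc (K := K) u)).
apply: le_trans (Bnorm_sum rho0 r0 _ _ _ _) _.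
apply: le_trans (_ : _ <= 2 * \sum_(d < K) pn (w d) * (2 * r) ^+ d) _; last first.
  by rewrite ler_wpM2l.
rewrite mulr_sumr; apply: ler_sum => d _.
apply: le_trans (BnormM rho0 r0 _ _ _) _.
rewrite mulrCA; apply: ler_pM; rewrite ?Bnorm_ge0 //; first exact: Bnorm_psC.
apply: le_trans (Bnorm_psXn _ _ _ r0) _.
rewrite exprMn mulrA -exprS mulrC ler_wpM2r ?exprn_ge0 //.
apply: le_trans (BnormX rho0 r0 _ _ _) _.
by rewrite lerXn2r ?nnegrE ?Bnorm_ge0.
Qed.

(** The three terms contribute 1, 2 M and 1. The size delta of the unknowns always comes multiplied
    by r, so the bound does not depend on delta. *)
Lemma Bnorm_rhs r K M delta beta v : 0 <= r -> 0 <= delta ->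
    r * delta <= 1 -> r * delta ^+ 2 <= 1 -> pn q * (r * delta) <= rho ->
    (forall K, \sum_(d < K) pn (w d) * (2 * r) ^+ d <= M) ->
    gsize 2 beta -> Bnorm rho r K beta <= delta -> Bnorm rho r K v <= delta ->
  Bnorm rho r K (rhs beta v) <= 2 * M + 2.
Proof.
move=> r0 d0 rd rd2 qrd wM sb bd vd.
have b0 := Bnorm_ge0 rho0 r0 K beta; have v0 := Bnorm_ge0 rho0 r0 K v.
rewrite /rhs; apply: le_trans (BnormD rho0 r0 _ _ _) _; rewrite BnormN //.
rewrite [2 * M + 2](_ : _ = (1 + 2 * M) + 1); last by ring.
apply: lerD.
  apply: le_trans (BnormD rho0 r0 _ _ _) _; apply: lerD.
    apply: le_trans (BnormM rho0 r0 _ _ _) _.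
    rewrite -(ler_pM2r rho0) mul1r -mulrA.
    apply: le_trans qrd; apply: ler_pM; rewrite ?Bnorm_ge0 //.
    - by rewrite mulr_ge0 ?Bnorm_ge0 // ltW.
    - exact: Bnorm_psC.
    - by apply: le_trans (Bnorm_dt_ushift _ r0 sb) _; rewrite ler_wpM2l.
  apply: Bnorm_wsum wM => //; apply: le_trans (Bnorm_ushift _ _ r0) _.
  rewrite [leRHS](_ : _ = 1 + 1) // lerD2l; apply: le_trans rd.
  by rewrite ler_wpM2l.
apply: le_trans (Bnorm_psX rho0 r0 _ _) _; apply: le_trans rd2.
rewrite ler_wpM2l // expr2; apply: le_trans (BnormM rho0 r0 _ _ _) _.
by apply: ler_pM.
Qed.

End Bounds.

Lemma rbeta_bounded (rho r0 M : R) : 0 < rho ->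
    (forall Q S : {poly C}, (size S < size w0)%N ->
       rho ^+ (size w0).-1 * pnorm rho Q <= 2 * pnorm rho (w0 * Q + S) /\
       pnorm rho S <= pnorm rho (w0 * Q + S)) ->
    0 < r0 -> (forall K, \sum_(d < K) pnorm rho (w d) * (2 * r0) ^+ d <= M) ->
  exists r delta : R, [/\ 0 < r, r * delta <= 1 & forall K,
    Bnorm rho r K rbeta <= delta /\ Bnorm rho r K rv <= delta].
Proof.
move=> rho0 div r00 wM.
have M0 : 0 <= M by apply: le_trans (wM 0%N); rewrite big_ord0.
(* c bounds both the quotient, by 2 / rho^n, and the remainder, by 1. Then delta = c (2 M + 2) is a
   ball into which the recursion maps itself. *)
pose c := 1 + 2 / rho ^+ n.
have rn0 : 0 < rho ^+ n by rewrite exprn_gt0.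
have c1 : 1 <= c by rewrite lerDl divr_ge0 // ltW.
pose delta := c * (2 * M + 2).
have d1 : 1 <= delta.
  have m2 : 1 <= 2 * M + 2 by lra.
  apply: (le_trans c1); rewrite /delta -[leLHS]mulr1 ler_wpM2l //.
  exact: le_trans c1.
have d0 : 0 < delta by apply: lt_le_trans d1.
have q0 : 0 <= pnorm rho q by apply: pnorm_ge0.
(* The three bounds serve in turn the series of w, the product beta v, and the term q u_t. *)
pose r := Num.min r0 (Num.min ((delta ^+ 2)^-1) (rho / (pnorm rho q * delta + 1))).
have qd0 : 0 < pnorm rho q * delta + 1 by rewrite ltr_wpDl // mulr_ge0 // ltW.
have rp : 0 < r by rewrite !lt_min r00 invr_gt0 exprn_gt0 // divr_gt0.
have rr0 : r <= r0 by rewrite ge_min lexx.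
have rd2 : r * delta ^+ 2 <= 1.
  by rewrite -ler_pdivlMr ?exprn_gt0 // mul1r ge_min ge_min lexx orbT.
have rd : r * delta <= 1.
  apply: le_trans rd2; rewrite ler_wpM2l ?(ltW rp) // expr2 -[leLHS]mulr1.
  by rewrite ler_wpM2l // ltW.
have qrd : pnorm rho q * (r * delta) <= rho.
  have h : r * (pnorm rho q * delta + 1) <= rho.
    by rewrite -ler_pdivlMr // ge_min ge_min lexx !orbT.
  apply: le_trans h; rewrite mulrCA ler_wpM2l ?(ltW rp) //.
  by rewrite lerDl.
have wMr K : \sum_(d < K) pnorm rho (w d) * (2 * r) ^+ d <= M.
  apply: le_trans (wM K); apply: ler_sum => d _.
  by rewrite ler_wpM2l ?pnorm_ge0 // lerXn2r ?nnegrE ?mulr_ge0 ?(ltW rp) ?(ltW r00) // ler_wpM2l.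
have main m K : Bnorm rho r K (riter m).1 <= delta /\ Bnorm rho r K (riter m).2 <= delta.
  elim: m => [|m [b1 b2]]; first by rewrite Bnorm0 // ltW.
  have [s1 s2] := gsize_riter m.
  have E := Bnorm_rhs rho0 (ltW rp) (ltW d0) rd rd2 qrd wMr s1 b1 b2.
  have bd (f : B) : (forall k, pnorm rho (f k) <= c * pnorm rho (rhs (riter m).1 (riter m).2 k)) ->
      Bnorm rho r K f <= delta.
    move=> fk; apply: le_trans (_ : _ <= c * Bnorm rho r K (rhs (riter m).1 (riter m).2)) _.
      rewrite /Bnorm mulr_sumr; apply: ler_sum => k _.
      by rewrite mulrA ler_wpM2r ?exprn_ge0 ?(ltW rp).
    by rewrite ler_wpM2l // (le_trans _ c1).
  have dv k := div (rhs (riter m).1 (riter m).2 k %/ w0) (rhs (riter m).1 (riter m).2 k %% w0) (ltn_modpN0 _ (monic_neq0 w0_monic)).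
  have dE k : w0 * (rhs (riter m).1 (riter m).2 k %/ w0)
      + rhs (riter m).1 (riter m).2 k %% w0 = rhs (riter m).1 (riter m).2 k.
    by rewrite mulrC -divp_eq.
  split; apply: bd => k /=; have [h1 h2] := dv k; rewrite dE in h1 h2.
    rewrite sw0 /= in h1; rewrite /c mulrDl mul1r; apply: ler_wpDl; first exact: pnorm_ge0.
    by rewrite mulrAC ler_pdivlMr // mulrC.
  by apply: le_trans h2 _; rewrite -[leLHS]mul1r ler_wpM2r // pnorm_ge0.
exists r, delta; split=> // K; have [e1 e2] := riter_lim K; have [b1 b2] := main K K.
by split; [rewrite -(eq_Bnorm rho r e1) | rewrite -(eq_Bnorm rho r e2)].
Qed.

End RadialRecursion.

(** [P] stands for W(x u, y u), [un] and [un2] for u^n and u^(n + 2), [ux] and [uy] for the partial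
    derivatives of u. *)
Lemma pullback_radial_identity (A : comNzRingType) (P W' Q un un2 u ux uy x y : A) :
    un * Q * uy + P = un * (u + (x * ux + y * uy)) * W' -> un2 = u * (u * un) ->
  (un2 * Q - P * (y * u)) * (1 * u + x * ux) + P * (x * u) * (0 * u + y * ux)
    = un2 * (u + (x * ux + y * uy)) * (Q - W' * y) /\
  (un2 * Q - P * (y * u)) * (0 * u + x * uy) + P * (x * u) * (1 * u + y * uy)
    = un2 * (u + (x * ux + y * uy)) * (W' * x).
Proof.
move=> E ->.
have -> : P = un * (u + (x * ux + y * uy)) * W' - un * Q * uy by rewrite -E; ring.
by split; ring.
Qed.

(** * Radial substitutions and the Weierstrass form *)

Section WeierstrassNormalization.
Variable R : realType.
Local Notation C := R[i].
Local Notation B := (pseries {poly C}).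
Local Notation bl := (@bl R).
Local Notation cser := (@cser R).
Implicit Types (f g u W Q : series2 R).

Lemma kc_X (P : {poly C}) : (map_poly (@kc R) P).[psC 'X] = psC P.
Proof.
rewrite (horner_kc _ (leqnn _)) -[in RHS](coefK P) poly_def (rmorph_sum (@psC _)).
by apply: eq_bigr => j _; rewrite -mul_polyC rmorphM rmorphXn kcE.
Qed.

Lemma order_Xs_mul u : order_ge (Xs * u) 1.
Proof. by apply/order_ge1; rewrite XsM. Qed.

Lemma order_Ys_mul u : order_ge (Ys * u) 1.
Proof. by apply/order_ge1; rewrite YsM. Qed.

(** A radial substitution fixes every direction: in the chart it is (x, t) -> (x u, t). *)
Lemma bl_pscomp_radial N f u :
  psvanish N (bl (pscomp f (Xs * u) (Ys * u))
              - \sum_(d < N) psC (bl f d) * (psX _ ^+ d * bl u ^+ d)).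
Proof.
have E : bl (Ys * u) = psC 'X * bl (Xs * u) by rewrite !blM bl_Ys bl_Xs mulrA.
have := @bl_pscomp _ N f _ _ _ (order_Xs_mul u) (order_Ys_mul u) E.
congr (psvanish N (_ - _)); apply: eq_bigr => d _.
by rewrite kc_X blM bl_Xs exprMn.
Qed.

Lemma psX_psvanish k (F : B) : psvanish k (psX _ ^+ k * F).
Proof. by move=> d dk; rewrite psXnM leqNgt dk. Qed.

Lemma eq_psvanish (F G : B) : (forall N, psvanish N (F - G)) -> F = G.
Proof. by move=> e; apply/eqP; rewrite -subr_eq0; apply/eqP/psvanish_inj. Qed.

Lemma bl_homogeneous m Q : homogeneous m Q -> bl Q = psX _ ^+ m * psC (bl Q m).
Proof.
move=> hQ; apply/funext => d; rewrite psXnM.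
have z k : k != m -> bl Q k = 0.
  move=> km; apply/polyP => j; rewrite coef_bl coef0; case: ifP => // jk.
  by rewrite hQ // subnK.
case: (ltngtP m d) => [md|dm|->]; last by rewrite subnn.
  by rewrite z ?gtn_eqF // (_ : (d - m)%N = (d - m).-1.+1) //; lia.
by rewrite z // ltn_eqF.
Qed.

Lemma pscomp_homogeneous m Q u : homogeneous m Q ->
  pscomp Q (Xs * u) (Ys * u) = u ^+ m * Q.
Proof.
move=> hQ; apply: bl_inj; apply: eq_psvanish => N.
apply: (@psvanishW _ (N + m.+1)); first exact: leq_addr.
have := @bl_pscomp_radial (N + m.+1) Q u.
congr (psvanish _ (_ - _)); rewrite blM blXn (bl_homogeneous hQ).
have mN : (m < N + m.+1)%N by rewrite addnS ltnS leq_addl.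
rewrite (bigD1 (Ordinal mN)) //= psXnM leqnn subnn big1 ?addr0; first by ring.
move=> d; rewrite -val_eqE /= => dm; rewrite psXnM.
have [md|md] := leqP m d; last by rewrite rmorph0 mul0r.
by rewrite (_ : (d - m)%N = (d - m).-1.+1) /= ?rmorph0 ?mul0r //; lia.
Qed.

Lemma psdx_Xs : psdx (Xs : series2 R) = 1.
Proof.
by apply/funext => -[|[|i]]; apply/funext => -[|j]; rewrite /psdx /Xs ps1 /= ?mul0rn ?ps1 ?ps0.
Qed.

Lemma psdy_Xs : psdy (Xs : series2 R) = 0.
Proof. by apply/funext => i; apply/funext => j; rewrite /psdy /Xs andbF mul0rn. Qed.

Lemma psdx_Ys : psdx (Ys : series2 R) = 0.
Proof. by apply/funext => i; apply/funext => j; rewrite /psdx /Ys mul0rn. Qed.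

Lemma psdy_Ys : psdy (Ys : series2 R) = 1.
Proof.
by apply/funext => -[|i]; apply/funext => -[|[|j]]; rewrite /psdy /Ys ps1 /= ?mul0rn ?ps1 ?ps0.
Qed.

(** Under (x u, y u) the form x dy - y dx is multiplied by u^2, and Q dx becomes u^(n + 2) ((u +
    E(u)) Q dx + u_y Q (x dy - y dx)) with E the Euler field. Dividing by the coefficient of Q dx
    gives the equation of W'. *)
Lemma pullback_radial n W W' Q u : homogeneous n.+2 Q ->
    u ^+ n * Q * psdy u + pscomp W (Xs * u) (Ys * u)
    = u ^+ n * (u + euler u) * W' ->
  let V := u ^+ n.+2 * (u + euler u) in
  (pullback (Xs * u, Ys * u) (nform W Q)).1 = V * (nform W' Q).1 /\
  (pullback (Xs * u, Ys * u) (nform W Q)).2 = V * (nform W' Q).2.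
Proof.
move=> hQ E V; have ox := order_Xs_mul u; have oy := order_Ys_mul u.
rewrite /pullback /nform; rewrite [(_, _).1]/= [(_, _).2]/=.
rewrite pscompB !(pscompM _ _ ox oy) (pscomp_Xs ox oy) (pscomp_Ys ox oy).
rewrite (pscomp_homogeneous u hQ) !psdxM !psdyM.
rewrite psdx_Xs psdy_Xs psdx_Ys psdy_Ys.
rewrite /V eulerE in E *; rewrite [(Q - W' * Ys, _).1]/= [(Q - W' * Ys, _).2]/=.
apply: (pullback_radial_identity E).
by rewrite !exprS.
Qed.

Section Normalize.
Variables (n : nat) (W Q : series2 R).
Hypotheses (Wc : convergent W) (Wo : order_ge W n) (W0 : W 0%N n != 0).
Hypothesis hQ : homogeneous n.+2 Q.
(** The substitution divides the leading term of W by u(0), so u is sought as lam [ub] with [ub] of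
    constant term 1: this makes the leading term monic. The powers of lam in [wd] come from the same
    scaling. *)
Let lam := W 0%N n.
Let w0 : {poly C} := lam^-1 *: bl W n.
Let q : {poly C} := bl Q n.+2.
Let wd d : {poly C} := lam ^+ d *: bl W (n + d.+1)%N.

Lemma w0_size : size w0 = n.+1.
Proof.
rewrite size_scale ?invr_eq0 //; apply/eqP; rewrite eqn_leq size_bl /= ltnNge.
apply/negP => /leq_sizeP/(_ n (leqnn _)); rewrite coef_bl leqnn subnn => /eqP.
by rewrite (negbTE W0).
Qed.

Lemma w0_monic : w0 \is monic.
Proof.
by rewrite monicE /lead_coef w0_size /= coefZ coef_bl leqnn subnn mulVf.
Qed.

Lemma wd_size d : (size (wd d) <= n.+2 + d)%N.
Proof.
apply: leq_trans (size_scale_leq _ _) _; apply: leq_trans (size_bl _ _) _.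
by rewrite addnS !addSn.
Qed.

Let beta := rbeta w0 q wd.
Let v := rv w0 q wd.
Let ub : B := ushift beta.

Lemma gsize_ub : gsize 1 ub.
Proof.
apply: gsize_ushift; apply: (size_rbeta (n := n)); first exact: w0_monic.
- exact: w0_size.
- exact: size_bl.
- exact: wd_size.
Qed.

Lemma size_v k : (size (v k) <= n)%N.
Proof. by apply: size_rv; [exact: w0_monic | exact: w0_size | exact: size_bl]. Qed.

(** The equation of the radial pull-back, after division by lam^(n + 1) x^n [ub]^n. *)
Lemma recursion_solved :
  (1 + psX _ * beta) * (psC w0 + psX _ * v)
  = psC w0 + psX _ * (psC q * dt ub + wsum wd ub).
Proof.
have := rfixE wd w0_monic w0_size (size_bl Q n.+2); rewrite -/beta -/v /rhs -/ub => E.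
transitivity (psC w0 + psX _ * (psC w0 * beta + v + psX _ * (beta * v))); first by ring.
by rewrite E subrK.
Qed.

Lemma bl_pscomp_W (u : series2 R) : bl u = psC lam%:P * ub ->
  bl (pscomp W (Xs * u) (Ys * u))
  = psC (lam ^+ n.+1)%:P * (psX _ ^+ n * ub ^+ n) * (psC w0 + psX _ * wsum wd ub).
Proof.
move=> uE; apply: eq_psvanish => N.
apply: (@psvanishW _ (n + N.+1)); first by rewrite addnS -addSn leq_addl.
have Wv : psvanish n (bl W) by apply/order_ge_bl.
have E : \sum_(d < n + N.+1) psC (bl W d) * (psX _ ^+ d * bl u ^+ d)
    = psC (lam ^+ n.+1)%:P * (psX _ ^+ n * ub ^+ n)
      * (psC w0 + psX _ * \sum_(d < N) psC (wd d) * (psX _ ^+ d * ub ^+ d.+1)).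
  rewrite big_split_ord /= big1 ?add0r => [|d _]; last first.
    by rewrite Wv // rmorph0 mul0r.
  rewrite big_ord_recl /= addn0 mulrDr; congr (_ + _).
    have -> : psC w0 = psC (lam^-1)%:P * psC (bl W n).
      by rewrite -rmorphM /= mul_polyC.
    have e : psC (lam ^+ n.+1)%:P * psC (lam^-1)%:P = psC (lam%:P) ^+ n :> B.
      by rewrite -!rmorphM -!rmorphXn /= exprSr mulfK.
    rewrite uE exprMn -e; ring.
  rewrite !mulr_sumr; apply: eq_bigr => d _; rewrite /bump add1n.
  have -> : psC (wd d) = psC (lam%:P) ^+ d * psC (bl W (n + d.+1)%N).
    by rewrite -rmorphXn -rmorphM -rmorphXn /= mul_polyC.
  have -> : psC (lam ^+ n.+1)%:P = psC lam%:P ^+ n.+1 :> B by rewrite !rmorphXn.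
  rewrite uE exprMn !addnS !exprS !exprD; ring.
have h1 := @bl_pscomp_radial (n + N.+1) W u; rewrite E in h1.
rewrite -[bl _](subrK (psC (lam ^+ n.+1)%:P * (psX _ ^+ n * ub ^+ n)
      * (psC w0 + psX _ * \sum_(d < N) psC (wd d) * (psX _ ^+ d * ub ^+ d.+1)))).
rewrite -addrA; apply: psvanishD h1 _.
have h2 := wsum_trunc wd (K := N) ub.
rewrite -mulrBr opprD addrACA subrr add0r -mulrBr -mulrA.
apply: psvanishMl; rewrite -mulrA; apply: psvanishM; first by move=> d dn; rewrite -[_ ^+ n]mulr1 psX_psvanish.
apply: psvanishMl; apply: (psvanishM (M := 1)); first by case.
by rewrite -opprB; apply: psvanishN.
Qed.

Lemma dt_psC c (F : B) : dt (psC c%:P * F) = psC c%:P * dt F.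
Proof. by apply/funext => k; rewrite /dt !psCM derivM derivC mul0r add0r. Qed.

(** From y = t x, d/dt acts as x d/dy on functions of the plane. *)
Lemma dt_bl u : dt (bl u) = psX _ * bl (psdy u).
Proof.
apply/funext => -[|k]; rewrite psXM /dt ?bl_psdy //.
have /size1_polyC -> := size_bl u 0; exact: derivC.
Qed.

Lemma weierstrass_solution : exists u W' : series2 R,
  [/\ bl u = psC lam%:P * ub, bl W' = psX _ ^+ n * (psC w0 + psX _ * v) &
    u ^+ n * Q * psdy u + pscomp W (Xs * u) (Ys * u)
    = u ^+ n * (u + euler u) * W'].
Proof.
pose wb : B := psC w0 + psX _ * v.
have swb k : (size (wb k) <= n.+1)%N.
  rewrite /wb psD psXM; case: k => [|k]; first by rewrite addr0 w0_size.
  by rewrite [psC _ _]/= add0r leqW // size_v.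
pose u := unbl (psC lam%:P * ub); pose W' := unbl (psX _ ^+ n * wb).
have uE : bl u = psC lam%:P * ub.
  apply: unblK => d; rewrite psCM; apply: leq_trans (gsize_ub d).
  by rewrite mul_polyC size_scale_leq.
have W'E : bl W' = psX _ ^+ n * wb.
  apply: unblK => d; rewrite psXnM; case: (leqP n d) => nd; last by rewrite size_poly0.
  by apply: leq_trans (swb _) _; rewrite ltnS.
exists u, W'; split=> //; apply: bl_inj.
have eE : bl (u + euler u) = psC lam%:P * (1 + psX _ * beta).
  apply/funext => k; rewrite blD psD bl_euler uE !psCM psD psXM -mulrS -mulrnAr.
  congr (_ * _); rewrite /ub; case: k => [|k]; first by rewrite ps1 addr0.
  rewrite ps1 add0r /= -scaler_nat scalerA divff ?scale1r // pnatr_eq0.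
  done.
have dE : psX _ * bl (psdy u) = psC lam%:P * dt ub by rewrite -dt_bl uE dt_psC.
rewrite blD !blM blXn eE W'E (bl_pscomp_W uE) (bl_homogeneous hQ) -/q uE.
have -> : psC (lam ^+ n.+1)%:P = psC lam%:P * psC lam%:P ^+ n :> B by rewrite -exprS !rmorphXn.
transitivity ((psC lam%:P * psC lam%:P ^+ n) * (psX _ ^+ n * ub ^+ n)
   * ((1 + psX _ * beta) * wb)).
  rewrite /wb recursion_solved.
  transitivity ((psC lam%:P * ub) ^+ n * (psX _ ^+ n * (psX _ * psC q)) * (psX _ * bl (psdy u))
    + (psC lam%:P * psC lam%:P ^+ n) * (psX _ ^+ n * ub ^+ n) * (psC w0 + psX _ * wsum wd ub)).
    by rewrite !exprS; ring.
  rewrite dE exprMn; ring.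
rewrite exprMn; ring.
Qed.

Lemma psC_bounded (rho r : R) P : 0 < rho -> 0 < r -> cvB rho (psC P).
Proof.
by move=> rho0 r0; exists r, (pnorm rho P); split=> // K; exact: Bnorm_psC.
Qed.

Lemma psX_bounded (rho : R) k : 0 < rho -> cvB rho (psX {poly C} ^+ k).
Proof.
move=> rho0; exists 1, 1; split=> // K; rewrite -[psX _ ^+ k]mulr1.
apply: le_trans (Bnorm_psXn _ _ _ _ _) _ => //.
by rewrite expr1n mul1r Bnorm1.
Qed.

Lemma weierstrass_normalization : exists u W' : series2 R,
  [/\ convergent u, u 0%N 0%N != 0, weierstrass_poly n W' /\ has_order W' n &
    u ^+ n * Q * psdy u + pscomp W (Xs * u) (Ys * u)
    = u ^+ n * (u + euler u) * W'].
Proof.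
have [u [W' [uE W'E E]]] := weierstrass_solution.
have [rho rho0 div] := monic_division_bound w0_monic.
have /(convergentP _ rho0)[rW [M [rW0 WM]]] := Wc.
have l0 : 0 < cabs lam by rewrite lt_neqAle eq_sym cabs_eq0 W0 cabs_ge0.
(* Chosen so that |lam| (2 r0) = rW: the factor lam^d in [wd] is absorbed and the radius of W is
   recovered. *)
pose r0 := rW / (2 * cabs lam).
have r00 : 0 < r0 by rewrite divr_gt0 // mulr_gt0.
have lr : cabs lam * (2 * r0) = rW by rewrite /r0; field; rewrite gt_eqF.
have wM K : \sum_(d < K) pnorm rho (wd d) * (2 * r0) ^+ d <= M / rW ^+ n.+1.
  rewrite ler_pdivlMr ?exprn_gt0 //; apply: le_trans (WM (n.+1 + K)%N).
  rewrite /Bnorm big_split_ord /=; apply: ler_wpDl.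
    by apply: sumr_ge0 => d _; rewrite mulr_ge0 ?pnorm_ge0 ?exprn_ge0 // ltW.
  rewrite mulr_suml; apply: ler_sum => d _; rewrite /wd pnormZ // addnS addSn.
  have -> : cabs (lam ^+ d) = cabs lam ^+ d.
    by elim: (d : nat) => [|e IH]; rewrite ?expr0 ?cabs1 // !exprS cabsM IH.
  have -> : rW ^+ (n + d).+1 = rW ^+ n.+1 * (cabs lam ^+ d * (2 * r0) ^+ d).
    by rewrite -exprMn lr -exprD.
  by rewrite le_eqVlt; apply/orP; left; apply/eqP; ring.
have [r [delta [rp rd bd]]] :=
  rbeta_bounded w0_monic w0_size (size_bl Q n.+2) wd_size rho0 div r00 wM.
have ubc : cvB rho ub.
  exists r, 2; split=> // K; apply: le_trans (Bnorm_ushift rho0 _ _ (ltW rp)) _.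
  rewrite [leRHS](_ : _ = 1 + 1) // lerD2l; apply: le_trans rd.
  by rewrite ler_wpM2l ?(ltW rp) //; case: (bd K).
have vc : cvB rho v by exists r, delta; split=> // K; case: (bd K).
have cC P : cvB rho (psC P) by apply: (psC_bounded (r := 1)).
have cX k : cvB rho (psX {poly C} ^+ k) by apply: psX_bounded.
have uc : convergent u.
  by apply/(convergentP _ rho0); rewrite uE; apply: cvB_M.
have W'c : convergent W'.
  apply/(convergentP _ rho0); rewrite W'E; apply: cvB_M => //; apply: cvB_D => //.
  by apply: cvB_M => //; have := cX 1%N; rewrite expr1.
have coefW' i j : W' i j = ((psX _ ^+ n * (psC w0 + psX _ * v)) (i + j)%N)`_j.
  by rewrite -W'E coef_bl leq_addl addnK.
have W'top : W' 0%N n = 1.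
  rewrite coefW' psXnM leqnn subnn psD psXM addr0 /psC.
  by have /monicP := w0_monic; rewrite /lead_coef w0_size.
exists u, W'; split=> //.
- have -> : u 0%N 0%N = (bl u 0%N)`_0 by rewrite coef_bl.
  by rewrite uE psCM /ub /= mulr1 coefC.
- split; split=> //.
  (* Beyond order n the coefficients of W' are remainders, of degree less than n in t, that is in y;
     only the monic w0 reaches y^n. *)
  + move=> i j nj; rewrite coefW' psXnM.
    have [ij|ij] := leqP n (i + j); last by lia.
    rewrite psD psXM; case e : (i + j - n)%N => [|k].
      have [-> ->] : i = 0%N /\ j = n by lia.
      rewrite !eqxx addr0 /psC.
      by have /monicP := w0_monic; rewrite /lead_coef w0_size.
    rewrite add0r nth_default; last by apply: leq_trans nj; apply: size_v.
    by case: eqP => // i0; case: eqP => // jn; lia.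
  + move=> i j ij; rewrite coefW' psXnM leqNgt ij /= coef0 //.
  + by move=> /(_ 0%N n (ltnSn n)) /eqP; rewrite W'top oner_eq0.
Qed.

End Normalize.

End WeierstrassNormalization.

(** * Existence *)

Section Existence.
Variable R : realType.
Local Notation C := R[i].
Local Notation bl := (@bl R).
Implicit Types (f g u W Q : series2 R) (F G : germmap R) (w : oneform R) (X : vfield R).

Lemma horner_inj (P Q : {poly C}) : (forall t, P.[t] = Q.[t]) -> P = Q.
Proof.
move=> e; apply/eqP; rewrite -subr_eq0; apply/negPn/negP => nz.
pose s := mkseq (fun i => i%:R : C) (size (P - Q)).
suff : (size s < size (P - Q)%R)%N by rewrite size_mkseq ltnn.
apply: max_poly_roots nz _ _.
  by apply/allP => t _; rewrite rootE hornerD hornerN e subrr.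
by apply: mkseq_uniq => i j /eqP; rewrite eqr_nat => /eqP.
Qed.

Lemma dehom_hev k f g c : (forall a b, hev k f a b = c * hev k g a b) ->
  dehom k f = c *: dehom k g.
Proof. by move=> e; apply: horner_inj => t; rewrite hornerZ !horner_bl. Qed.

Lemma zero_divisor_hev k f g c : c != 0 ->
    (forall a b, hev k f a b = c * hev k g a b) ->
  forall e, zero_divisor k f e = zero_divisor k g e.
Proof.
move=> c0 e.
have mupZ t (P : {poly C}) : mup t (c *: P) = mup t P.
  by rewrite -mul_polyC mupMr // rootC.
case=> [t|] /=; first exact: (etrans (congr1 (mup t) (dehom_hev e)) (mupZ _ _)).
have es a b : hev k (psswap f) a b = c * hev k (psswap g) a b by rewrite (hev_psswap f) (hev_psswap g) e.
exact: (etrans (congr1 (mup 0) (dehom_hev es)) (mupZ _ _)).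
Qed.

Lemma order_linear_part f : order_ge (linear_part f) 1.
Proof. by apply/order_ge1. Qed.

Lemma hev_linear_part f a b : hev 1 (linear_part f) a b = hev 1 f a b.
Proof. by rewrite !hev1. Qed.

(** A binary form of positive degree over C has a zero (v1 : v2), at infinity or at a root; (u1, u2)
    completes it to a basis. *)
Lemma zero_direction k f : bl f k.+2 != 0 -> exists v1 v2 u1 u2 : C,
  u1 * v2 - v1 * u2 != 0 /\ hev k.+2 f v1 v2 = 0.
Proof.
move=> nz; have [z|z] := eqVneq (f 0%N k.+2) 0.
  by exists 0, 1, 1, 0; rewrite hev01 mulr1 mul0r subr0 oner_neq0.
have : size (bl f k.+2) != 1.
  rewrite neq_ltn; apply/orP; right; rewrite ltnNge; apply/negP => /leq_sizeP/(_ k.+2 isT).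
  by rewrite coef_bl leqnn subnn => /eqP; rewrite (negbTE z).
case/closed_rootP => t /rootP; rewrite horner_bl => e.
by exists 1, t, 0, 1; rewrite mul0r sub0r mulr1 oppr_eq0 oner_neq0.
Qed.

Lemma pscomp00 f p q : order_ge p 1 -> order_ge q 1 ->
  pscomp f p q 0%N 0%N = f 0%N 0%N.
Proof.
move=> op oq; have := @hev_pscomp _ 0 f p q 0 0 op oq (fun i j h => ltac:(by [])).
by rewrite !hev0.
Qed.

Lemma ps00M f g : (f * g) 0%N 0%N = f 0%N 0%N * g 0%N 0%N.
Proof. by rewrite -!(hev0 _ 0 0) -(@hevM _ 0 0). Qed.

Lemma ps00_1 : (1 : series2 R) 0%N 0%N = 1.
Proof. by rewrite ps1. Qed.

Lemma ps00X f k : (f ^+ k) 0%N 0%N = f 0%N 0%N ^+ k.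
Proof.
elim: k => [|k IH]; last by rewrite !exprS ps00M IH.
by rewrite !expr0 ps00_1.
Qed.

Lemma ps00_unit f g : f * g = 1 -> g 0%N 0%N != 0.
Proof.
move=> e; apply/eqP => g0; have := ps00M f g; rewrite e g0 mulr0.
by rewrite ps00_1 => /eqP; rewrite oner_eq0.
Qed.

Lemma nform_after_straightening n w X : holomorphic w -> radial X ->
    order_ge w.1 n.+1 -> order_ge w.2 n.+1 ->
    invariant_divisor w (contract w X) -> order_ge (contract w X) n.+3 ->
    bl (contract w X) n.+3 != 0 -> no_common_direction n w (contract w X) ->
  exists G U W Q, [/\ [/\ germ G, holomorphic G & jac G != 0],
    [/\ convergent U, U 0%N 0%N != 0, homogeneous n.+2 Q & dehom n.+2 Q \is monic],
    [/\ convergent W, order_ge W n & W 0%N n != 0],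
    (pullback G w).1 = U * (nform W Q).1 /\ (pullback G w).2 = U * (nform W Q).2 &
    pscomp (contract w X) G.1 G.2 = U * (Xs * Q)].
Proof.
move=> hw rX o1 o2 [h _ inv] of0 bf0 ncd.
have [v1 [v2 [u1 [u2 [d0 z]]]]] := zero_direction bf0.
have [G [gG hG [x1 y1] [x2 y2] eG]] := radial_straightening v1 v2 u1 u2 rX.
have jG : jac G != 0 by rewrite /jac x1 y2 y1 x2.
have [og1 og2] := gG.
have E := contract_pullback w gG eG.
have Wd := wedge_pullback w (contract w X) gG.
rewrite inv (pscompM _ _ og1 og2) -mulrA in Wd.
have [E1 E2] := euler_divisible E Wd.
have [oa ob] := order_ge_pullback gG o1 o2.
have of1 := order_ge_pscomp og1 og2 of0.
have hv a b : hev n.+3 (pscomp (contract w X) G.1 G.2) a b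
    = hev n.+3 (contract w X) (u1 * a + v1 * b) (u2 * a + v2 * b).
  by rewrite (hev_pscomp _ _ og1 og2 of0) !hev1 x1 y1 x2 y2.
have f0n : pscomp (contract w X) G.1 G.2 0%N n.+3 = 0.
  by rewrite -hev01 hv !mulr0 !add0r !mulr1.
have bf1 : bl (pscomp (contract w X) G.1 G.2) n.+3 != 0.
  apply: contra_neq bf0 => e.
  have hvz a b : hev n.+3 (pscomp (contract w X) G.1 G.2) a b = 0.
    have [->|a0] := eqVneq a 0.
      by rewrite -[b]mulr1 -(mulr0 b) hevZ hev01 f0n !mulr0.
    have -> : b = a * (b / a) by rewrite mulrCA mulfV ?mulr1.
    by rewrite -{1}[a]mulr1 hevZ -horner_bl e horner0 mulr0.
  apply: horner_inj => t; rewrite horner_bl horner0.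
  (* Cramer's rule for the preimage (a, b) of (1, t) under the linear part of G. *)
  pose a := (v2 - v1 * t) / (u1 * v2 - v1 * u2).
  pose b := (u1 * t - u2) / (u1 * v2 - v1 * u2).
  by rewrite -(hvz a b) hv; congr (hev _ _ _ _); rewrite /a /b; field.
have nc := no_common_pullback gG jG o1 o2 of0 ncd.
have [hw1 hw2] := holomorphic_pullback gG hG hw.
have fc : convergent (pscomp (contract w X) G.1 G.2).
  by rewrite -E; apply: convergentD; apply: convergentM => //;
     [exact: convergent_Xs | exact: convergent_Ys].
have nc' : no_common_direction n ((pullback G w).1, (pullback G w).2)
             (pscomp (contract w X) G.1 G.2) by [].
have [U [Q [Uc U0 hQ mQ fE]]] := invariant_tangency_factor E oa ob of1 bf1 f0n nc' E1 E2 fc.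
have [_ a0] := transverse_at_infinity E of1 f0n nc'.
have E' := E; rewrite fE in E'.
have [W [Wc Wo W0 aE bE]] := nform_representation E' Uc U0 hw1 hw2 ob a0 hQ.
by exists G, U, W, Q.
Qed.

Lemma germ_radial u : germ (Xs * u, Ys * u).
Proof. by split; [exact: order_Xs_mul | exact: order_Ys_mul]. Qed.

Lemma radial_coef u : [/\ (Xs * u) 1%N 0%N = u 0%N 0%N, (Xs * u) 0%N 1%N = 0,
  (Ys * u) 1%N 0%N = 0 & (Ys * u) 0%N 1%N = u 0%N 0%N].
Proof. by rewrite !XsM !YsM. Qed.

Lemma pullback_mul V a b G : germ G ->
  pullback G (V * a, V * b) = (pscomp V G.1 G.2 * (pullback G (a, b)).1,
                               pscomp V G.1 G.2 * (pullback G (a, b)).2).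
Proof.
case=> g1 g2; rewrite /pullback; rewrite ![(_, _).1]/= ![(_, _).2]/=.
by rewrite !(pscompM _ _ g1 g2) -!mulrA -!mulrDr.
Qed.

Lemma pullback_gid w : pullback (gid R) w = w.
Proof.
case: w => a b; rewrite /pullback /gid ![(_, _).1]/= ![(_, _).2]/= !pscomp_id.
by rewrite psdx_Xs psdy_Xs psdx_Ys psdy_Ys !mulr1 !mulr0 addr0 add0r.
Qed.

Lemma same_foliation_pullback w w' Phi Gam V : germ Phi -> germ Gam ->
    holomorphic Phi -> gcomp Gam Phi = gid R ->
    convergent V -> V 0%N 0%N != 0 ->
    (pullback Gam w).1 = V * w'.1 -> (pullback Gam w).2 = V * w'.2 ->
  same_foliation (pullback Phi w') w.
Proof.
move=> gP gG hP GP Vc V0 E1 E2.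
have [p1 p2] := gP.
have [V' VV] := series2_inv V0.
have V'c := convergent_inv Vc VV.
have E : pullback Phi (pullback Gam w) = w.
  by rewrite (pullback_gcomp _ gG gP) GP pullback_gid.
have E' : pullback Gam w = (V * w'.1, V * w'.2).
  by rewrite -E1 -E2; case: (pullback Gam w).
rewrite E' (pullback_mul _ _ _ gP) in E.
have VP : pscomp V' Phi.1 Phi.2 * pscomp V Phi.1 Phi.2 = 1.
  rewrite -(pscompM _ _ p1 p2) [V' * V]mulrC VV.
  by have := pscomp_cser 1 Phi.1 Phi.2; rewrite rmorph1.
have -> : pullback Phi w' = pullback Phi (w'.1, w'.2) by case: (w').
exists (pscomp V' Phi.1 Phi.2); split.
- by case: hP => c1 c2; apply: convergent_pscomp.
- by rewrite pscomp00 // (ps00_unit VV).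
- by rewrite -E [(_, _).1]/= mulrA VP mul1r.
- by rewrite -E [(_, _).2]/= mulrA VP mul1r.
Qed.

Lemma homogeneous_order m Q : homogeneous m Q -> order_ge Q m.
Proof. by move=> h i j ij; rewrite h // ltn_eqF. Qed.

Lemma order_XsM m Q : order_ge Q m -> order_ge (Xs * Q) m.+1.
Proof. by move=> h; rewrite -add1n; apply: order_geM => //; apply: order_Xs. Qed.

Lemma hev_gcomp_id F G (a b : C) : germ F -> germ G -> gcomp F G = gid R ->
  hev 1 F.1 (hev 1 G.1 a b) (hev 1 G.2 a b) = a /\
  hev 1 F.2 (hev 1 G.1 a b) (hev 1 G.2 a b) = b.
Proof.
case=> f1 f2 [g1 g2] [e1 e2].
rewrite -(hev_pscomp a b g1 g2 f1) -(hev_pscomp a b g1 g2 f2) e1 e2 !hev1.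
by rewrite /Xs /Ys /= !mul1r !mul0r addr0 add0r.
Qed.

Lemma normal_form_exists n w D : Dhclass n w -> divh w D ->
  exists Phi W Q, normal_form n w D Phi W Q.
Proof.
case=> [[[hw _] mw rw] _] [X [rX [_ inv] tX]].
have [of0 bf0 _ ncd Dz] := tangency_data mw rw rX tX.
have [o1 o2 _] := mw.
have [G [U [W [Q [[gG hG jG] [Uc U0 hQ mQ] [Wc Wo W0] [a1 a2] fE]]]]] :=
  nform_after_straightening hw rX o1 o2 inv of0 bf0 ncd.
have [u [W' [uc u0 W'w E]]] := weierstrass_normalization Wc Wo W0 hQ.
have [b1 b2] := pullback_radial hQ E; move: b1 b2.
set V := u ^+ n.+2 * (u + euler u) => b1 b2.
pose rad : germmap R := (Xs * u, Ys * u).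
have gr : germ rad := germ_radial u; have [r1 r2] := gr.
have [ux uy vx vy] := radial_coef u.
have hr : holomorphic rad.
  by split; apply: convergentM => //; [exact: convergent_Xs | exact: convergent_Ys].
have gGam : germ (gcomp G rad) by apply: germ_gcomp.
have bGam : biholomorphism (gcomp G rad).
  apply/biholomorphismP; split=> //; first exact: holomorphic_gcomp.
  rewrite (jac_gcomp gG gr) mulf_neq0 // /jac /rad [(_, _).1]/= [(_, _).2]/= ux uy vx vy mul0r subr0.
  by rewrite mulf_neq0.
have [Phi [bP gP GP PG]] := germ_inverse bGam.
have [_ hP _] := (biholomorphismP Phi).1 bP.
have PE : pullback (gcomp G rad) w
    = (pscomp U rad.1 rad.2 * (V * (nform W' Q).1), pscomp U rad.1 rad.2 * (V * (nform W' Q).2)).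
  rewrite -(pullback_gcomp _ gG gr).
  have -> : pullback G w = (U * (nform W Q).1, U * (nform W Q).2).
    by rewrite -a1 -a2; case: (pullback G w).
  by rewrite (pullback_mul _ _ _ gr) -b1 -b2.
have V00 : V 0%N 0%N = u 0%N 0%N ^+ n.+3.
  rewrite /V ps00M ps00X psd2.
  have -> : euler u 0%N 0%N = 0 by rewrite /euler mulr0n.
  by rewrite addr0 -exprSr.
exists Phi, W', Q; split=> //.
- apply: (same_foliation_pullback (V := pscomp U rad.1 rad.2 * V) gP gGam hP GP).
  + apply: convergentM; first by case: hr => h1 h2; apply: convergent_pscomp.
    apply: convergentM; first exact: convergentX.
    apply: convergentD => //; rewrite eulerE; apply: convergentD.
      by apply: convergentM; [exact: convergent_Xs | exact: convergent_psdx].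
    by apply: convergentM; [exact: convergent_Ys | exact: convergent_psdy].
  + by rewrite ps00M pscomp00 // V00 mulf_neq0 // expf_neq0.
  + by rewrite PE -mulrA.
  + by rewrite PE -mulrA.
- move=> e; rewrite Dz; have [p1 p2] := gP; have [g1 g2] := gGam.
  have oQ := order_XsM (homogeneous_order hQ).
  (* To first order the radial map is the homothety of ratio u(0), whence the power n + 3; the unit
     U contributes its constant term. *)
  apply: (@zero_divisor_hev _ _ _ (u 0%N 0%N ^+ n.+3 * U 0%N 0%N)).
    by rewrite mulf_neq0 // expf_neq0.
  move=> a b.
  rewrite (hev_pscomp _ _ (order_linear_part _) (order_linear_part _) oQ).
  rewrite !hev_linear_part.
  have [ea eb] := hev_gcomp_id a b gGam gP GP.
  move: ea eb; set a' := hev 1 Phi.1 a b; set b' := hev 1 Phi.2 a b => ea eb.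
  transitivity (hev n.+3 (contract w X) (hev 1 (gcomp G rad).1 a' b') (hev 1 (gcomp G rad).2 a' b')).
    by rewrite ea eb.
  rewrite -(hev_pscomp _ _ g1 g2 of0).
  have [G1 G2] := gG.
  have -> : pscomp (contract w X) (gcomp G rad).1 (gcomp G rad).2
      = pscomp (U * (Xs * Q)) rad.1 rad.2.
    by rewrite -fE (pscompA _ G1 G2 r1 r2).
  have oU : order_ge (U * (Xs * Q)) n.+3.
    by rewrite -[n.+3]add0n; apply: order_geM.
  rewrite (hev_pscomp _ _ r1 r2 oU) !hev1 /rad [(_, _).1]/= [(_, _).2]/= ux uy vx vy !mul0r addr0 add0r hevZ -mulrA.
  by rewrite -(hev0 U a' b') -(@hevM _ 0 n.+3).
Qed.

End Existence.

(** * Rigidity in the blow-up *)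

Lemma leibniz_identity (A : comNzRingType) (a b x x' y y' u u' : A) :
  a * (x' * y + x * y') - b * (u' * y + x * u)
  = (a * x' - b * u') * y + x * (a * y' - b * u).
Proof. by ring. Qed.

Lemma delta_psC (K : comNzRingType) (F : pseries K) : delta (psC F) = F.
Proof.
apply/funext => d; rewrite /delta big_ord_recr /= subnn big1 ?add0r // => -[j /= jd] _.
by rewrite (_ : (d - j)%N = (d - j).-1.+1) //; lia.
Qed.

Lemma delta_psX (K : comNzRingType) : delta (psX (pseries K)) = psX K.
Proof.
have := delta_psC (0 : pseries K); rewrite rmorph0 => e0.
apply/funext => -[|d]; rewrite /delta.
  by rewrite big_ord1.
rewrite big_ord_recl subn0 big1 ?addr0.
  by rewrite /psX; case: d => [|d]; rewrite ?ps1 ?ps0.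
by move=> j _; rewrite /psX; case: eqP => // _; rewrite ps1.
Qed.

Lemma deltaD (K : comNzRingType) (H H' : pseries (pseries K)) :
  delta (H + H') = delta H + delta H'.
Proof. exact: (raddfD (@delta K) H H'). Qed.

Lemma deltaB (K : comNzRingType) (H H' : pseries (pseries K)) :
  delta (H - H') = delta H - delta H'.
Proof. exact: (raddfB (@delta K) H H'). Qed.

Lemma deltaM (K : comNzRingType) (H H' : pseries (pseries K)) :
  delta (H * H') = delta H * delta H'.
Proof. exact: (rmorphM (@delta K) H H'). Qed.

Lemma delta_trunc (K : comNzRingType) (H : pseries (pseries K)) N :
  psvanish N (delta H - \sum_(d < N) psX K ^+ d * H d).
Proof.
move=> k kN; rewrite psB ps_sum; apply/eqP; rewrite subr_eq0; apply/eqP.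
rewrite /delta (reindex_inj rev_ord_inj) /=.
rewrite (big_ord_widen N (fun d => H (k - (k.+1 - d.+1))%N (k.+1 - d.+1)%N)) // big_mkcond.
apply: eq_bigr => -[d /= dN] _; rewrite psXnM ltnS subSS.
by case: ifP => // dk; rewrite subKn.
Qed.

(** * Formal flows on C[t][[x]] *)

Section TransverseFlow.
Variable R : realType.
Local Notation C := R[i].
Local Notation B := (pseries {poly C}).
Local Notation kc := (@kc R).
Implicit Types (F G : B) (Y Z : pseries B).

(** Continuous C-algebra endomorphisms of C[t][[x]], in place of pairs (X, T) of series: composition
    with a flow is then a mere composition of functions. *)
Definition endo (s : B -> B) := [/\ forall F G, s (F + G) = s F + s G,
  forall F G, s (F * G) = s F * s G, forall c, s (kc c) = kc c &
  forall N F, psvanish N F -> psvanish N (s F)].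

Lemma endo_comp s s' : endo s -> endo s' -> endo (s \o s').
Proof.
case=> sD sM sC sv [s'D s'M s'C s'v]; split=> [F G|F G|c|N F FN] /=.
- by rewrite s'D sD.
- by rewrite s'M sM.
- by rewrite s'C sC.
- exact/sv/s'v.
Qed.

Section EndoTheory.
Variable s : B -> B.
Hypothesis es : endo s.

Lemma endo0 : s 0 = 0.
Proof. by case: es => _ _ sC _; have := sC 0; rewrite rmorph0. Qed.

Lemma endo1 : s 1 = 1.
Proof. by case: es => _ _ sC _; have := sC 1; rewrite rmorph1. Qed.

Lemma endoB F G : s (F - G) = s F - s G.
Proof.
have [sD _ _ _] := es; have := sD (F - G) G; rewrite subrK => ->.
by rewrite addrK.
Qed.

Lemma endoX F k : s (F ^+ k) = s F ^+ k.
Proof.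
have [_ sM _ _] := es.
elim: k => [|k IH]; first by rewrite !expr0; exact: endo1.
by rewrite !exprS sM IH.
Qed.

Lemma series_trunc N F : psvanish N (F - \sum_(d < N) psC (F d) * psX _ ^+ d).
Proof.
move=> k kN; rewrite psB ps_sum (bigD1 (Ordinal kN)) //= big1 => [|d dk].
  by rewrite mulrC psXnM leqnn subnn addr0 subrr.
rewrite mulrC psXnM; case: ifP => // dk'; rewrite -val_eqE /= in dk.
by rewrite (_ : (k - d)%N = (k - d).-1.+1) //; move/eqP: dk; lia.
Qed.

Lemma endo_close N : psvanish N (s (psX _) - psX _) ->
    psvanish N (s (psC 'X) - psC 'X) -> forall F, psvanish N (s F - F).
Proof.
have [sD sM sC sv] := es.
move=> cX ct.
have close_mul F G : psvanish N (s F - F) -> psvanish N (s G - G) ->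
    psvanish N (s (F * G) - F * G).
  move=> cF cG; rewrite sM (_ : _ - _ = (s F - F) * s G + F * (s G - G)); last by ring.
  by apply: psvanishD; [apply: psvanishMr | apply: psvanishMl].
have close_add F G : psvanish N (s F - F) -> psvanish N (s G - G) ->
    psvanish N (s (F + G) - (F + G)).
  by move=> cF cG; rewrite sD opprD addrACA; apply: psvanishD.
have close_poly (P : {poly C}) : psvanish N (s (psC P) - psC P).
  elim/poly_ind: P => [|P c IH].
    by rewrite rmorph0 endo0 subrr => k _.
  rewrite rmorphD rmorphM /= -kcE; apply: close_add; first exact: close_mul.
  by rewrite sC subrr => k _.
move=> F; have e := series_trunc (N := N) F.
have close_sum m : psvanish N (s (\sum_(d < m) psC (F d) * psX _ ^+ d) - \sum_(d < m) psC (F d) * psX _ ^+ d).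
  elim: m => [|m IH]; first by rewrite big_ord0 endo0 subrr => k _.
  rewrite big_ord_recr /=; apply: (close_add) => //; apply: (close_mul) => //.
  elim: m {IH} => [|m IH]; last by rewrite exprS; apply: (close_mul).
  by rewrite expr0 endo1 subrr => k _.
rewrite -[F](subrK (\sum_(d < N) psC (F d) * psX _ ^+ d)).
apply: close_add => //; apply: psvanishB => //; exact: sv.
Qed.

End EndoTheory.

Fact dt_is_zmod_morphism : zmod_morphism (@dt R).
Proof. by move=> F G; apply/funext => k; rewrite psB /dt derivB. Qed.
HB.instance Definition _ := GRing.isZmodMorphism.Build B B (@dt R) dt_is_zmod_morphism.

Lemma dtM F G : dt (F * G) = dt F * G + F * dt G.
Proof.
apply/funext => k; rewrite psD /dt !psM (raddf_sum (@deriv _)) -big_split.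
by apply: eq_bigr => i _; rewrite [LHS]derivM.
Qed.

Lemma psd_psC (P : {poly C}) : psd (psC P) = 0.
Proof. by apply/funext => k; rewrite /psd mul0rn. Qed.

Lemma psd_psX : psd (psX {poly C}) = 1.
Proof. by apply/funext => -[|k]; rewrite /psd /psX ps1 ?mul0rn. Qed.

Lemma dt_psX : dt (psX {poly C}) = 0.
Proof. by apply/funext => -[|[|k]]; rewrite /dt /psX ps0 ?derivC ?deriv0. Qed.

Lemma psd_delta (H : pseries B) :
  psd (delta H) = delta (fun i => psd (H i)) + delta (psd H).
Proof.
apply/funext => d; rewrite psD /psd /delta.
transitivity (\sum_(j < d.+2) H (d.+1 - j)%N j *+ j
              + \sum_(j < d.+2) H (d.+1 - j)%N j *+ (d.+1 - j)).
  rewrite -sumrMnl -big_split; apply: eq_bigr => -[j /= jd] _.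
  by rewrite -mulrnDr subnKC.
congr (_ + _).
  by rewrite big_ord_recl mulr0n add0r.
rewrite big_ord_recr /= subnn mulr0n addr0; apply: eq_bigr => -[j /= jd] _.
by rewrite psMn subSn.
Qed.

Lemma dt_delta (H : pseries B) : dt (delta H) = delta (fun i => dt (H i)).
Proof. by apply/funext => d; rewrite /dt /delta (raddf_sum (@deriv _)). Qed.

Section Flow.
Variables (q : {poly C}) (w : B).

(* The vector field q d/dt - w d/dx. *)
Definition vf F : B := psC q * dt F - w * psd F.

Fact vf_is_zmod_morphism : zmod_morphism vf.
Proof. by move=> F G; rewrite /vf (raddfB (@dt R)) (raddfB (@psd _)); ring. Qed.
HB.instance Definition _ := GRing.isZmodMorphism.Build B B vf vf_is_zmod_morphism.

Lemma vfB F G : vf (F - G) = vf F - vf G.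
Proof. exact: (raddfB vf). Qed.

Lemma vfM F G : vf (F * G) = vf F * G + F * vf G.
Proof. by rewrite /vf dtM psdM; exact: leibniz_identity. Qed.

Lemma vf_kc c : vf (kc c) = 0.
Proof.
rewrite /vf kcE psd_psC (_ : dt _ = 0) ?mulr0 ?subrr //.
by apply/funext => -[|k]; rewrite /dt ?derivC ?deriv0.
Qed.

Lemma vf_psX : vf (psX _) = - w.
Proof. by rewrite /vf dt_psX psd_psX mulr0 mulr1 sub0r. Qed.

Lemma vf_t : vf (psC 'X) = psC q.
Proof.
rewrite /vf psd_psC mulr0 subr0 (_ : dt _ = 1) ?mulr1 //.
by apply/funext => -[|k]; rewrite /dt ps1 ?derivX ?deriv0.
Qed.

Lemma vf_vanish N F : psvanish N.+1 F -> psvanish N (vf F).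
Proof.
move=> v; apply: psvanishB; apply: psvanishMl => k kN.
  by rewrite /dt v ?deriv0 // ltnW.
by rewrite /psd v ?mul0rn.
Qed.

Lemma kc_natK k F : kc (k.+1%:R^-1) * (F *+ k.+1) = F.
Proof.
rewrite kcE; apply/funext => i; rewrite psCM psMn mul_polyC -[F i *+ _]scaler_nat scalerA.
by rewrite mulVf ?scale1r // pnatr_eq0.
Qed.

(** Uniqueness for dY/dz = K Y, where K is [vf]. Additivity and multiplicativity of the flow follow,
    both sides solving the same equation. *)
Lemma flow_unique Y Z : Y 0%N = Z 0%N -> (forall i, psd Y i = vf (Y i)) ->
  (forall i, psd Z i = vf (Z i)) -> Y = Z.
Proof.
move=> e0 eY eZ; apply/funext; elim=> [|i IH] //.
by rewrite -[LHS](kc_natK i) -[RHS](kc_natK i) -/(psd Y i) -/(psd Z i) eY eZ IH.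
Qed.

(* exp (z vf), as a series in z. *)
Fixpoint flow F i : B :=
  if i is j.+1 then kc (j.+1%:R^-1) * vf (flow F j) else F.

Lemma psd_flow F i : psd (flow F) i = vf (flow F i).
Proof.
rewrite /psd /= -[RHS](kc_natK i); symmetry; rewrite -mulrnAr; done.
Qed.

Lemma flowD F G : flow (F + G) = (flow F : pseries B) + flow G.
Proof.
apply: flow_unique => // i; first exact: psd_flow.
rewrite psD (raddfD vf) (raddfD (@psd _)) psD; congr (_ + _); exact: psd_flow.
Qed.

Lemma flowM F G : flow (F * G) = (flow F : pseries B) * flow G.
Proof.
apply: flow_unique; [by rewrite psM0 | exact: psd_flow | move=> i].
rewrite psdM psD !psM (raddf_sum vf) -big_split; apply: eq_bigr => j _.
rewrite !psd_flow; exact: (esym (vfM _ _)).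
Qed.

Lemma flow_kc c : flow (kc c) = psC (kc c) :> pseries B.
Proof.
apply: flow_unique => // [i|[|i]]; first exact: psd_flow.
  by rewrite /psd mul0rn vf_kc.
by rewrite /psd mul0rn (raddf0 vf).
Qed.

Lemma flow_vf F i : flow (vf F) i = vf (flow F i).
Proof.
elim: i => [|i IH] //=; rewrite IH vfM vf_kc mul0r add0r; done.
Qed.

Variable h : B.

(** The flow for the time z h. Setting z = x by [delta] gives the flow for the time x h, whose
    factor x makes the series converge formally. *)
Definition flowh F : pseries B := fun i => h ^+ i * flow F i.
Definition flow_at F : B := delta (flowh F).

Lemma flow_at_trunc F N : psvanish N (flow_at F - \sum_(d < N) (psX _ * h) ^+ d * flow F d).
Proof.
have := delta_trunc (flowh F) (N := N); congr (psvanish _ (_ - _)).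
by apply: eq_bigr => d _; rewrite /flowh exprMn mulrA.
Qed.

Lemma flow_vanish N F i : psvanish N F -> psvanish (N - i) (flow F i).
Proof.
move=> v; elim: i => [|i IH]; first by rewrite subn0.
case e : (N - i.+1)%N => [|m]; first exact: psvanish0.
rewrite /=; apply: psvanishMl; apply: vf_vanish.
by apply: psvanishW IH; lia.
Qed.

Lemma endo_flow_at : endo flow_at.
Proof.
split=> [F G|F G|c|N F v]; rewrite /flow_at.
- have e : flowh (F + G) = flowh F + flowh G.
    by apply/funext => i; rewrite psD /flowh flowD psD mulrDr.
  exact: (etrans (congr1 (@delta _) e) (raddfD (@delta _) (flowh F) (flowh G))).
- have e : flowh (F * G) = flowh F * flowh G.
    apply/funext => i.
    rewrite /flowh flowM !psM mulr_sumr; apply: eq_bigr => -[j /= ji] _.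
    by rewrite -{1}(subnKC (ltnSE ji)) exprD; ring.
  exact: (etrans (congr1 (@delta _) e) (rmorphM (@delta _) (flowh F) (flowh G))).
- rewrite -[RHS]delta_psC; congr (delta _); apply/funext => i.
  by rewrite /flowh flow_kc; case: i => [|i] /=; rewrite ?expr0 ?mul1r ?mulr0.
- rewrite -[delta _](subrK (\sum_(d < N) (psX _ * h) ^+ d * flow F d)).
  apply: psvanishD; first exact: flow_at_trunc.
  apply: psvanish_sum => -[d /= dN] _.
  have -> : N = (d + (N - d))%N by lia.
  apply: psvanishM; last exact: flow_vanish.
  have x1 : psvanish 1 (psX {poly C} * h) by apply: psvanishMr; case.
  by have := psvanishX (k := d) x1; rewrite mul1n.
Qed.

(** For a constant time the flow commutes with its field; a variable time x h adds the derivative of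
    the time. The factor is the same for all F, so relations that are linear in the derivatives are
    preserved. *)
Lemma vf_flow_at F : vf (flow_at F) = (1 + vf (psX _ * h)) * flow_at (vf F).
Proof.
have vfX i : vf (h ^+ i.+1) = h ^+ i * vf h *+ i.+1.
  elim: i => [|i IH]; first by rewrite expr1 expr0 mul1r.
  by rewrite exprS vfM IH mulrnAr mulrA -exprS [RHS]mulrS mulrC.
have vf1 : vf 1 = 0 by rewrite -(rmorph1 kc) vf_kc.
have e1 : (fun i => vf (flowh F i)) =
    (psX _ * (psC (vf h) * flowh (vf F)) + flowh (vf F) : pseries B).
  apply/funext => i; rewrite psD psXM [in LHS]/flowh vfM -flow_vf addrC.
  rewrite [RHS]addrC -/(flowh (vf F) i); congr (_ + _).
  case: i => [|i]; first by rewrite expr0 vf1 mul0r.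
  rewrite psCM vfX mulrnAl -mulrnAr -/(psd (flow F : pseries B) i) psd_flow -flow_vf.
  by rewrite /flowh; ring.
have e2 : psd (flowh F) = psC h * flowh (vf F).
  apply/funext => i; rewrite psCM /psd /flowh -mulrnAr.
  by rewrite -/(psd (flow F : pseries B) i) psd_flow -flow_vf exprS mulrA.
have e3 : delta (fun i => vf (flowh F i))
    = psC q * delta (fun i => dt (flowh F i)) - w * delta (fun i => psd (flowh F i)).
  have e : (fun i => vf (flowh F i)) = psC (psC q) * (fun i => dt (flowh F i) : B)
      - psC w * (fun i => psd (flowh F i) : B) :> pseries B.
    by apply/funext => i; rewrite psB !psCM.
  by rewrite e deltaB (deltaM (psC _)) (deltaM (psC _)) (delta_psC (psC q)) (delta_psC w).
have E : vf (flow_at F) = delta (fun i => vf (flowh F i)) - w * delta (psd (flowh F)).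
  rewrite /vf /flow_at dt_delta psd_delta mulrDr opprD addrA -e3; done.
rewrite E e1 e2 deltaD (deltaM (psX _)) (deltaM (psC (vf h))) (deltaM (psC h))
  (delta_psC (vf h)) (delta_psC h) delta_psX.
rewrite -/(flow_at (vf F)) vfM vf_psX; ring.
Qed.

End Flow.
End TransverseFlow.
Lemma cancel_identity (A : comNzRingType) (q c g t : A) (k : nat) :
  c * (q * g + c * t) *+ k = q * (c * g *+ k) + c * (c * t *+ k).
Proof. by rewrite mulrDr mulrnDl !mulrnAr [c * (q * g)]mulrCA. Qed.

Lemma psvanishS (K : comNzRingType) N (F : pseries K) :
  psvanish N F -> F N = 0 -> psvanish N.+1 F.
Proof. by move=> v z d; rewrite ltnS leq_eqVlt => /orP [/eqP ->|/v]. Qed.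

Section Rigidity.
Variable R : realType.
Local Notation C := R[i].
Local Notation B := (pseries {poly C}).
Local Notation bX := (psX {poly C}).
Local Notation bT := (psC 'X : B).
Variables (n : nat) (q : {poly C}) (w w' : B).
Hypotheses (w0_monic : w 0%N \is monic) (sw0 : size (w 0%N) = n.+2).
Hypothesis w0q : coprimep (w 0%N) q.
Hypothesis dw : forall k, (size ((w' - w)%R k) <= n.+1)%N.
Local Notation K := (vf q w).

(** The last condition says that K is tangent to the image under s of q dx + w' dt, the lift of the
    second normal form. *)
Definition conjugates k (s : B -> B) := [/\ endo s, psvanish k (s bX - bX),
  psvanish k (s bT - bT) & s (psC q) * K (s bX) + s w' * K (s bT) = 0].

Lemma vf_lead k (F : B) : psvanish k.+1 F -> K F k = - (w 0%N * F k.+1 *+ k.+1).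
Proof.
move=> v; rewrite /vf psB psCM /dt v // deriv0 mulr0 sub0r -[k in LHS]add0n.
rewrite psM_lead ?[psd F k]/psd ?mulrnAr //; move=> j jk; rewrite /psd v ?mul0rn //.
Qed.

(** For s = id the conjugacy relation would read q (w' - w). As s is the identity modulo x^(k + 1)
    and K lowers the order by one, at order k the only corrections are K(s(x) - x) and K(s(t) - t),
    through the part - w d/dx of K. *)
Lemma conjugates_coef k s : conjugates k.+1 s ->
  q * (w' - w) k = q * (w 0%N * (s bX - bX) k.+1 *+ k.+1)
                 + w' 0%N * (w 0%N * (s bT - bT) k.+1 *+ k.+1).
Proof.
case=> es vX vT e.
have cq := endo_close es vX vT (psC q); have cw := endo_close es vX vT w'.
have kX := vf_vanish q w vX; have kT := vf_vanish q w vT.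
have eX := vf_lead vX; have eT := vf_lead vT.
have KX : K (s bX) = - w + K (s bX - bX) by rewrite vfB vf_psX; ring.
have KT : K (s bT) = psC q + K (s bT - bT) by rewrite vfB vf_t; ring.
move: kX kT eX eT KX KT; set eps := K (s bX - bX); set eps' := K (s bT - bT).
move=> kX kT eX eT KX KT.
have E : psC q * (w' - w) + psC q * eps + w' * eps'
    + ((s (psC q) - psC q) * (- w + eps) + (s w' - w') * (psC q + eps')) = 0.
  by rewrite -[RHS]e KX KT; ring.
have := congr1 (fun F : B => F k) E; rewrite !psD !psCM ps0.
rewrite [((s (psC q) - psC q) * _) k](psvanishMr _ cq) //.
rewrite [((s w' - w') * _) k](psvanishMr _ cw) //.
have -> : (w' * eps') k = w' 0%N * eps' k.
  by rewrite -{1}[k]add0n psM_lead.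
rewrite eX eT !addr0 !mulrN => /eqP; rewrite subr_eq0 subr_eq => /eqP ->.
by rewrite addrC.
Qed.

Lemma small_multiple (d : {poly C}) : w 0%N %| q * d -> (size d <= n.+1)%N -> d = 0.
Proof.
rewrite Gauss_dvdpr // => wd sd; apply/eqP; apply/negPn/negP => d0.
by have := dvdp_leq d0 wd; rewrite sw0 leqNgt ltnS sd.
Qed.

(** Tangency to a homothety makes the first coefficient of s(x) constant. Divisibility by w_0, of
    positive degree, then forces lam = 1; at this order no flow is used, since K(s(x) - x) would not
    be of higher order. *)
Lemma conjugates_first (s : B -> B) (lam : C) : conjugates 1 s ->
    (s bX) 1%N = lam%:P -> (w' - w) 0%N = 0 /\ conjugates 2 s.
Proof.
move=> cs sl; have := conjugates_coef cs; rewrite !mulr1n => e.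
have d0 : (w' - w) 0%N = 0.
  apply: small_multiple => //; rewrite e; apply: dvdp_add.
    by apply: dvdp_mull; apply: dvdp_mulr.
  by apply: dvdp_mull; apply: dvdp_mulr.
have w'0 : w' 0%N = w 0%N by apply/eqP; rewrite -subr_eq0 -psB d0.
rewrite d0 mulr0 w'0 in e.
have w0n0 := monic_neq0 w0_monic.
have e' : q * (s bX - bX) 1%N + w 0%N * (s bT - bT) 1%N = 0.
  apply: (mulfI w0n0); rewrite mulr0.
  exact: (etrans (cancel_identity _ _ _ _ 1) (esym e)).
have gE : (s bX - bX) 1%N = (lam - 1)%:P by rewrite psB sl /psX /= polyCB.
have g0 : (s bX - bX) 1%N = 0.
  apply: small_multiple; last by rewrite gE; apply: leq_trans (size_polyC_leq1 _) _.
  have -> : q * (s bX - bX) 1%N = w 0%N * - (s bT - bT) 1%N.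
    by rewrite mulrN; apply/eqP; rewrite -addr_eq0 e'.
  exact: dvdp_mulIl.
have t0 : (s bT - bT) 1%N = 0.
  by move: e'; rewrite g0 mulr0 add0r => /eqP; rewrite mulf_eq0 (negbTE w0n0) => /eqP.
split; first exact: d0.
case: cs => es vX vT eq; split; [exact: es | | | exact: eq].
- exact: (psvanishS vX g0).
- exact: (psvanishS vT t0).
Qed.

(* The flow of K for the time h = x^(k+2) g / w_0 removes the term of order
   k + 2 of s(x) - x. *)
Lemma conjugates_next k s : w' 0%N = w 0%N -> conjugates k.+2 s ->
  (w' - w) k.+1 = 0 /\ exists s', conjugates k.+3 s'.
Proof.
move=> w'0 cs; have e := conjugates_coef cs; rewrite w'0 in e.
have w0n0 := monic_neq0 w0_monic.
have k2 : k.+2%:R != 0 :> {poly C} by rewrite -polyC_natr polyC_eq0 pnatr_eq0.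
have dvd1 (p P : {poly C}) m : p %| P -> p %| P *+ m.
  by move=> pP; rewrite -mulr_natr dvdp_mulr.
have d0 : (w' - w) k.+1 = 0.
  apply: small_multiple => //; rewrite e; apply: dvdp_add.
    by apply: dvdp_mull; apply: (dvd1); apply: dvdp_mulIl.
  exact: dvdp_mulIl.
have reduce (s1 : B -> B) : conjugates k.+2 s1 ->
    q * (s1 bX - bX) k.+2 + w 0%N * (s1 bT - bT) k.+2 = 0.
  move=> /conjugates_coef; rewrite d0 mulr0 w'0 => /esym e1.
  apply: (mulfI w0n0); apply: (mulfI k2); rewrite !mulr0 mulr_natl.
  exact: (etrans (cancel_identity _ _ _ _ k.+2) e1).
split; first exact: d0.
have [es vX vT eq] := cs; have e1 := reduce s cs.
have : w 0%N %| (s bX - bX) k.+2.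
  rewrite -(Gauss_dvdpr _ w0q).
  have -> : q * (s bX - bX) k.+2 = w 0%N * - (s bT - bT) k.+2.
    by rewrite mulrN; apply/eqP; rewrite -addr_eq0 e1.
  exact: dvdp_mulIl.
move=> /dvdpP [g gE].
(* [g] is the quotient by w_0 of the term of order k + 2; the exponent is k + 1 because [flow_at]
   runs for the time x h. *)
pose h : B := psX _ ^+ k.+1 * psC g.
have ef := endo_flow_at q w h; have [fD fM fC fv] := ef.
have xhE : bX * h = bX ^+ k.+2 * psC g by rewrite /h mulrA -exprS.
have xh : psvanish k.+2 (bX * h) by rewrite xhE; exact: psX_psvanish.
have flow1 F : psvanish k.+3 (flow_at q w h F - (F + bX * h * K F)).
  have t1 := flow_at_trunc q w h F (N := k.+3).
  have E : \sum_(d < k.+3) (bX * h) ^+ d * flow q w F d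
      = F + bX * h * K F + \sum_(d < k.+1) (bX * h) ^+ d.+2 * flow q w F d.+2.
    rewrite 2!big_ord_recl addrA; congr (_ + _ + _).
    - by rewrite expr0 mul1r.
    - by rewrite [nat_of_ord _]/= expr1 [flow _ _ _ _]/= invr1 rmorph1 mul1r.
  rewrite E in t1.
  have v : psvanish k.+3 (\sum_(d < k.+1) (bX * h) ^+ d.+2 * flow q w F d.+2).
    apply: psvanish_sum => i _; apply: psvanishMr.
    by apply: psvanishW (psvanishX (k := i.+2) xh); nia.
  have := psvanishD t1 v; congr (psvanish _ _); ring.
have flow0 F : psvanish k.+2 (flow_at q w h F - F).
  rewrite (_ : _ - F = flow_at q w h F - (F + bX * h * K F) + bX * h * K F); last by ring.
  apply: psvanishD; first exact: (psvanishW (leqnSn _) (flow1 F)).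
  exact: psvanishMr.
have cs' : conjugates k.+2 (flow_at q w h \o s).
  split=> /=.
  - exact: endo_comp.
  - have := psvanishD (flow0 (s bX)) vX; congr (psvanish _ _); ring.
  - have := psvanishD (flow0 (s bT)) vT; congr (psvanish _ _); ring.
  (* Both terms acquire the same factor u, and what remains is the flow applied to the relation
     satisfied by s. *)
  - rewrite !vf_flow_at; set u := 1 + K (bX * h).
    rewrite [_ * (u * _)]mulrCA [X in _ + X]mulrCA -mulrDr -!fM -fD eq (endo0 ef).
    exact: mulr0.
have g0 : ((flow_at q w h \o s) bX - bX) k.+2 = 0.
  (* Modulo x^(k + 3) the new s(x) - x is the old one plus x h K(x), with K(x) = - w; the leading
     term x^(k + 2) g w_0 cancels. The remaining x h K(s(x) - x) has order at least 2 k + 3. *)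
  have v := flow1 (s bX - bX); have v2 := flow1 bX.
  have v3 : psvanish k.+3 (bX * h * K (s bX - bX)).
    apply: psvanishW (psvanishM xh (vf_vanish q w vX)); lia.
  have v4 : psvanish k.+3 (s bX - bX - bX * h * w).
    apply: psvanishS; first by apply: psvanishB => //; apply: psvanishMr.
    rewrite psB gE -{1}[k.+2]addn0 (psM_lead xh (psvanish0 w)) xhE psXnM leqnn subnn.
    by rewrite mulrC subrr.
  have := psvanishD (psvanishD v v2) (psvanishD v3 v4).
  rewrite vf_psX (endoB ef) => /(_ k.+2 (ltnSn _)) <-; congr (_ k.+2); rewrite /comp.
  rewrite mulrN; ring.
exists (flow_at q w h \o s); case: (cs') => es' vX' vT' eq'; split; [exact: es' | | | exact: eq'].
  exact: (psvanishS vX' g0).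
have := reduce _ cs'; rewrite g0 mulr0 add0r => /eqP; rewrite mulf_eq0 (negbTE w0n0) => /eqP t0.
exact: (psvanishS vT' t0).
Qed.

Lemma rigidity s (lam : C) : conjugates 1 s -> (s bX) 1%N = lam%:P -> w' = w.
Proof.
move=> cs sl; have [d0 cs2] := conjugates_first cs sl.
have w'0 : w' 0%N = w 0%N by apply/eqP; rewrite -subr_eq0 -psB d0.
have ex k : exists s', conjugates k.+2 s'.
  by elim: k => [|k [s' /(conjugates_next w'0) [_ ?]]] //; exists s.
apply/funext => -[|k] //; apply/eqP; rewrite -subr_eq0 -psB.
by have [s' /(conjugates_next w'0) [-> _]] := ex k.
Qed.

End Rigidity.
(** The field W (x d/dx + y d/dy) - Q d/dy is tangent to [nform W Q], hence annihilated by any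
    pulled-back form proportional to it. *)
Lemma contraction_identity (A : comNzRingType) (P S a b ax ay bx by_ x y W Q V : A) :
  (P - S * b) * ax + S * a * bx = V * (Q - W * y) ->
  (P - S * b) * ay + S * a * by_ = V * (W * x) ->
  (P - S * b) * (W * (x * ax + y * ay) - Q * ay)
    + S * a * (W * (x * bx + y * by_) - Q * by_) = 0.
Proof.
move=> e1 e2.
have -> : (P - S * b) * (W * (x * ax + y * ay) - Q * ay)
    + S * a * (W * (x * bx + y * by_) - Q * by_)
  = ((P - S * b) * ax + S * a * bx) * (W * x)
    + ((P - S * b) * ay + S * a * by_) * (W * y - Q) by ring.
rewrite e1 e2; ring.
Qed.

(** The passage to the chart rests on X d(T X) - T X dX = X^2 dT. [LX] and [LTX] are derivatives
    along the field of the plane, [vX], [vTX] and [vT] along K, and [z] is x. *)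
Lemma lifted_contraction_identity (A : comNzRingType) (z P S X T LX LTX vX vTX vT xn : A) :
  (P - S * (T * X)) * LX + S * X * LTX = 0 ->
  z * LX = - (xn * vX) -> z * LTX = - (xn * vTX) -> vTX = vT * X + T * vX ->
  xn * (P * vX + S * X * X * vT) = 0.
Proof.
move=> e e1 e2 e3.
have -> : xn * (P * vX + S * X * X * vT) = - (z * ((P - S * (T * X)) * LX + S * X * LTX)).
  have -> : z * ((P - S * (T * X)) * LX + S * X * LTX)
    = (P - S * (T * X)) * (z * LX) + S * X * (z * LTX) by ring.
  rewrite e1 e2 e3; ring.
by rewrite e mulr0 oppr0.
Qed.

Lemma radial_factor_identity (A : comNzRingType) (x u P S a b : A) m :
  x ^+ m.+2 * ((x * u) ^+ m.+2 * P * a + (x * u) ^+ m * S * (x * u) * (x * u) * b)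
  = x ^+ m.+2 * (x ^+ m.+2 * (u ^+ m.+2 * (P * a + S * b))).
Proof. rewrite !exprMn !exprS; ring. Qed.

Lemma psXn_eq0 (K : comNzRingType) k (F : pseries K) : psX K ^+ k * F = 0 -> F = 0.
Proof. by move=> e; apply: (@psXn_inj _ k); rewrite mulr0. Qed.

Lemma unit_eq0 (A : comNzRingType) (u v f : A) : u * v = 1 -> u * f = 0 -> f = 0.
Proof. by move=> uv uf; rewrite -[f]mul1r -uv mulrAC uf mul0r. Qed.

(** * Lifting a conjugacy of normal forms to the chart *)

Section ConjugateForms.
Variable R : realType.
Local Notation C := R[i].
Local Notation B := (pseries {poly C}).
Local Notation bl := (@bl R).
Local Notation kc := (@kc R).
Local Notation bX := (psX {poly C}).
Local Notation bT := (psC 'X : B).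
Implicit Types (f W Q V : series2 R) (F G : B) (Psi : germmap R).

Section Substitution.
Variables X1 T : B.

(** The substitution x -> x X1, t -> T; [delta] supplies the powers of x. *)
Definition bsubst F : B := delta (fun i => (map_poly kc (F i)).[T] * X1 ^+ i).

Lemma endo_bsubst : endo bsubst.
Proof.
split=> [F G|F G|c|N F v]; rewrite /bsubst.
- rewrite -deltaD; congr (delta _); apply/funext => i.
  by rewrite psD raddfD hornerD mulrDl.
- rewrite -deltaM; congr (delta _); apply/funext => i.
  rewrite !psM (rmorph_sum (map_poly kc)) horner_sum mulr_suml; apply: eq_bigr => -[j /= ji] _.
  have -> : X1 ^+ i = X1 ^+ j * X1 ^+ (i - j) by rewrite -exprD subnKC.
  by rewrite rmorphM hornerM mulrACA.
- rewrite -[RHS]delta_psC; congr (delta _); apply/funext => i.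
  rewrite kcE; case: i => [|i] /=; last by rewrite raddf0 horner0 mul0r.
  by rewrite map_polyC hornerC expr0 mulr1 /= kcE.
- rewrite -[delta _](subrK (\sum_(d < N) bX ^+ d * ((map_poly kc (F d)).[T] * X1 ^+ d))).
  apply: psvanishD; first exact: delta_trunc.
  by rewrite big1 => [j _|d _]; rewrite ?ps0 // v // raddf0 horner0 mul0r mulr0.
Qed.

Lemma bsubst_psC (P : {poly C}) : bsubst (psC P) = (map_poly kc P).[T].
Proof.
rewrite /bsubst -[RHS]delta_psC; congr (delta _); apply/funext => -[|i] /=.
  by rewrite expr0 mulr1.
by rewrite raddf0 horner0 mul0r.
Qed.

Lemma bsubst_psX : bsubst bX = bX * X1.
Proof.
rewrite /bsubst -[X1 in RHS]delta_psC -[bX in RHS]delta_psX -deltaM; congr (delta _).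
apply/funext => i; rewrite psXM /psX; case: i => [|[|i]] /=.
- by rewrite raddf0 horner0 mul0r.
- by rewrite rmorph1 hornerC mul1r expr1.
- by rewrite raddf0 horner0 mul0r.
Qed.

Lemma bsubst_bl Psi f : germ Psi -> bl Psi.1 = bX * X1 -> bl Psi.2 = T * bl Psi.1 ->
  bsubst (bl f) = bl (pscomp f Psi.1 Psi.2).
Proof.
case=> g1 g2 e1 e2; apply: eq_psvanish => N.
have h1 := delta_trunc (fun i => (map_poly kc (bl f i)).[T] * X1 ^+ i) (N := N).
have h2 := bl_pscomp (N := N) f g1 g2 e2.
have e : \sum_(d < N) (map_poly kc (bl f d)).[T] * bl Psi.1 ^+ d
    = \sum_(d < N) bX ^+ d * ((map_poly kc (bl f d)).[T] * X1 ^+ d).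
  by apply: eq_bigr => d _; rewrite e1 exprMn mulrCA.
rewrite e in h2; have := psvanishB h1 h2; congr (psvanish _ _).
rewrite /bsubst; ring.
Qed.

End Substitution.

Lemma bl_tangent_homothety Psi lam : germ Psi -> lam != 0 ->
    Psi.1 1%N 0%N = lam -> Psi.1 0%N 1%N = 0 ->
    Psi.2 1%N 0%N = 0 -> Psi.2 0%N 1%N = lam ->
  exists X1 X1' T : B, [/\ bl Psi.1 = bX * X1, bl Psi.2 = T * bl Psi.1,
    X1 * X1' = 1, X1 0%N = lam%:P & T 0%N = 'X].
Proof.
move=> [g1 g2] l0 e1 e2 e3 e4.
have [X1 X1E] := psvanishXn ((order_ge_bl _ _).1 g1).
have [Y1 Y1E] := psvanishXn ((order_ge_bl _ _).1 g2).
rewrite expr1 in X1E Y1E.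
have X10 : X1 0%N = lam%:P.
  have -> : X1 0%N = bl Psi.1 1%N by rewrite X1E psXM.
  apply/polyP => -[|[|j]]; rewrite coef_bl coefC //=; exact: e2.
have Y10 : Y1 0%N = lam *: 'X.
  have -> : Y1 0%N = bl Psi.2 1%N by rewrite Y1E psXM.
  by apply/polyP => -[|[|j]]; rewrite coef_bl coefZ coefX //= ?mulr0 ?mulr1.
have [X1' X1X1'] : exists g, X1 * g = 1.
  by apply: (@ps_inv _ (lam^-1)%:P); rewrite X10 -polyCM mulVf.
exists X1, X1', (Y1 * X1'); split=> //.
  rewrite X1E Y1E; transitivity (bX * (Y1 * (X1 * X1'))); last by ring.
  by rewrite X1X1' mulr1.
have := congr1 (fun F : B => F 0%N) X1X1'; rewrite !psM0 X10 Y10 ps1 /= => e.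
by rewrite -mul_polyC mulrAC e mul1r.
Qed.

(** The Euler field lifts to x d/dx and d/dy to x^-1 d/dt; the factor x on the left clears the
    denominator. *)
Lemma bl_contract_dual n w q W Q f :
    bl W = bX ^+ n * w -> bl Q = bX ^+ n.+2 * psC q ->
  bX * bl (W * euler f - Q * psdy f) = - (bX ^+ n.+2 * vf q w (bl f)).
Proof.
move=> eW eQ; rewrite blB !blM eW eQ /vf.
have -> : bl (euler f) = bX * psd (bl f).
  by apply/funext => -[|k]; rewrite psXM bl_euler.
transitivity (bX ^+ n * w * (bX * (bX * psd (bl f))) - bX ^+ n.+2 * psC q * (bX * bl (psdy f))).
  ring.
rewrite -dt_bl !exprS; ring.
Qed.

Lemma weierstrass_leading n W :
    (forall i j, (n <= j)%N -> W i j = ((i == 0) && (j == n))%:R) ->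
  bl W n \is monic /\ size (bl W n) = n.+1.
Proof.
move=> wW; have top : (bl W n)`_n = 1 by rewrite coef_bl leqnn subnn wW // eqxx.
have sz : size (bl W n) = n.+1.
  apply/eqP; rewrite eqn_leq size_bl /= ltnNge.
  by apply/negP => /leq_sizeP/(_ n (leqnn _)) /eqP; rewrite top oner_eq0.
by split=> //; rewrite monicE /lead_coef sz /= top.
Qed.

Lemma nform_rigidity n W W' Q V Psi lam :
    weierstrass_poly n.+1 W -> order_ge W n.+1 ->
    weierstrass_poly n.+1 W' -> order_ge W' n.+1 ->
    homogeneous n.+3 Q -> coprimep (bl W n.+1) (bl Q n.+3) ->
    germ Psi -> lam != 0 ->
    Psi.1 1%N 0%N = lam -> Psi.1 0%N 1%N = 0 ->
    Psi.2 1%N 0%N = 0 -> Psi.2 0%N 1%N = lam ->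
    (pullback Psi (nform W' Q)).1 = V * (nform W Q).1 ->
    (pullback Psi (nform W' Q)).2 = V * (nform W Q).2 ->
  W' = W.
Proof.
move=> [_ wW] oW [_ wW'] oW' hQ cop gPsi l0 e1 e2 e3 e4 p1 p2.
have [X1 [X1' [T [XE TE XX X10 T0]]]] := bl_tangent_homothety gPsi l0 e1 e2 e3 e4.
have [g1 g2] := gPsi.
have blw f : order_ge f n.+1 -> bl f = bX ^+ n.+1 * (fun k => bl f (n.+1 + k)%N : {poly C}).
  move=> of_; apply/funext => k; rewrite psXnM; case: (leqP n.+1 k) => nk.
    by rewrite subnKC.
  by have /order_ge_bl := of_; apply.
have := blw W oW; have := blw W' oW'.
set w' : B := fun k => _; set w : B := fun k => _ => eW' eW.
have eQ := bl_homogeneous hQ; set q := bl Q n.+3 in eQ cop.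
have es := endo_bsubst X1 T; have [sD sM sC sv] := es.
have sX := bsubst_psX X1 T; rewrite -XE in sX.
have sT : bsubst X1 T bT = T by rewrite bsubst_psC map_polyX hornerX.
have sQ : bl (pscomp Q Psi.1 Psi.2) = bl Psi.1 ^+ n.+3 * bsubst X1 T (psC q).
  by rewrite -(bsubst_bl _ gPsi XE TE) eQ sM (endoX es) sX.
have sW : bl (pscomp W' Psi.1 Psi.2) = bl Psi.1 ^+ n.+1 * bsubst X1 T w'.
  by rewrite -(bsubst_bl _ gPsi XE TE) eW' sM (endoX es) sX.
have E : bsubst X1 T (psC q) * vf q w (bl Psi.1) + bsubst X1 T w' * vf q w T = 0.
  move: p1 p2; rewrite /pullback /nform; rewrite ![(_, _).1]/= ![(_, _).2]/=.
  rewrite pscompB !(pscompM _ _ g1 g2) (pscomp_Xs g1 g2) (pscomp_Ys g1 g2) => p1 p2.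
  have := contraction_identity p1 p2; rewrite -!eulerE => /(congr1 bl).
  rewrite blD (blM _ (_ - _)) (blM _ (W * _ - _)) blB !(blM (pscomp W' _ _)) rmorph0 TE => p3.
  have dX := bl_contract_dual Psi.1 eW eQ; have dY := bl_contract_dual Psi.2 eW eQ.
  have vTX : vf q w (bl Psi.2) = vf q w T * bl Psi.1 + T * vf q w (bl Psi.1).
    by rewrite TE vfM.
  have := lifted_contraction_identity p3 dX dY vTX.
  rewrite sQ sW XE radial_factor_identity.
  move=> /psXn_eq0/psXn_eq0 e5.
  have u1 : X1 ^+ n.+3 * X1' ^+ n.+3 = 1 by rewrite -exprMn XX expr1n.
  exact: (unit_eq0 u1 e5).
have [m0 s0] := weierstrass_leading wW.
have w0E : w 0%N = bl W n.+1 by rewrite /w addn0.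
have dw k : (size ((w' - w)%R k) <= n.+1)%N.
  apply/leq_sizeP => j nj; rewrite psB coefB /w /w' !coef_bl.
  by case: ifP => _; rewrite ?subrr // wW' ?wW ?subrr.
have cs : conjugates q w w' 1 (bsubst X1 T).
  split; [exact: es | | | by rewrite sX sT].
  - by case=> // _; rewrite sX XE psB psXM /psX /= subrr.
  - by case=> // _; rewrite sT psB T0 subrr.
apply: bl_inj; rewrite eW eW'.
rewrite -w0E in m0 s0 cop.
have lamE : bsubst X1 T bX 1%N = lam%:P by rewrite sX XE psXM.
by rewrite (rigidity m0 s0 cop dw cs lamE).
Qed.

End ConjugateForms.

(** * Uniqueness *)

Lemma divf_option_eq (F : fieldType) (x y x' y' : F) :
    (if x == 0 then None else Some (y / x)) = (if x' == 0 then None else Some (y' / x')) ->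
  (x == 0) = (x' == 0) /\ x * y' = x' * y.
Proof.
case: eqVneq => [->|x0]; case: eqVneq => [->|x'0] //; first by rewrite !mul0r.
case=> e; split=> //; have := congr1 (fun z => z * x * x') e.
by rewrite divfK // mulrAC divfK // [y * _]mulrC [y' * _]mulrC.
Qed.

(** A projectivity determines its matrix up to a scalar. The values at infinity, 0 and 1 give three
    bilinear relations, and the equality of the poles gives the fourth, a' b = a b'. *)
Lemma proportional_coordinates (F : fieldType) (a b c d a' b' c' d' : F) :
    a * d - b * c != 0 -> a' * d' - b' * c' != 0 ->
    (if b == 0 then None else Some (d / b)) = (if b' == 0 then None else Some (d' / b')) ->
    (forall t, (if a + b * t == 0 then None else Some ((c + d * t) / (a + b * t)))
             = (if a' + b' * t == 0 then None else Some ((c' + d' * t) / (a' + b' * t)))) ->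
  exists2 k, k != 0 & [/\ a' = k * a, b' = k * b, c' = k * c & d' = k * d].
Proof.
move=> j j' /divf_option_eq [zb eb] et.
have [_ e0] := divf_option_eq (et 0); rewrite !mulr0 !addr0 in e0.
have [_ e1] := divf_option_eq (et 1); rewrite !mulr1 in e1.
have e2 : a * d' + b * c' = a' * d + b' * c.
  apply/eqP; rewrite -subr_eq0.
  have -> : a * d' + b * c' - (a' * d + b' * c)
    = ((a + b) * (c' + d') - (a' + b') * (c + d)) - (a * c' - a' * c) - (b * d' - b' * d).
    by ring.
  by rewrite e0 e1 eb !subrr.
have ab : a' * b = a * b'.
  have [b0|b0] := eqVneq b 0.
    by move: zb; rewrite b0 eqxx => /esym/eqP ->; rewrite !mulr0.
  (* The pole of the first coordinate must be the pole of the second. *)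
  have [+ _] := divf_option_eq (et (- a / b)).
  rewrite mulrC divfK // subrr eqxx => /esym/eqP e.
  apply/eqP; rewrite -subr_eq0; have -> : a' * b - a * b' = b * (a' + b' * (- a / b)).
    by field.
  by rewrite e mulr0.
have [k [ka kb]] : exists k, a' = k * a /\ b' = k * b.
  have [a0|a0] := eqVneq a 0; last first.
    by exists (a' / a); split; [rewrite divfK | rewrite mulrAC ab mulrAC divff ?mul1r].
  have b0 : b != 0 by apply: contra_neq j => b0; rewrite a0 b0 !mul0r subrr.
  exists (b' / b); rewrite divfK //; split=> //.
  by apply: (mulIf b0); rewrite ab a0 !(mulr0, mul0r).
have k0 : k != 0.
  by apply: contra_neq j' => k0; rewrite ka kb k0 !mul0r subrr.
exists k => //; move: e0 eb e2; rewrite ka kb => e0 eb e2.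
have [ec ed] : c' - k * c = 0 /\ d' - k * d = 0.
  have p0 : a * (c' - k * c) = 0 by rewrite mulrBr e0; ring.
  have r0 : b * (d' - k * d) = 0 by rewrite mulrBr eb; ring.
  have pr : a * (d' - k * d) + b * (c' - k * c) = 0.
    have -> : a * (d' - k * d) + b * (c' - k * c) = a * d' + b * c' - (k * a * d + k * b * c) by ring.
    by rewrite e2 subrr.
  have [a0|a0] := eqVneq a 0.
    have b0 : b != 0 by apply: contra_neq j => b0; rewrite a0 b0 !mul0r subrr.
    move: r0 pr => /eqP; rewrite mulf_eq0 (negbTE b0) => /eqP r0.
    by rewrite r0 mulr0 add0r => /eqP; rewrite mulf_eq0 (negbTE b0) => /eqP ->.
  move: p0 pr => /eqP; rewrite mulf_eq0 (negbTE a0) => /eqP p0.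
  by rewrite p0 mulr0 addr0 => /eqP; rewrite mulf_eq0 (negbTE a0) => /eqP ->.
by split=> //; apply/eqP; rewrite -subr_eq0 ?ec ?ed.
Qed.

Lemma mup_proportional (F : closedFieldType) (P P' : {poly F}) : P != 0 -> P' != 0 ->
  (forall t, mup t P = mup t P') -> exists2 c, c != 0 & P = c *: P'.
Proof.
move=> P0 P'0 e.
have [r rE] := closed_field_poly_normal P; have [r' r'E] := closed_field_poly_normal P'.
have l0 : lead_coef P != 0 by rewrite lead_coef_eq0.
have l'0 : lead_coef P' != 0 by rewrite lead_coef_eq0.
have muE c t (s : seq F) : c != 0 -> mup t (c *: \prod_(z <- s) ('X - z%:P)) = count_mem t s.
  by move=> c0; rewrite -mul_polyC mupMr ?rootC // mu_prod_XsubC.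
have rr' : perm_eq r r'.
  apply/allP => t _ /=; rewrite -(muE _ t r l0) -rE e r'E.
  by rewrite -r'E -(muE _ t r' l'0) -r'E.
exists (lead_coef P / lead_coef P'); first by rewrite mulf_neq0 ?invr_eq0.
rewrite {}rE (perm_big _ rr') /=; move: l'0 r'E; move: (lead_coef P') => l' l'0 ->.
by rewrite lead_coefZ lead_coef_prod_XsubC mulr1 scalerA divfK.
Qed.

Section Uniqueness.
Variable R : realType.
Local Notation C := R[i].
Local Notation bl := (@bl R).
Implicit Types (f g u V W Q : series2 R) (F G H Phi Psi : germmap R) (w : oneform R)
  (D : divisor R).

Lemma zero_divisor_proportional k f g : dehom k f != 0 -> dehom k g != 0 ->
    (forall e, zero_divisor k f e = zero_divisor k g e) ->
  exists2 c, c != 0 & forall a b, hev k f a b = c * hev k g a b.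
Proof.
move=> f0 g0 e; have [c c0 cE] := mup_proportional f0 g0 (fun t => e (Some t)).
exists c => // a b; rewrite /hev mulr_sumr; apply: eq_bigr => -[j /= jk] _.
have := congr1 (fun P : {poly C} => P`_j) cE.
by rewrite coefZ !coef_poly jk => ->; rewrite -!mulrA.
Qed.

Lemma hev_XsM k Q a b : order_ge Q k -> hev k.+1 (Xs * Q) a b = a * hev k Q a b.
Proof.
move=> oQ; rewrite -add1n (hevM _ _ (order_Xs R) oQ) hev1.
by rewrite /Xs /= mul1r mul0r addr0.
Qed.

Lemma hev_XsQ_lin n Q F a b : order_ge Q n.+2 ->
  hev n.+3 (pscomp (Xs * Q) (linear_part F.1) (linear_part F.2)) a b
  = hev 1 F.1 a b * hev n.+2 Q (hev 1 F.1 a b) (hev 1 F.2 a b).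
Proof.
move=> oQ; rewrite (hev_pscomp _ _ (order_linear_part _) (order_linear_part _) (order_XsM oQ)).
by rewrite !hev_linear_part hev_XsM.
Qed.

Lemma dehom_lin_neq0 n Q F : biholomorphism F -> order_ge Q n.+2 -> bl Q n.+2 != 0 ->
  dehom n.+3 (pscomp (Xs * Q) (linear_part F.1) (linear_part F.2)) != 0.
Proof.
move=> bF oQ Q0; have [G [_ gG FG _]] := germ_inverse bF.
have [gF _ _] := (biholomorphismP F).1 bF.
apply: contra_neq Q0 => e; apply: horner_inj => t; rewrite horner_bl horner0.
have [e1 e2] := hev_gcomp_id 1 t gF gG FG.
have z a b : hev n.+3 (pscomp (Xs * Q) (linear_part F.1) (linear_part F.2)) a b = 0.
  rewrite /hev big1 // => -[j /= jk] _.
  by have := congr1 (fun P : {poly C} => P`_j) e; rewrite coef_poly jk coef0 => ->; rewrite !mul0r.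
by have := z (hev 1 G.1 1 t) (hev 1 G.2 1 t); rewrite (hev_XsQ_lin F _ _ oQ) e1 e2 mul1r.
Qed.

Lemma monic_dehom_neq0 n Q : dehom n Q \is monic -> bl Q n != 0.
Proof. exact: monic_neq0. Qed.

Lemma pullback_eq_mul F w w' : same_foliation (pullback F w) w' ->
  exists2 U : series2 R, U 0%N 0%N != 0 & pullback F w = (U * w'.1, U * w'.2).
Proof.
by case=> U [_ U0 e1 e2]; exists U => //; rewrite -e1 -e2; case: (pullback F w).
Qed.

Lemma pullback_unit F w w' w'' U V : germ F -> w = (V * w'.1, V * w'.2) ->
    pullback F w' = (U * w''.1, U * w''.2) ->
  pullback F w = (pscomp V F.1 F.2 * U * w''.1, pscomp V F.1 F.2 * U * w''.2).
Proof.
move=> gF -> e; rewrite (pullback_mul _ _ _ gF).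
have -> : (w'.1, w'.2) = w' by case: (w').
by rewrite e -!(mulrA (pscomp V F.1 F.2) U).
Qed.

(** In the direction of a common root the lowest component of the normal form and the tangency both
    vanish, which would be a singular point on E. *)
Lemma leading_coprime n w D Phi W Q : Dhclass n w -> divh w D ->
  normal_form n w D Phi W Q -> coprimep (bl W n) (bl Q n.+2).
Proof.
case=> [[_ mw rw] _] [X [rX [_ _] tX]].
have [of0 bf0 _ ncd Dz] := tangency_data mw rw rX tX.
have [o1 o2 _] := mw.
case=> [bP /pullback_eq_mul [U U0 PE] [_ [oW _]] [hQ mQ] DE].
have [G [_ gG PG _]] := germ_inverse bP.
have [gP _ _] := (biholomorphismP Phi).1 bP.
have oQ := homogeneous_order hQ.
have [c c0 cE] : exists2 c, c != 0 & forall a b, hev n.+3 (contract w X) a b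
    = c * hev n.+3 (pscomp (Xs * Q) (linear_part Phi.1) (linear_part Phi.2)) a b.
  apply: zero_divisor_proportional => //.
    exact: (dehom_lin_neq0 bP oQ (monic_dehom_neq0 mQ)).
  by move=> e; rewrite -Dz DE.
apply: Pdiv.ClosedField.root_coprimep => t /rootP Wt; apply/eqP => Qt.
rewrite !horner_bl in Wt Qt.
have [e1 e2] := hev_gcomp_id 1 t gP gG PG.
pose a := hev 1 G.1 1 t; pose b := hev 1 G.2 1 t.
have oWY : order_ge (W * Ys) n.+1 by rewrite -addn1; apply: order_geM => //; apply: order_Ys.
have oWX : order_ge (W * Xs) n.+1 by rewrite -addn1; apply: order_geM => //; apply: order_Xs.
have ob1 : order_ge (Q - W * Ys) n.+1.
  by move=> i j ij; rewrite psb2 oWY // oQ ?subrr // ltnW.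
have [p1 p2] := @hev_pullback _ n.+1 (nform W Q) Phi a b gP ob1 oWX.
have z1 : hev n.+1 (nform W Q).1 1 t = 0.
  have -> : hev n.+1 (Q - W * Ys) 1 t = hev n.+1 (- W * Ys) 1 t.
    apply: hev_eqo => i j ij; rewrite psb2 oQ // mulNr sub0r; done.
  rewrite -addn1 (@hevM _ n 1) //; [|by move=> i j ij; rewrite psN psN oW ?oppr0|exact: order_Ys].
  have -> : hev n (- W) 1 t = - hev n W 1 t.
    by rewrite /hev -sumrN; apply: eq_bigr => j _; rewrite psN psN !mulNr.
  by rewrite Wt oppr0 mul0r.
have z2 : hev n.+1 (nform W Q).2 1 t = 0.
  by rewrite -addn1 (@hevM _ n 1) ?Wt ?mul0r //; exact: order_Xs.
rewrite e1 e2 z1 z2 !mul0r addr0 PE in p1 p2.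
have w0 g : order_ge g n.+1 -> hev n.+1 (U * g) a b = 0 -> hev n.+1 g a b = 0.
  move=> og; rewrite (@hevM _ 0 n.+1) // hev0 => /eqP.
  by rewrite mulf_eq0 (negbTE U0) => /eqP.
apply: (ncd a b); [| exact: w0 | exact: w0 |].
  rewrite -negb_and; apply/negP => /andP [/eqP a0 /eqP b0].
  by move: e1; rewrite -/a -/b a0 b0 hev1 !mulr0 addr0 => /esym/eqP; rewrite oner_eq0.
by rewrite cE (hev_XsQ_lin Phi _ _ oQ) e1 e2 Qt !mulr0.
Qed.

Lemma homogeneous_eq m Q Q' : homogeneous m Q -> homogeneous m Q' -> bl Q m = bl Q' m ->
  Q = Q'.
Proof.
by move=> h h' e; apply: bl_inj; rewrite (bl_homogeneous h) (bl_homogeneous h') e.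
Qed.

(** The divisor determines x Q up to a constant, to which the ratio k of the linear parts
    contributes k^(n + 3); monicity fixes the constant. *)
Lemma leading_unique n D Phi Phi' Q Q' k : biholomorphism Phi -> biholomorphism Phi' ->
    homogeneous n.+2 Q -> homogeneous n.+2 Q' ->
    dehom n.+2 Q \is monic -> dehom n.+2 Q' \is monic -> k != 0 ->
    (forall a b, hev 1 Phi'.1 a b = k * hev 1 Phi.1 a b) ->
    (forall a b, hev 1 Phi'.2 a b = k * hev 1 Phi.2 a b) ->
    (forall e, D e = zero_divisor n.+3
       (pscomp (Xs * Q) (linear_part Phi.1) (linear_part Phi.2)) e) ->
    (forall e, D e = zero_divisor n.+3
       (pscomp (Xs * Q') (linear_part Phi'.1) (linear_part Phi'.2)) e) ->
  Q = Q'.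
Proof.
move=> bP bP' hQ hQ' mQ mQ' k0 k1 k2 DQ DQ'.
have oQ := homogeneous_order hQ; have oQ' := homogeneous_order hQ'.
have [c c0 cE] := zero_divisor_proportional
  (dehom_lin_neq0 bP oQ (monic_dehom_neq0 mQ)) (dehom_lin_neq0 bP' oQ' (monic_dehom_neq0 mQ'))
  (fun e => etrans (esym (DQ e)) (DQ' e)).
have [G [_ gG PG _]] := germ_inverse bP.
have [gP _ _] := (biholomorphismP Phi).1 bP.
have E : bl Q n.+2 = (c * k ^+ n.+3) *: bl Q' n.+2.
  apply: horner_inj => t; rewrite hornerZ !horner_bl.
  have [e1 e2] := hev_gcomp_id 1 t gP gG PG.
  pose a := hev 1 G.1 1 t; pose b := hev 1 G.2 1 t.
  have L := hev_XsQ_lin Phi a b oQ; have L' := hev_XsQ_lin Phi' a b oQ'.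
  have := etrans (esym L) (etrans (cE a b) (congr1 ( *%R c) L')).
  rewrite (k1 a b) (k2 a b) e1 e2 hevZ mul1r mulr1 => ->.
  by rewrite [k ^+ n.+3]exprS !mulrA.
apply: (homogeneous_eq hQ hQ'); rewrite E.
have := congr1 lead_coef E; rewrite lead_coefZ.
rewrite -[lead_coef (bl Q n.+2)]/(lead_coef (dehom n.+2 Q)) (monicP mQ).
rewrite -[lead_coef (bl Q' n.+2)]/(lead_coef (dehom n.+2 Q')) (monicP mQ') mulr1 => <-.
by rewrite scale1r.
Qed.

Lemma affine_coordinate_hev Phi Phi' : biholomorphism Phi -> biholomorphism Phi' ->
    (forall e, affine_coordinate Phi e = affine_coordinate Phi' e) ->
  exists2 k, k != 0 & (forall a b, hev 1 Phi'.1 a b = k * hev 1 Phi.1 a b) /\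
    (forall a b, hev 1 Phi'.2 a b = k * hev 1 Phi.2 a b).
Proof.
move=> /biholomorphismP [_ _ j] /biholomorphismP [_ _ j'] e.
have ei := e None; have et t := e (Some t).
rewrite /affine_coordinate !mulr0 !add0r !mulr1 in ei.
have et' t := et t; rewrite /affine_coordinate in et'.
have [k k0 [ka kb kc kd]] := @proportional_coordinates _
  (Phi.1 1%N 0%N) (Phi.1 0%N 1%N) (Phi.2 1%N 0%N) (Phi.2 0%N 1%N)
  (Phi'.1 1%N 0%N) (Phi'.1 0%N 1%N) (Phi'.2 1%N 0%N) (Phi'.2 0%N 1%N) j j' ei
  (fun t => ltac:(have := et' t; rewrite !mulr1; exact)).
by exists k => //; split=> a b; rewrite !hev1 ?ka ?kb ?kc ?kd; ring.
Qed.

Lemma normal_form_unique n w D w' H Phi Phi' W Q W' Q' : Dhclass n w -> divh w D ->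
    biholomorphism H -> tangent_to_homothety H -> same_foliation (pullback H w') w ->
    (forall e, affine_coordinate Phi e = affine_coordinate Phi' e) ->
    normal_form n w D Phi W Q -> normal_form n w' D Phi' W' Q' ->
  nform W Q = nform W' Q'.
Proof.
move=> hF hD bH [c c0 [lH1 lH2]] sH ac nf nf'.
have cop := leading_coprime hF hD nf.
case: nf => [bP sP [wW [oW _]] [hQ mQ] DE]; case: nf' => [bP' sP' [wW' [oW' _]] [hQ' mQ'] DE'].
have [k k0 [k1 k2]] := affine_coordinate_hev bP bP' ac.
have QQ := leading_unique bP bP' hQ hQ' mQ mQ' k0 k1 k2 DE DE'.
subst Q'; suff -> : W' = W by [].
(* A Weierstrass polynomial of degree 0 is 1. In positive degree w_0 is not constant, which the
   first order of the rigidity argument uses. *)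
case: n => [|n] in hF hD cop wW oW hQ mQ DE wW' oW' hQ' mQ' DE' *.
  case: wW => _ wW; case: wW' => _ wW'.
  by apply/funext => i; apply/funext => j; rewrite wW // wW'.
have [gP _ _] := (biholomorphismP Phi).1 bP.
have [gP' _ _] := (biholomorphismP Phi').1 bP'.
have [gH _ _] := (biholomorphismP H).1 bH.
have [G [_ gG PG GP]] := germ_inverse bP.
have [U U0 EP] := pullback_eq_mul sP.
have [U' U'0 EP'] := pullback_eq_mul sP'.
have [U'' U''0 EH] := pullback_eq_mul sH.
have gHG : germ (gcomp H G) by apply: germ_gcomp.
(* The conjugacy between the two normal forms. Its linear part is k c times the identity: k from the
   common affine coordinate, c from H. *)
pose Psi := gcomp Phi' (gcomp H G).
have gPsi : germ Psi by apply: germ_gcomp.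
have [Ui UUi] : exists g, pscomp U G.1 G.2 * g = 1.
  by apply: series2_inv; have [g1 g2] := gG; rewrite pscomp00.
have ww : (w.1, w.2) = w by case: (w).
have EG : pullback G w = (Ui * (nform W Q).1, Ui * (nform W Q).2).
  have : pullback G (pullback Phi (nform W Q)) = nform W Q.
    by rewrite (pullback_gcomp _ gP gG) PG pullback_gid.
  rewrite EP (pullback_mul _ _ _ gG) ww => e.
  have e1 : pscomp U G.1 G.2 * (pullback G w).1 = (nform W Q).1 := congr1 fst e.
  have e2 : pscomp U G.1 G.2 * (pullback G w).2 = (nform W Q).2 := congr1 snd e.
  rewrite -e1 -e2 !mulrA [Ui * _]mulrC UUi !mul1r.
  by case: (pullback G w).
have [V E] : exists V, pullback Psi (nform W' Q) = (V * (nform W Q).1, V * (nform W Q).2).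
  exists (pscomp (pscomp U' H.1 H.2 * U'') G.1 G.2 * Ui).
  rewrite -(pullback_gcomp _ gP' gHG) -(pullback_gcomp _ gH gG).
  exact: (pullback_unit gG (pullback_unit gH EP' EH) EG).
have hH a b : hev 1 H.1 a b = c * a /\ hev 1 H.2 a b = c * b.
  have l1 := congr1 (fun f : series2 R => (f 1%N 0%N, f 0%N 1%N)) lH1.
  have l2 := congr1 (fun f : series2 R => (f 1%N 0%N, f 0%N 1%N)) lH2.
  move: l1 l2; rewrite /linear_part /Xs /Ys /= => -[l1 l1'] [l2 l2'].
  by rewrite !hev1 l1 l1' l2 l2'; split; ring.
have hPsi a b : hev 1 Psi.1 a b = k * c * a /\ hev 1 Psi.2 a b = k * c * b.
  have [p1 p2] := gP'; have [q1 q2] := gHG; have [g1 g2] := gG; have [h1 h2] := gH.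
  have F1 : hev 1 (gcomp H G).1 a b = c * hev 1 G.1 a b :=
    etrans (hev_pscomp a b g1 g2 h1) (hH _ _).1.
  have F2 : hev 1 (gcomp H G).2 a b = c * hev 1 G.2 a b :=
    etrans (hev_pscomp a b g1 g2 h2) (hH _ _).2.
  have [e1 e2] := hev_gcomp_id a b gP gG PG.
  split; [apply: etrans (hev_pscomp a b q1 q2 p1) _ | apply: etrans (hev_pscomp a b q1 q2 p2) _].
    by rewrite F1 F2 k1 hevZ e1 expr1 mulrA.
  by rewrite F1 F2 k2 hevZ e2 expr1 mulrA.
have [[x1 x2] [y1 y2]] := (hPsi 1 0, hPsi 0 1).
rewrite !hev10 !mulr1 !mulr0 in x1 x2; rewrite !hev01 !mulr1 !mulr0 in y1 y2.
have kc0 : k * c != 0 by rewrite mulf_neq0.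
apply: (nform_rigidity (n := n) (lam := k * c) (Psi := Psi) (V := V) (Q := Q)) => //.
- by rewrite E.
- by rewrite E.
Qed.

End Uniqueness.

Theorem theorem5 (R : realType) (n : nat) (w : oneform R) (D : divisor R)
    (hF : Dhclass n w) (hD : divh w D) :
  (exists (Phi : germmap R) (W Q : series2 R), normal_form n w D Phi W Q)
  /\
  (forall (w' : oneform R) (H Phi Phi' : germmap R) (W Q W' Q' : series2 R),
     foliation w' ->
     biholomorphism H -> tangent_to_homothety H ->
     same_foliation (pullback H w') w ->
     (forall e, affine_coordinate Phi e = affine_coordinate Phi' e) ->
     normal_form n w D Phi W Q ->
     normal_form n w' D Phi' W' Q' ->
     nform W Q = nform W' Q').
Proof.
split; first exact: normal_form_exists.
move=> w' H Phi Phi' W Q W' Q' _ bH tH sH ac nf nf'.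
exact: (normal_form_unique hF hD bH tH sH ac nf nf').
Qed.
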